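(* Let $p$ be a polynomial on $\mathbf{C}^{n}$. The composed mapping \[ \mathcal{F} \circ {}^{t}r : \mathrm{Exp}'(V_{p}) \to \mathcal{O}_{\partial p}(\mathbf{C}^{n}) \] is a topological linear isomorphism if and only if $p$ is a reduced polynomial on $\mathbf{C}^{n}$.
   Context: $\mathcal{O}(\mathbf{C}^{n})$ is the space of entire functions on $\mathbf{C}^{n}$ with the topology of uniform convergence on compact subsets. For $A>0$ let $\|f\|_{A}=\sup\{|f(z)|\exp(-A|z|) ; z\in\mathbf{C}^{n}\}$, where $|z|=\sqrt{|z_1|^2+\dots+|z_n|^2}$, and let $E_{A}=\{f\in\mathcal{O}(\mathbf{C}^{n}) ; \|f\|_{A}<\infty\}$, a Banach space with norm $\|\cdot\|_{A}$. The space of entire functions of exponential type is $\mathrm{Exp}(\mathbf{C}^{n})=\mathrm{ind\,lim}_{A>0}E_{A}$ (the union of the $E_A$) with the (locally convex) inductive limit topology. $\mathrm{Exp}'(\mathbf{C}^{n})$ is its dual space (continuous linear functionals) with the strong dual topology. The Fourier-Borel transformation of $T\in\mathrm{Exp}'(\mathbf{C}^{n})$ is the function $\mathcal{F}(T)(z)=\langle T, e^{\langle z,\cdot\rangle}\rangle$, $z\in\mathbf{C}^n$, where $\langle z,w\rangle=z_1w_1+\dots+z_nw_n$ for $z,w\in\mathbf{C}^n$ and $\langle T,f\rangle=T(f)$. For a polynomial $p$ on $\mathbf{C}^n$ (complex coefficients), $V_{p}=\{z\in\mathbf{C}^{n} ; p(z)=0\}$. $\mathrm{Exp}(V_{p})$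 is the image of $\mathrm{Exp}(\mathbf{C}^{n})$ under the restriction map $r: f\mapsto f|_{V_p}$, equipped with the quotient topology of $r:\mathrm{Exp}(\mathbf{C}^{n})\to\mathrm{Exp}(V_{p})$. $\mathrm{Exp}'(V_{p})$ is its dual space with the strong dual topology, and ${}^{t}r:\mathrm{Exp}'(V_{p})\to\mathrm{Exp}'(\mathbf{C}^{n})$, ${}^{t}r(S)=S\circ r$, is the transposed mapping. $\partial p$ is the differential operator obtained by replacing each variable $z_{j}$ with $\partial/\partial z_{j}$ in $p$, and $\mathcal{O}_{\partial p}(\mathbf{C}^{n})=\{f\in\mathcal{O}(\mathbf{C}^{n}) ; \partial p(f)=0\}$ with the subspace topology from $\mathcal{O}(\mathbf{C}^n)$. A polynomial $p$ on $\mathbf{C}^n$ is called reduced if the principal ideal $\langle p\rangle$ it generates in the polynomial ring $\mathbf{C}[z_1,\dots,z_n]$ is a reduced (radical) ideal, i.e. $\langle p\rangle=\sqrt{\langle p\rangle}$. *)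

(* Defs.v *)
From HB Require Import structures.
From mathcomp Require Import all_boot all_order all_algebra.
From mathcomp Require Import complex.
From mathcomp Require mpoly.
(* The notations of mpoly clash with those of mathcomp-analysis. *)
Import -(notations) mpoly.
From mathcomp Require Import all_classical all_reals all_analysis.
From mathcomp Require Import ring lra.


Set Implicit Arguments.
Unset Strict Implicit.
Unset Printing Implicit Defensive.

Import Order.TTheory GRing.Theory Num.Theory.
Import numFieldNormedType.Exports.

Local Open Scope classical_set_scope.
Local Open Scope ring_scope.
Local Open Scope complex_scope.

(* The usual topology of the complex plane, as a normed space over itself. *)
HB.instance Definition _ (R : realType) := NormedModule.copy R[i] R[i]^o.

Local Notation normc := ComplexField.Normc.normc.

Section complex_exponential.
Variable R : realType.
Implicit Types z w : R[i].

Definition cexp z : R[i] :=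
  let: x +i* y := z in (expR x * cos y) +i* (expR x * sin y).

Lemma cexp0 : cexp 0 = 1.
Proof. by rewrite /cexp /= expR0 cos0 sin0 mulr1 mulr0. Qed.

Lemma cexpD z w : cexp (z + w) = cexp z * cexp w.
Proof.
case: z w => [a b] [c d]; rewrite /cexp /=.
by apply/eqP; rewrite eq_complex /= expRD cosD sinD; apply/andP; split;
  apply/eqP; ring.
Qed.

Lemma normc_cexp z : normc (cexp z) = expR (complex.Re z).
Proof.
case: z => a b; rewrite /cexp /= !exprMn -mulrDr cos2Dsin2 mulr1.
by rewrite sqrtr_sqr ger0_norm ?expR_ge0.
Qed.

Lemma normr_normc z : `|z| = (normc z)%:C.
Proof. by []. Qed.

Lemma normc_ge0 z : 0 <= normc z.
Proof. by case: z => a b; exact: sqrtr_ge0. Qed.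

Lemma normc_le_ReIm z : normc z <= `|complex.Re z| + `|complex.Im z|.
Proof.
case: z => a b /=; rewrite -[leRHS]ger0_norm ?addr_ge0// -sqrtr_sqr.
rewrite ler_sqrt ?sqr_ge0// sqrrD !real_normK ?num_real//.
by rewrite lerD2r lerDl mulrn_wge0 ?mulr_ge0.
Qed.

Lemma Re_le_normc z : `|complex.Re z| <= normc z.
Proof.
case: z => a b /=; rewrite -sqrtr_sqr ler_sqrt ?addr_ge0 ?sqr_ge0//.
by rewrite lerDl sqr_ge0.
Qed.

Lemma Im_le_normc z : `|complex.Im z| <= normc z.
Proof.
case: z => a b /=; rewrite -sqrtr_sqr ler_sqrt ?addr_ge0 ?sqr_ge0//.
by rewrite lerDr sqr_ge0.
Qed.

Lemma is_derive0_le (f : R -> R) d : is_derive (0 : R) 1 f d ->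
  forall e, 0 < e -> exists2 t, 0 < t &
    forall x, `|x| < t -> `|f x - f 0 - d * x| <= e * `|x|.
Proof.
move=> [df <-] e e0.
have /cvgrPdist_le/(_ e e0) := df.
move=> [t /= t0 tP]; exists t => // x xt.
have [->|x0] := eqVneq x 0; first by rewrite mulr0 !subr0 subrr normr0 mulr0.
have := tP x; rewrite /ball_ /= sub0r normrN => /(_ xt x0).
rewrite addr0 [x *: 1]mulr1 => h.
rewrite -ler_pdivrMr ?normr_gt0// -normfV -normrM.
rewrite distrC in h; apply: le_trans h; rewrite le_eqVlt; apply/orP; left.
apply/eqP; congr `|_|; rewrite mulrBl mulfK// mulrC; congr (_ - _).
Qed.

Lemma cexp_near0 e : 0 < e -> exists2 t, 0 < t &
  forall z, normc z < t -> normc (cexp z - 1 - z) <= e * normc z.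
Proof.
move=> e0.
have [d [d0 d1 de]] : exists d : R, [/\ 0 < d, d <= 1 & 8%:R * d <= e].
  exists (Num.min 1 (e / 8%:R)); split.
  - by rewrite lt_min ltr01 divr_gt0.
  - by rewrite ge_min lexx.
  - by rewrite mulrC -ler_pdivlMr// ge_min lexx orbT.
have [t1 t10 E] := is_derive0_le (is_derive_expR 0) d0.
have [t2 t20 K] := is_derive0_le (is_derive_cos 0) d0.
have [t3 t30 S] := is_derive0_le (is_derive_sin 0) d0.
exists (Num.min d (Num.min t1 (Num.min t2 t3))).
  by rewrite !lt_min d0 t10 t20 t30.
case=> x y; set h := normc _; rewrite !lt_min => /and4P[hd h1 h2 h3].
have xh : `|x| <= h := Re_le_normc (x +i* y).
have yh : `|y| <= h := Im_le_normc (x +i* y).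
have {}E := E _ (le_lt_trans xh h1).
have {}K := K _ (le_lt_trans yh h2).
have {}S := S _ (le_lt_trans yh h3).
rewrite expR0 mul1r in E; rewrite cos0 sin0 oppr0 mul0r subr0 in K.
rewrite sin0 cos0 subr0 mul1r in S.
have x1 : `|x| <= d by rewrite (le_trans xh)// ltW.
have A1 : `|expR x * cos y - 1 - x| <= 3%:R * d * h.
  have -> : expR x * cos y - 1 - x
    = (expR x - 1 - x) * cos y + (1 + x) * (cos y - 1) by ring.
  rewrite (le_trans (ler_normD _ _))// !normrM.
  have : `|expR x - 1 - x| * `|cos y| <= d * h * 1.
    apply: ler_pM => //; last by rewrite ler_norml cos_geN1 cos_le1.
    by rewrite (le_trans E)// ler_wpM2l// ltW.
  have : `|1 + x| * `|cos y - 1| <= 2%:R * (d * h).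
    apply: ler_pM => //; last by rewrite (le_trans K)// ler_wpM2l// ltW.
    by rewrite (le_trans (ler_normD _ _))// normr1 (_ : 2%:R = 1 + 1)// lerD2l (le_trans x1).
  lra.
have A2 : `|expR x * sin y - y| <= 5%:R * d * h.
  have -> : expR x * sin y - y
    = (expR x - 1) * sin y + (sin y - y) by ring.
  rewrite (le_trans (ler_normD _ _))// normrM.
  have B1 : `|expR x - 1| <= 2%:R * d.
    have -> : expR x - 1 = (expR x - 1 - x) + x by ring.
    rewrite (le_trans (ler_normD _ _))//.
    have : d * `|x| <= 1 * `|x| by rewrite ler_wpM2r.
    lra.
  have B2 : `|sin y| <= 2%:R * h.
    have -> : sin y = (sin y - y) + y by ring.
    rewrite (le_trans (ler_normD _ _))//.
    have : d * `|y| <= 1 * `|y| by rewrite ler_wpM2r.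
    lra.
  have : `|expR x - 1| * `|sin y| <= 2%:R * d * (2%:R * h) by apply: ler_pM.
  have : d * `|y| <= d * h by rewrite ler_wpM2l// ltW.
  lra.
have -> : cexp (x +i* y) - 1 - (x +i* y) =
    (expR x * cos y - 1 - x) +i* (expR x * sin y - y).
  by apply/eqP; rewrite eq_complex /= subr0 !eqxx.
rewrite (le_trans (normc_le_ReIm _))//=.
have h0 : 0 <= h := normc_ge0 _.
have : 8%:R * d * h <= e * h by rewrite ler_wpM2r.
lra.
Qed.

Lemma is_derive_cexp z : is_derive z (1 : R[i]) (@cexp : R[i] -> R[i]) (cexp z).
Proof.
have H : (fun h : R[i] => h^-1 *: (cexp (h *: 1 + z) - cexp z)) @ 0^' --> cexp z.
  apply/cvgrPdist_le => e e0.
  have [e' ee' e'0] : exists2 e' : R, e = e'%:C & 0 < e'.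
    case: e e0 => a b; rewrite ltcE /= => /andP[/eqP -> a0].
    by exists a.
  have [t t0 tP] := cexp_near0 (divr_gt0 e'0 (expR_gt0 (complex.Re z))).
  exists t%:C => /=; first by rewrite ltcR.
  move=> h /=; rewrite sub0r normrN normr_normc ltcR => ht h0.
  rewrite [h *: 1]mulr1 cexpD [_ *: _]mulrC.
  have -> : cexp z - (cexp h * cexp z - cexp z) / h =
            - (cexp z * ((cexp h - 1 - h) / h)).
    by field.
  rewrite normrN !normrM normfV !normr_normc normc_cexp ee'.
  rewrite -[_^-1]fmorphV -!rmorphM lecR.
  have hn : 0 < normc h by rewrite lt_neqAle normc_ge0 andbT eq_sym; apply: contra h0 => /eqP/ComplexField.Normc.eq0_normc ->.
  rewrite mulrA ler_pdivrMr// mulrC -ler_pdivlMr ?expR_gt0// mulrAC.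
  exact: tP.
apply: DeriveDef; first by apply/cvg_ex; exists (cexp z).
exact/cvg_lim.
Qed.

End complex_exponential.

Section entire_functions.
Variables (R : realType) (n : nat).
Local Notation C := R[i].
Local Notation Cn := 'rV[R[i]]_n.
Implicit Types (z w : Cn) (f g : Cn -> C) (p : mpoly n C).

(* Frechet differentiability over the field [R[i]], i.e. holomorphy. *)
Definition entire : set (Cn -> C) :=
  [set f | forall z : Cn, differentiable f z].

Definition partial (j : 'I_n) f : Cn -> C := 'D_(delta_mx 0 j) f.

Definition mpartial (m : multinom n) f : Cn -> C :=
  foldr (fun j => iter (m j) (partial j)) f (enum 'I_n).

Definition dpoly p f : Cn -> C := \sum_(m <- msupp p) mcoeff m p *: mpartial m f.

(* Functions carry the topology of uniform convergence on compact sets. *)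
Definition entire_ker p : set {family compact, Cn -> C} :=
  [set f | entire f /\ dpoly p f = 0].

Definition enorm z : R := Num.sqrt (\sum_j normc (z 0 j) ^+ 2).

(* Extended-real valued, [+oo] when the supremum is infinite. *)
Definition expnorm (A : R) f : \bar R :=
  ereal_sup (range (fun z => (normc (f z) * expR (- (A * enorm z)))%:E)).

Definition dotC z w : C := \sum_j z 0 j * w 0 j.

(* [expker z] is the function w |-> exp <z, w>, with a bilinear pairing. *)
Definition expker z : Cn -> C := fun w => cexp (dotC z w).

Definition expA (A : R) : set (Cn -> C) :=
  [set f | entire f /\ (expnorm A f < +oo)%E].

Definition exptype : {pred Cn -> C} :=
  mem (\bigcup_(A in [set A : R | 0 < A]) expA A).

Lemma enorm_ge0 z : 0 <= enorm z.
Proof. exact: sqrtr_ge0. Qed.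

Lemma coord_le_enorm z j : normc (z 0 j) <= enorm z.
Proof.
rewrite -[leLHS]ger0_norm ?normc_ge0// -sqrtr_sqr ler_sqrt.
  by rewrite (bigD1 j)//= lerDl sumr_ge0// => i _; rewrite exprn_ge0// normc_ge0.
by rewrite sumr_ge0// => i _; rewrite exprn_ge0// normc_ge0.
Qed.

Lemma expnorm_ltyP A f : (expnorm A f < +oo)%E <->
  exists M : R, forall z, normc (f z) <= M * expR (A * enorm z).
Proof.
split=> [foo|[M fM]].
  have f0 : (-oo < expnorm A f)%E.
    apply: (@lt_le_trans _ _ (normc (f 0) * expR (- (A * enorm 0)))%:E).
      by rewrite ltNyr.
    by apply: ereal_sup_ubound; exists 0.
  exists (fine (expnorm A f)) => z.
  rewrite -ler_pdivrMr ?expR_gt0// -expRN -lee_fin fineK.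
    by apply: ereal_sup_ubound; exists z.
  by rewrite fin_numE gt_eqF// lt_eqF.
apply: (@le_lt_trans _ _ M%:E); last exact: ltry.
apply: ge_ereal_sup => _ [z _ <-].
by rewrite lee_fin expRN ler_pdivrMr ?expR_gt0.
Qed.

Lemma expnormZ_le A a f (d : R) : (expnorm A f <= d%:E)%E ->
  (expnorm A (a *: f) <= (normc a * d)%:E)%E.
Proof.
move=> fd; apply: ge_ereal_sup => _ [z _ <-]; rewrite lee_fin /=.
rewrite (ComplexField.Normc.normcM a) -mulrA.
rewrite ler_wpM2l ?normc_ge0// -lee_fin (le_trans _ fd)//.
by apply: ereal_sup_ubound; exists z.
Qed.

Lemma expnorm_lt_le A f (d : R) : (expnorm A f < d%:E)%E ->
  exists2 c : R, 0 <= c < d & (expnorm A f <= c%:E)%E.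
Proof.
have f0 : (0%:E <= expnorm A f)%E.
  apply: (@le_trans _ _ (normc (f 0) * expR (- (A * enorm 0)))%:E).
    by rewrite lee_fin mulr_ge0 ?normc_ge0 ?expR_ge0.
  by apply: ereal_sup_ubound; exists 0.
case: (expnorm A f) f0 => [c||]//; rewrite lee_fin lte_fin => c0 cd.
by exists c => //; rewrite c0 cd.
Qed.

Lemma exptypeP f : f \in exptype <-> entire f /\
  exists A M : R, forall z, normc (f z) <= M * expR (A * enorm z).
Proof.
rewrite inE; split=> [[A A0 [fe /expnorm_ltyP[M fM]]]|[fe [A [M fM]]]].
  by split => //; exists A, M.
exists (Num.max 1 A); first by rewrite /= lt_max ltr01.
split => //; apply/expnorm_ltyP; exists M => z; apply: (le_trans (fM z)).
have M0 : 0 <= M.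
  by rewrite -(pmulr_lge0 _ (expR_gt0 (A * enorm z))) (le_trans _ (fM z))// normc_ge0.
by rewrite ler_wpM2l// ler_expR ler_wpM2r ?enorm_ge0// le_max lexx orbT.
Qed.

Lemma exptype_submod_closed : submod_closed exptype.
Proof.
split.
  apply/exptypeP; split; first by move=> z; exact: differentiable_cst.
  by exists 0, 0 => z; rewrite mul0r ComplexField.Normc.normc0.
move=> a f g /exptypeP[fe [A [M fM]]] /exptypeP[ge [B [N gN]]].
apply/exptypeP; split.
  by move=> z; apply: differentiableD => //; exact: differentiableZ.
exists (Num.max A B), (normc a * M + N) => z.
have M0 : 0 <= M.
  by rewrite -(pmulr_lge0 _ (expR_gt0 (A * enorm z))) (le_trans _ (fM z))// normc_ge0.
have N0 : 0 <= N.
  by rewrite -(pmulr_lge0 _ (expR_gt0 (B * enorm z))) (le_trans _ (gN z))// normc_ge0.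
apply: (le_trans (le_normcD _ _)); rewrite ComplexField.Normc.normcM mulrDl -mulrA.
apply: lerD; [apply: ler_wpM2l; first exact: normc_ge0|].
  apply: (le_trans (fM z)).
  by rewrite ler_wpM2l// ler_expR ler_wpM2r ?enorm_ge0// le_max lexx.
apply: (le_trans (gN z)).
by rewrite ler_wpM2l// ler_expR ler_wpM2r ?enorm_ge0// le_max lexx orbT.
Qed.

Lemma differentiable_dotC z w : differentiable (dotC z) w.
Proof.
have -> : dotC z = \sum_j (fun w : Cn => z 0 j *: (w 0 j : C)).
  by apply/funext => u; rewrite fct_sumE.
apply: differentiable_sum => j.
apply: differentiableZ; exact: differentiable_coord.
Qed.

Lemma expker_exptype z : expker z \in exptype.
Proof.
apply/exptypeP; split.
  move=> w; apply: differentiable_comp; first exact: differentiable_dotC.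
  by apply/derivable1_diffP; have [] := is_derive_cexp (dotC z w).
exists (\sum_j normc (z 0 j)), 1 => w; rewrite mul1r normc_cexp ler_expR.
apply: (le_trans (ler_norm _)); apply: (le_trans (Re_le_normc _)).
rewrite /dotC mulr_suml; elim/big_ind2 : _ => //.
- by rewrite ComplexField.Normc.normc0.
- by move=> x1 x2 y1 y2 h1 h2; rewrite (le_trans (le_normcD _ _))// lerD.
- by move=> j _; rewrite ComplexField.Normc.normcM ler_wpM2l ?normc_ge0 ?coord_le_enorm.
Qed.

End entire_functions.

Section polynomials.
Variables (R : realType) (n : nat).
Local Notation C := R[i].
Implicit Types (p : mpoly n C) (I : set (mpoly n C)).

Definition zeros p : set 'rV[C]_n := [set z | meval (fun j => z 0 j) p = 0].

Definition principal_ideal p : set (mpoly n C) := [set a * p | a in setT].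

Definition radical I : set (mpoly n C) :=
  [set q | exists2 k, (0 < k)%N & I (q ^+ k)].

Definition reduced p : Prop := principal_ideal p = radical (principal_ideal p).

End polynomials.

Section strong_dual_space.
Variable R : realType.
Local Notation C := R[i].
Variable E : preTopologicalLmodType C.

(* von Neumann boundedness: [B] is absorbed by every neighbourhood of 0. *)
Definition tvs_bounded (B : set E) : Prop :=
  forall U : set E, nbhs 0 U ->
  exists2 r : C, 0 < r & forall c : C, r <= `|c| -> B `<=` [set c *: x | x in U].

Definition continuous_functional : {pred E -> C} :=
  mem [set u : E -> C | scalar u /\ continuous u].

Lemma continuous_functional_submod_closed : submod_closed continuous_functional.
Proof.
split.
  rewrite inE /=; split; first by move=> a x y /=; rewrite mulr0 addr0.
  by move=> x; exact: cvg_cst.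
move=> a u v /set_mem[ul uc] /set_mem[vl vc]; apply: mem_set; split.
  move=> b x y; rewrite /= -[LHS]/(a * u _ + v _) ul vl.
  by rewrite -[RHS]/(b * (a * _ + _) + _) !mulrDr !(mulrCA b) addrACA.
move=> x; apply: (@cvgD _ C); last exact: vc.
by apply: (@cvgZr _ C); exact: uc.
Qed.

HB.instance Definition _ :=
  GRing.isSubmodClosed.Build C (E -> C) continuous_functional
    continuous_functional_submod_closed.

Definition strong_dual : Type := {u : E -> C | u \in continuous_functional}.

HB.instance Definition _ := SubChoice.on strong_dual.
HB.instance Definition _ := [SubChoice_isSubLmodule of strong_dual by <:].

(* The strong topology: uniform convergence on the bounded subsets of [E]. *)
HB.instance Definition _ := Topological.copy strong_dual
  (initial_topology (\val : strong_dual -> {family tvs_bounded, E -> C})).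

End strong_dual_space.

Section exp_space.
Variables (R : realType) (n : nat).
Local Notation C := R[i].
Local Notation Cn := 'rV[R[i]]_n.

HB.instance Definition _ :=
  GRing.isSubmodClosed.Build C (Cn -> C) (@exptype R n)
    (@exptype_submod_closed R n).

Definition Exp : Type := {f : Cn -> C | f \in @exptype R n}.

HB.instance Definition _ := SubChoice.on Exp.
HB.instance Definition _ := [SubChoice_isSubLmodule of Exp by <:].

(* The convex sets meeting every step [E_A] of the inductive system in a
   neighbourhood of 0 form a base of neighbourhoods of 0 for the finest locally
   convex topology making all the inclusions [E_A -> Exp] continuous; see
   [indlim_universal] below. As [expnorm A] is infinite outside [E_A], the
   membership of [f] in [E_A] is implicit. *)
Definition indlim_nbhs0 (W : set Exp) : Prop :=
  convex_set W /\
  forall A : R, 0 < A -> exists2 e : R, 0 < e &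
    forall f : Exp, (expnorm A (\val f) < e%:E)%E -> W f.

Definition indlim_open (U : set Exp) : Prop :=
  forall f, U f -> exists2 W, indlim_nbhs0 W & forall g, W g -> U (f + g).

Lemma indlim_openT : indlim_open setT.
Proof.
move=> f _; exists setT => //; split; first by move=> *; rewrite inE.
by move=> A A0; exists 1.
Qed.

Lemma indlim_nbhs0I (V W : set Exp) :
  indlim_nbhs0 V -> indlim_nbhs0 W -> indlim_nbhs0 (V `&` W).
Proof.
move=> [c1 n1] [c2 n2]; split.
  move=> x y l; rewrite !in_setI => /andP[x1 x2] /andP[y1 y2].
  by rewrite c1// c2.
move=> A A0; have [e e0 eW1] := n1 A A0; have [d d0 dW2] := n2 A A0.
exists (Num.min e d); first by rewrite lt_min e0.
move=> g; rewrite EFin_min lt_min => /andP[ge gd].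
by split; [exact: eW1|exact: dW2].
Qed.

Lemma indlim_openI : setI_closed indlim_open.
Proof.
move=> U V oU oV f [/oU[W1 n1 W1U] /oV[W2 n2 W2V]].
exists (W1 `&` W2); first exact: indlim_nbhs0I.
by move=> g [/W1U ? /W2V].
Qed.

Lemma indlim_open_bigU (I : Type) (U : I -> set Exp) :
  (forall i, indlim_open (U i)) -> indlim_open (\bigcup_i U i).
Proof.
move=> oU f [i _ /oU[W nW WU]]; exists W => // g Wg.
by exists i => //; exact: WU.
Qed.

HB.instance Definition _ :=
  isOpenTopological.Build Exp indlim_openT indlim_openI indlim_open_bigU.

Lemma indlim_nbhs0Z (W : set Exp) (M : R) : indlim_nbhs0 W ->
  indlim_nbhs0 [set f | forall c : C, normc c <= M -> W (c *: f)].
Proof.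
move=> [cW nW]; split.
  move=> f g l /set_mem fW /set_mem gW; apply: mem_set => c cM.
  have -> : c *: (l%:num *: f + (1 - l%:num) *: g) =
            l%:num *: (c *: f) + (1 - l%:num) *: (c *: g).
    by rewrite scalerDr !scalerA !(mulrC c).
  by apply/set_mem/(cW _ _ l); apply/mem_set; [exact: fW|exact: gW].
move=> A A0; have [e e0 eW] := nW A A0.
have M0 : 0 < 1 + `|M| by rewrite ltr_pwDl.
exists (e / (1 + `|M|)); first by rewrite divr_gt0.
move=> f /expnorm_lt_le[d /andP[d0 de] fd] c cM; apply: eW.
apply: (le_lt_trans (expnormZ_le c fd)); rewrite lte_fin.
apply: (@le_lt_trans _ _ ((1 + `|M|) * d)).
  by rewrite ler_wpM2r// (le_trans cM)// (le_trans (ler_norm _))// lerDr.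
by rewrite mulrC -ltr_pdivlMr.
Qed.

Lemma indlim_nbhs0_half (W : set Exp) : indlim_nbhs0 W ->
  exists2 V, indlim_nbhs0 V & forall f g, V f -> V g -> W (f + g).
Proof.
move=> nW; exists [set f | forall c : C, normc c <= 2 -> W (c *: f)].
  exact: indlim_nbhs0Z.
have n2 : normc (2 : C) <= 2 by rewrite -lecR -normr_normc normr_nat rmorph_nat.
move=> f g /(_ _ n2) fW /(_ _ n2) gW.
have h1 : (2^-1 : C) <= 1 by rewrite invf_le1// ler1n.
have h0 : 0 <= (2^-1 : C) by rewrite invr_ge0.
have /set_mem := nW.1 (2 *: f) (2 *: g) (Itv01 h0 h1) (mem_set fW) (mem_set gW).
have h2 : 1 - (2^-1 : C) = 2^-1 by field.
rewrite -[X in W X -> _]/(2^-1 *: (2 *: f) + (1 - 2^-1) *: (2 *: g)).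
by rewrite h2 !scalerA mulVf// !scale1r.
Qed.

Lemma indlim_nbhs0_absorb (W : set Exp) f : indlim_nbhs0 W ->
  exists2 t : R, 0 < t & forall c, normc c < t -> W (c *: f).
Proof.
move=> [_ nW]; have [A A0 [_ fA]] := set_mem (valP f).
have [d d0 fd] : exists2 d : R, 0 < d & (expnorm A (\val f) <= d%:E)%E.
  case: (expnorm A (\val f)) fA => [r||]//= _.
    by exists (`|r| + 1); [rewrite ltr_wpDl|rewrite lee_fin (le_trans (ler_norm _))// lerDl].
  by exists 1; rewrite ?leNye.
have [e e0 eW] := nW A A0; exists (e / d); first exact: divr_gt0.
move=> c ce; apply: eW; apply: (le_lt_trans (expnormZ_le c fd)).
by rewrite lte_fin -ltr_pdivlMr.
Qed.

Lemma indlim_nbhsP f (V : set Exp) :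
  nbhs f V <-> exists2 W, indlim_nbhs0 W & forall g, W g -> V (f + g).
Proof.
split=> [|[W nW WV]].
  rewrite nbhsE => -[U [oU Uf] UV]; have [W nW WU] := oU f Uf.
  by exists W => // g /WU /UV.
have W0 (X : set Exp) : indlim_nbhs0 X -> X 0.
  move=> /(indlim_nbhs0_absorb 0)[t t0 /(_ 0)]; rewrite scaler0; apply.
  by rewrite ComplexField.Normc.normc0.
rewrite nbhsE; exists [set g | exists2 X, indlim_nbhs0 X &
    forall h, X h -> V (g + h)].
  split; last by exists W.
  move=> g [X nX XV]; have [Y nY YX] := indlim_nbhs0_half nX.
  by exists Y => // h Yh; exists Y => // k Yk; rewrite -addrA; exact/XV/YX.
by move=> g [X /W0 X0 /(_ _ X0)]; rewrite addr0.
Qed.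

Lemma Exp_add_continuous : continuous (fun x : Exp * Exp => x.1 + x.2).
Proof.
move=> [f g] U /indlim_nbhsP[W nW WU]; have [V nV VW] := indlim_nbhs0_half nW.
exists ([set h | V (h - f)], [set h | V (h - g)]) => /=.
  by split; apply/indlim_nbhsP; exists V => // h /=; rewrite addrAC subrr add0r.
move=> [h k] /= [Vh Vk]; have /WU := VW _ _ Vh Vk.
by rewrite addrACA !(addrC f) !(addrC g) !subrK.
Qed.

Lemma Exp_scale_continuous : continuous (fun x : C^o * Exp => x.1 *: x.2).
Proof.
move=> [c f] U /indlim_nbhsP[W nW WU]; have [V nV VW] := indlim_nbhs0_half nW.
have [t t0 tV] := indlim_nbhs0_absorb f nV.
have nX := indlim_nbhs0Z (normc c + t) nV.
exists ([set d : C | `|c - d| < t%:C],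
        [set h | forall d : C, normc d <= normc c + t -> V (d *: (h - f))]) => /=.
  split; first by exists t%:C => //=; rewrite ltcR.
  apply/indlim_nbhsP; eexists; first exact: nX.
  by move=> h hV d /hV; rewrite addrAC subrr add0r.
move=> [d h] /= []; rewrite distrC normr_normc ltcR => cd hV.
have dn : normc d <= normc c + t.
  rewrite -[d](subrK c) addrC (le_trans (le_normcD _ _))// lerD2l.
  exact: ltW.
have /WU := VW _ _ (tV _ cd) (hV _ dn).
by rewrite /= scalerBr scalerBl addrA (addrC (c *: f)) subrK addrC subrK.
Qed.

Lemma Exp_locally_convex : exists2 B : set_system Exp,
  (forall b, b \in B -> convex_set b) & basis B.
Proof.
exists [set U | open U /\ convex_set U]; first by move=> U /set_mem[].
split=> [U []//|f V /indlim_nbhsP[W nW WV]].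
pose U := [set g | exists2 X, indlim_nbhs0 X & forall h, X h -> W (g + h - f)].
exists U; last first.
  move=> g [X nX XW]; have [t t0 /(_ 0)] := indlim_nbhs0_absorb 0 nX.
  rewrite scaler0 ComplexField.Normc.normc0 => /(_ t0)/XW/WV.
  by rewrite addr0 addrC subrK.
split; last by exists W => // h; rewrite addrAC subrr add0r.
split.
  move=> g [X nX XW]; have [Y nY YX] := indlim_nbhs0_half nX.
  exists Y => // h Yh; exists Y => // k Yk; rewrite -(addrA g).
  exact/XW/YX.
move=> g h l /set_mem[X nX XW] /set_mem[Y nY YW]; apply/mem_set.
exists (X `&` Y); first exact: indlim_nbhs0I.
move=> k [Xk Yk].
have -> : l%:num *: g + (1 - l%:num) *: h + k - f =
    l%:num *: (g + k - f) + (1 - l%:num) *: (h + k - f).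
  have e x : l%:num *: x + (1 - l%:num) *: x = x :> Exp.
    by rewrite -scalerDl addrC subrK scale1r.
  by rewrite -addrA -[in LHS](e (k - f)) addrACA -!scalerDr !addrA.
by apply/set_mem/(nW.1 _ _ l); apply/mem_set; [exact: XW|exact: YW].
Qed.

HB.instance Definition _ := PreTopologicalLmod_isTvs.Build C Exp
  Exp_add_continuous Exp_scale_continuous Exp_locally_convex.

(* The universal property of the locally convex inductive limit. *)
Lemma indlim_universal (F : tvsType C) (u : {linear Exp -> F}) :
  continuous u <->
  forall A : R, 0 < A -> forall V : set F, nbhs 0 V ->
    exists2 e : R, 0 < e &
      forall f : Exp, (expnorm A (\val f) < e%:E)%E -> V (u f).
Proof.
split=> [uc A A0 V V0|uA f V Vf].
  have : nbhs (0 : Exp) (u @^-1` V) by apply: uc; rewrite linear0.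
  move=> /indlim_nbhsP[W [_ /(_ A A0)[e e0 eW]] WV].
  by exists e => // f /eW/WV; rewrite add0r.
have : nbhs 0 [set x | V (u f + x)].
  have := nbhsB (- u f) Vf; rewrite addNr; apply: filterS.
  by move=> _ [x Vx <-] /=; rewrite addrA subrr add0r.
have [B cB [Bo Bb]] := @locally_convex C F.
move=> /Bb[b [Bb' b0] bV].
apply/indlim_nbhsP; exists (u @^-1` b).
  split.
    move=> g h l /set_mem gb /set_mem hb; apply/mem_set => /=.
    rewrite linearD !linearZ; apply/set_mem/(cB b (mem_set Bb') _ _ l); exact: mem_set.
  by move=> A A0; apply: uA => //; apply: open_nbhs_nbhs; split=> //; exact: Bo.
by move=> g /bV /=; rewrite linearD.
Qed.

Definition expkerE (z : Cn) : Exp := exist _ (expker z) (expker_exptype z).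

Definition fourier_borel (T : strong_dual Exp) : {family compact, Cn -> C} :=
  fun z => \val T (expkerE z).

Section on_zeros.
Variable p : mpoly n C.

Definition restr (f : Exp) : zeros p -> C := fun z => \val f (\val z).

Definition exptypeV : {pred zeros p -> C} := mem (range restr).

Lemma exptypeV_submod_closed : submod_closed exptypeV.
Proof.
split; first by rewrite inE; exists 0.
move=> a _ _ /set_mem[f _ <-] /set_mem[g _ <-].
by rewrite inE; exists (a *: f + g).
Qed.

HB.instance Definition _ :=
  GRing.isSubmodClosed.Build C (zeros p -> C) exptypeV exptypeV_submod_closed.

Definition ExpV : Type := {f : zeros p -> C | f \in exptypeV}.

HB.instance Definition _ := SubChoice.on ExpV.
HB.instance Definition _ := [SubChoice_isSubLmodule of ExpV by <:].

Definition resV (f : Exp) : ExpV := exist _ (restr f) (mem_set (imageT restr f)).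

Lemma resV_linear : linear resV.
Proof. by move=> a f g; apply: val_inj. Qed.

HB.instance Definition _ := GRing.isLinear.Build C Exp ExpV *:%R resV resV_linear.

(* The quotient topology of [resV]. *)
Definition quot_open (U : set ExpV) : Prop := open (resV @^-1` U).

Lemma quot_openT : quot_open setT.
Proof. by rewrite /quot_open preimage_setT; exact: openT. Qed.

Lemma quot_openI : setI_closed quot_open.
Proof. by move=> U V; exact: openI. Qed.

Lemma quot_open_bigU (I : Type) (U : I -> set ExpV) :
  (forall i, quot_open (U i)) -> quot_open (\bigcup_i U i).
Proof. by move=> oU; apply: bigcup_open => i _; exact: oU. Qed.

HB.instance Definition _ :=
  isOpenTopological.Build ExpV quot_openT quot_openI quot_open_bigU.

Lemma resV_continuous : continuous resV.
Proof. exact/continuousP. Qed.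

Lemma transpose_subproof (S : strong_dual ExpV) :
  \val S \o resV \in @continuous_functional R Exp.
Proof.
have [Sl Sc] := set_mem (valP S); apply: mem_set; split.
  by move=> a f g /=; rewrite linearP Sl.
by move=> f; apply: continuous_comp; [exact: resV_continuous|exact: Sc].
Qed.

Definition transpose_resV (S : strong_dual ExpV) : strong_dual Exp :=
  exist _ (\val S \o resV) (transpose_subproof S).

End on_zeros.

End exp_space.

Section top_linear_iso.
Variable R : realType.
Local Notation C := R[i].

HB.instance Definition _ (U : choiceType) (fam : set U -> Prop) :=
  GRing.Lmodule.copy {family fam, U -> C} (U -> C).

(* [Phi] is an isomorphism of topological vector spaces from [E] onto the
   subspace [A] of [F]; [{within A, continuous g}] is continuity of the inverse
   for the subspace topology of [A]. *)
Definition top_linear_iso_onto (E F : preTopologicalLmodType C) (A : set F)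
    (Phi : E -> F) : Prop :=
  [/\ linear Phi, set_bij setT A Phi, continuous Phi &
      exists2 g : F -> E, cancel Phi g & {within A, continuous g}].

End top_linear_iso.

(* Main.v *)
From HB Require Import structures.
Require Import Defs.
From mathcomp Require Import all_boot all_order all_algebra.
From mathcomp Require Import complex.
From mathcomp Require mpoly.
(* Without the notations, some of which clash with later ones. *)
Import -(notations) mpoly.
From mathcomp Require Import all_classical all_reals all_analysis.
From mathcomp Require Import separable ring lra.

(** The value at [z] of the composed mapping at a functional [S] is
    [S (exp <z, .>)], the exponential being restricted to the zero set [V] of [p].

    A continuous functional [T] on [Exp] can be recovered from its transform [u]:
    [T] takes the monomial of exponent [a] to [a!] times the Taylor coefficient of
    [u] of index [a], so [T f] is a pairing of the Taylor coefficients of [f] and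
    [u].  By Cauchy's estimates the pairing of any entire [u] with the functions of
    exponential type converges and is continuous, and for [f] in a given step of
    the inductive system it is bounded by the maximum of [u] on one polycircle.
    Hence the Fourier-Borel transformation maps the dual of [Exp] bijectively onto
    the space of all entire functions ([fourier_borel_bound],
    [fourier_borel_surj]).  Differentiation under the functional shows that
    [dpoly p u] is the transform of [f |-> T (p f)] ([dpoly_fourier_borel]), so
    [dpoly p u = 0] means that [T] kills the multiples of [p].  On the other hand
    [T] comes from a functional on [V] if and only if it kills all the functions
    that vanish on [V].  So the mapping is onto as soon as every function of
    exponential type that vanishes on [V] is a multiple of [p].

    For a reduced [p] this is the division theorem [exp_division].  There is a
    direction [v] for which [p (z + t v)] has a constant leading coefficient [c] as
    a polynomial in [t]; as [p] is reduced, the roots are simple for generic [z].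
    If [f] vanishes on [V], then for generic [z] the mean of
    [f (z + t v) / p (z + t v)] over a large circle is [f z / p z] by partial
    fractions, and this mean is holomorphic in all [z].  The quotient [g] is of
    exponential type because [|c| |g z|] is at most the maximum of
    [|p g|] at the points [z + t v] with [|t| = 1] ([malgrange_bound]).

    Conversely, let [p] divide a power of [q] but not [q].  On some line [p] does
    not divide [q], hence [p] has there a root [a] of larger multiplicity than
    [q], and a Taylor coefficient at [a] is a functional [T] that kills the
    multiples of [p] but not [q].  Its transform is in the kernel of [dpoly p] and
    not in the image of the mapping, since [q] vanishes on [V]
    ([separating_functional], [onto_reduced]).

    The mapping is continuous because the exponentials [exp <z, .>] with [z] in a
    compact set form a bounded set.  Its inverse is continuous by a gliding hump
    argument ([fbV_lower_bound]), which uses of a bounded set of restrictions only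
    that every continuous functional is bounded on it.

    The complex analysis is built on one notion, the mean of a function over the
    unit circle, taken as a generalized limit of the means over the roots of unity.
    Invariance of these under rotation gives integration by parts
    ([mean_by_parts]); together with Goursat's lemma it yields Cauchy's formula on
    the disc ([cauchy_formula]), and iterated means give the Taylor expansion in
    several variables. *)

Set Implicit Arguments.
Unset Strict Implicit.
Unset Printing Implicit Defensive.

Import Order.TTheory GRing.Theory Num.Theory.
Import numFieldNormedType.Exports.

Local Open Scope classical_set_scope.
Local Open Scope ring_scope.
Local Open Scope complex_scope.

Local Notation nc := ComplexField.Normc.normc.


(** * The modulus of a complex number *)

Lemma eq_ler (R : realType) (x y : R) : x = y -> x <= y.
Proof. by move=> ->. Qed.

Section modulus.
Variable R : realType.
Local Notation C := R[i].
Implicit Types x y z : C.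

Lemma nc0 : nc (0 : C) = 0. Proof. exact: ComplexField.Normc.normc0. Qed.
Lemma nc1 : nc (1 : C) = 1. Proof. exact: ComplexField.Normc.normc1. Qed.
Lemma ncM x y : nc (x * y) = nc x * nc y.
Proof. exact: ComplexField.Normc.normcM. Qed.
Lemma ncN x : nc (- x) = nc x. Proof. exact: normcN. Qed.
Lemma ncD x y : nc (x + y) <= nc x + nc y. Proof. exact: le_normcD. Qed.
Lemma nc_ge0 x : 0 <= nc x. Proof. exact: normc_ge0. Qed.
Hint Resolve nc_ge0 : core.

Lemma ncB x y : nc (x - y) <= nc x + nc y.
Proof. by rewrite (le_trans (ncD _ _))// ncN. Qed.

Lemma nc_distC x y : nc (x - y) = nc (y - x).
Proof. by rewrite -ncN opprB. Qed.

Lemma nc_triangle y x z : nc (x - z) <= nc (x - y) + nc (y - z).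
Proof. by rewrite (le_trans _ (ncD _ _))// addrA subrK. Qed.

Lemma nc_eq0 x : (nc x == 0) = (x == 0).
Proof.
apply/eqP/eqP => [|->]; last exact: nc0.
exact: ComplexField.Normc.eq0_normc.
Qed.

Lemma nc_gt0 x : (0 < nc x) = (x != 0).
Proof. by rewrite lt_def nc_ge0 andbT nc_eq0. Qed.

Lemma nc_le0 x : nc x <= 0 -> x = 0.
Proof. by move=> h; apply/eqP; rewrite -nc_eq0 eq_le h nc_ge0. Qed.

Lemma ncV x : nc x^-1 = (nc x)^-1.
Proof. exact: ComplexField.Normc.normcV. Qed.

Lemma ncX x k : nc (x ^+ k) = nc x ^+ k.
Proof. by elim: k => [|k IH]; rewrite ?expr0 ?nc1// !exprS ncM IH. Qed.

Lemma nc_real (a : R) : nc (a%:C) = `|a|.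
Proof. by rewrite /= expr0n addr0 sqrtr_sqr. Qed.

Lemma nc_posreal (a : R) : 0 <= a -> nc (a%:C) = a.
Proof. by move=> a0; rewrite nc_real ger0_norm. Qed.

Lemma nc_nat k : nc (k%:R : C) = k%:R.
Proof. by rewrite -(rmorph_nat (real_complex R)) nc_posreal. Qed.

Lemma nc_sum (I : Type) (r : seq I) (P : pred I) (F : I -> C) :
  nc (\sum_(i <- r | P i) F i) <= \sum_(i <- r | P i) nc (F i).
Proof.
elim/big_ind2 : _ => [|x1 x2 y1 y2 h1 h2|//]; first by rewrite nc0.
by rewrite (le_trans (ncD _ _))// lerD.
Qed.

Lemma nc_prod (I : Type) (r : seq I) (P : pred I) (F : I -> C) :
  nc (\prod_(i <- r | P i) F i) = \prod_(i <- r | P i) nc (F i).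
Proof. by elim/big_rec2 : _ => [|i y1 y2 _ <-]; rewrite ?nc1 ?ncM. Qed.

Lemma nc_geB x y : nc x - nc y <= nc (x + y).
Proof. by rewrite lerBlDr -{1}[x](addrK y) ncB. Qed.

Lemma nc_conj x : nc x^* = nc x.
Proof. by case: x => a b /=; rewrite sqrrN. Qed.

Lemma nc_mul_le x y (a b : R) : nc x <= a -> nc y <= b -> nc (x * y) <= a * b.
Proof. by move=> xa yb; rewrite ncM ler_pM. Qed.

Lemma nc_eq_small x : (forall e : R, 0 < e -> nc x <= e) -> x = 0.
Proof.
move=> h; apply: nc_le0; apply/ler_addgt0Pl => e e0.
by rewrite addr0; exact: h.
Qed.

End modulus.
#[local] Arguments ComplexField.Normc.normc : simpl never.
#[local] Hint Extern 0 (is_true (0 <= nc _)) => solve [apply: nc_ge0] : core.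

(** * A generalized limit *)

Section generalized_limit.
Variable R : realType.
Local Notation C := R[i].

Section along_ultrafilter.
Variable U : set_system nat.
Hypotheses (UU : UltraFilter U) (Uoo : forall N, U [set k | (N <= k)%N]).

Let PFU : ProperFilter U. Proof. exact: ultra_proper. Qed.
Let FU : Filter U. Proof. exact: filter_filter. Qed.
Let UI := @filterI _ U FU.
Let US := @filterS _ U FU.
Let Uex := @filter_ex _ U PFU.

Let tends (x : nat -> C) (l : C) :=
  forall e : R, 0 < e -> U [set k | nc (x k - l) < e].

Let tendsP a x y l m : tends x l -> tends y m -> tends (a *: x + y) (a * l + m).
Proof.
move=> xl ym e e0; have a0 : 0 < 2 * (1 + nc a) by rewrite mulr_gt0 ?ltr_pwDl ?nc_ge0.
have h := UI (xl _ (divr_gt0 e0 a0)) (ym _ (divr_gt0 e0 (ltr0Sn _ 1))).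
move: h; apply: US => k /= [xk yk].
have -> : (a *: x + y) k - (a * l + m) = a * (x k - l) + (y k - m).
  by rewrite /= -[LHS]/(a * x k + y k - _); ring.
rewrite (le_lt_trans (ncD _ _))// ncM.
have h2 : nc a * nc (x k - l) <= e / 2.
  rewrite (@le_trans _ _ ((1 + nc a) * (e / (2 * (1 + nc a)))))//.
    by apply: ler_pM => //; [rewrite lerDr|exact: ltW].
  apply: eq_ler; field.
  by rewrite gt_eqF ?ltr_pwDl ?nc_ge0.
by rewrite [ltRHS](splitr e) ler_ltD.
Qed.

Let tends_uniq x l m : tends x l -> tends x m -> l = m.
Proof.
move=> xl xm; apply/eqP; rewrite -subr_eq0; apply/eqP; apply: nc_eq_small => e e0.
have e2 : 0 < e / 2 by rewrite divr_gt0.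
have [k [/= h1 h2]] := Uex (UI (xl _ e2) (xm _ e2)).
by rewrite (le_trans (nc_triangle (x k) _ _))// nc_distC [leRHS](splitr e) lerD// ltW.
Qed.

(** A bounded real sequence has a cluster point along [U], which is a limit because
    [U] is an ultrafilter. *)
Let tends_real (y : nat -> R) (M : R) N : (forall k, (N <= k)%N -> `|y k| <= M) ->
  exists a, forall e : R, 0 < e -> U [set k | `|a - y k| < e].
Proof.
move=> yM.
have Uy : ProperFilter (y @ U) by exact: fmap_proper_filter.
have [|a [_ ya]] := @segment_compact R (- M) M (y @ U) Uy.
  move: (Uoo N); apply: US => k /= /yM.
  by rewrite in_itv /= ler_norml.
exists a => e e0.
have [//|h] := in_ultra_setVsetC [set k | `|a - y k| < e] UU.
have [_ [[k hk <-] /=]] := ya (y @` ~` [set k | `|a - y k| < e]) (ball a e)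
  (US (@preimage_image _ _ y _) h) (nbhsx_ballx _ _ e0).
by [].
Qed.

Let tends_bounded x M N : (forall k, (N <= k)%N -> nc (x k) <= M) ->
  exists2 l, tends x l & nc l <= M.
Proof.
move=> xM.
have [a xa] : exists a, forall e : R, 0 < e -> U [set k | `|a - complex.Re (x k)| < e].
  by apply: (@tends_real _ M N) => k /xM; apply: le_trans; exact: Re_le_normc.
have [b xb] : exists a, forall e : R, 0 < e -> U [set k | `|a - complex.Im (x k)| < e].
  by apply: (@tends_real _ M N) => k /xM; apply: le_trans; exact: Im_le_normc.
have xl : tends x (a +i* b).
  move=> e e0; have e2 : 0 < e / 2 by rewrite divr_gt0.
  move: (UI (xa _ e2) (xb _ e2)); apply: US => k /= [h1 h2].
  rewrite nc_distC (le_lt_trans (normc_le_ReIm _))// [ltRHS](splitr e).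
  by case: (x k) h1 h2 => u v /= h1 h2; rewrite ltrD.
move: (a +i* b) xl => l xl; exists l => //; apply/ler_addgt0Pl => e e0.
have [k [/= h1 h2]] := Uex (UI (xl _ e0) (Uoo N)).
rewrite -[l](subKr (x k)) (le_trans (ncB _ _))// [leRHS]addrC.
by apply: lerD; [exact: xM|exact: ltW].
Qed.

Let good (G : set ((nat -> C) * C)) :=
  (forall a x y, G x -> G y -> G (a *: x.1 + y.1, a * x.2 + y.2)) /\
  (forall c, G (0, c) -> c = 0).

Let G0 : set ((nat -> C) * C) := [set x | tends x.1 x.2].

(** The limit along an ultrafilter is defined on a subspace of the space of all
    sequences; a maximal linear extension, given by Zorn's lemma, is defined on
    the whole space. *)
Lemma total_ultralimit : exists ul : (nat -> C) -> C,
  [/\ scalar ul, forall c, ul (fun=> c) = c &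
   forall x M N, (forall k, (N <= k)%N -> nc (x k) <= M) -> nc (ul x) <= M].
Proof.
have G00 : G0 (0, 0).
  move=> e e0; move: (@filterT _ U FU); apply: US => k _ /=.
  by rewrite subr0 nc0.
have gG0 : good G0.
  split=> [a x y|c /tends_uniq]; first exact: tendsP.
  by move=> /(_ 0 G00).
have [A [[Alin Afun] Amax]] : exists A, good (A `|` G0) /\
    forall B, A `<` B -> ~ good (B `|` G0).
  apply: Zorn_bigcup => F FP Ft.
  have two x y : (\bigcup_(X in F) X `|` G0) x -> (\bigcup_(X in F) X `|` G0) y ->
      (G0 x /\ G0 y) \/ exists2 X, F X & (X `|` G0) x /\ (X `|` G0) y.
    case=> [[X FX Xx]|G0x]; case=> [[Y FY Yy]|G0y].
    - right; have [XY|YX] := Ft X Y FX FY.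
        by exists Y => //; split; left => //; exact: XY.
      by exists X => //; split; left => //; exact: YX.
    - by right; exists X => //; split; [left|right].
    - by right; exists Y => //; split; [right|left].
    - by left.
  split=> [a x y hx hy|c].
    case: (two x y hx hy) => [[G0x G0y]|[X FX [Xx Xy]]].
      by right; exact: gG0.1.
    have [] := (FP _ FX).1 a x y Xx Xy; last by right.
    by left; exists X.
  move=> [[X FX Xc]|]; last exact: gG0.2.
  by apply: (FP _ FX).2; left.
pose H := A `|` G0.
have H0 : H (0, 0) by right.
have Huniq x c d : H (x, c) -> H (x, d) -> c = d.
  move=> Hc Hd; have /= := Alin (-1) _ _ Hc Hd.
  rewrite scaleN1r addNr mulN1r => /Afun/eqP.
  by rewrite addrC subr_eq0 => /eqP ->.
have Htot x : exists c, H (x, c).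
  apply: contrapT => Hx.
  (* The span of [H] and [(x, 0)], which would still be single-valued. *)
  pose B := [set y | exists2 h, H h & exists a, y = (h.1 + a *: x, h.2)].
  have HB : H `<=` B.
    by move=> h Hh; exists h => //; exists 0; rewrite scale0r addr0; case: h {Hh}.
  apply: (Amax B).
    split; first by move=> h Ah; apply: HB; left.
    move=> BA; apply: Hx; exists 0; left; apply: BA.
    by exists (0, 0) => //; exists 1; rewrite scale1r add0r.
  rewrite (_ : B `|` G0 = B); last first.
    by apply/seteqP; split=> [h []// G0h|h]; [apply: HB; right|left].
  split.
    move=> a _ _ [h Hh [b ->]] [k Hk [c ->]] /=.
    exists (a *: h.1 + k.1, a * h.2 + k.2); first exact: Alin.
    exists (a * b + c) => /=; congr pair.
    by rewrite scalerDr scalerDl scalerA addrACA.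
  move=> c [[h d] Hh [a [/= e ->]]].
  have [a0|a0] := eqVneq a 0.
    by move: e; rewrite a0 scale0r addr0 => h0; apply: Afun; rewrite -h0 in Hh.
  exfalso; apply: Hx; exists (- a^-1 * d).
  have := Alin (- a^-1) _ _ Hh H0; rewrite /= !addr0 => hh.
  suff -> : x = - a^-1 *: h by [].
  apply/(@scalerI _ _ a a0); rewrite scalerA mulrN divff// scaleN1r.
  by apply/eqP; rewrite -addr_eq0 addrC -e.
pose ul x := projT1 (cid (Htot x)).
have ulP x : H (x, ul x) := projT2 (cid (Htot x)).
exists ul; split.
- by move=> a x y; apply: (Huniq _ _ _ (ulP _)); exact: Alin (ulP x) (ulP y).
- move=> c; apply: (Huniq _ _ _ (ulP _)); right=> e e0 /=.
  by move: (@filterT _ U FU); apply: US => k _ /=; rewrite subrr nc0.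
move=> x M N /tends_bounded[l xl lM].
by rewrite (Huniq _ _ l (ulP x))//; right.
Qed.

End along_ultrafilter.

Lemma generalized_limit_exists : exists ul : (nat -> C) -> C,
  [/\ scalar ul, forall c, ul (fun=> c) = c &
   forall x M N, (forall k, (N <= k)%N -> nc (x k) <= M) -> nc (ul x) <= M].
Proof.
have [U [UU Uoo]] := ultraFilterLemma (eventually_filter : ProperFilter \oo).
by apply: (total_ultralimit UU) => N; apply: Uoo; exists N.
Qed.

(** A single total and linear limit, so that limits can be taken of any sequence
    and manipulated algebraically; estimates pass to it by [ulim_bound]. *)
Definition ulim : (nat -> C) -> C := projT1 (cid generalized_limit_exists).

Lemma ulim_scalar : scalar ulim.
Proof. by have [] := projT2 (cid generalized_limit_exists). Qed.

HB.instance Definition _ := GRing.isLinear.Build C (nat -> C) C *%R ulim ulim_scalar.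

Lemma ulim_cst c : ulim (fun=> c) = c.
Proof. by have [_ + _] := projT2 (cid generalized_limit_exists); exact. Qed.

Lemma ulim_bound (x : nat -> C) M N :
  (forall k, (N <= k)%N -> nc (x k) <= M) -> nc (ulim x) <= M.
Proof. by have [_ _] := projT2 (cid generalized_limit_exists); exact. Qed.

Lemma eq_ulim (x y : nat -> C) :
  (forall e : R, 0 < e -> exists N, forall k, (N <= k)%N -> nc (x k - y k) <= e) ->
  ulim x = ulim y.
Proof.
move=> xy; apply/eqP; rewrite -subr_eq0 -linearB; apply/eqP.
apply: nc_eq_small => e /xy[N Nxy]; exact: (ulim_bound (N := N)).
Qed.

Lemma ulim_lim (x : nat -> C) l :
  (forall e : R, 0 < e -> exists N, forall k, (N <= k)%N -> nc (x k - l) <= e) ->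
  ulim x = l.
Proof. by move=> xl; rewrite -[RHS]ulim_cst; exact: eq_ulim. Qed.

Lemma ulim_near (x : nat -> C) l M N :
  (forall k, (N <= k)%N -> nc (x k - l) <= M) -> nc (ulim x - l) <= M.
Proof.
move=> xl; rewrite -[l]ulim_cst -linearB; exact: (ulim_bound (N := N)).
Qed.

End generalized_limit.

(** * The mean value over the unit circle *)

Section circle_mean.
Variable R : realType.
Local Notation C := R[i].
Implicit Types (z w : C) (F f g : C -> C).

Lemma cexpMn z k : cexp (z *+ k) = cexp z ^+ k.
Proof.
elim: k => [|k IH]; first by rewrite mulr0n cexp0.
by rewrite mulrS cexpD IH exprS.
Qed.

Definition root1 N : C := cexp (0 +i* (2 * pi / N.+1%:R)).

Lemma root1X N : root1 N ^+ N.+1 = 1.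
Proof.
rewrite -cexpMn.
have imMn (a : R) k : (0 +i* a) *+ k = 0 +i* (a *+ k) :> C.
  elim: k => [|k IH]; first by rewrite !mulr0n.
  by rewrite !mulrS IH; apply/eqP; rewrite eq_complex /= addr0 !eqxx.
rewrite imMn -[X in _ +i* X]mulr_natr divfK ?pnatr_eq0//.
by rewrite /cexp expR0 !mul1r mulrC mulr_natr cos2pi sin2pi.
Qed.

Lemma nc_root1 N : nc (root1 N) = 1.
Proof. by rewrite normc_cexp expR0. Qed.

(** [root1 k] is the exponential of a purely imaginary number of modulus
    [2 pi / (k + 1)], to which the estimate of [cexp] near 0 applies. *)
Lemma root1_near1 (e : R) : 0 < e ->
  exists N, forall k, (N <= k)%N -> root1 k != 1 /\ nc (root1 k - 1) < e.
Proof.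
move=> e0; have [t t0 tP] := @cexp_near0 R 2^-1 (ltac:(by rewrite invr_gt0)).
have m0 : 0 < Num.min t (e / 2) by rewrite lt_min t0 divr_gt0.
exists (Num.truncn (2 * pi / Num.min t (e / 2))) => k Nk.
pose h : C := 0 +i* (2 * pi / k.+1%:R).
have p0 : 0 < 2 * pi / k.+1%:R :> R by rewrite divr_gt0 ?mulr_gt0 ?pi_gt0.
have nh : nc h = 2 * pi / k.+1%:R.
  by rewrite /h /ComplexField.Normc.normc /= expr0n add0r sqrtr_sqr gtr0_norm.
have : nc h < Num.min t (e / 2).
  rewrite nh ltr_pdivrMr// -ltr_pdivrMl// [ltLHS]mulrC.
  by rewrite (lt_le_trans (truncnS_gt _))// ler_nat.
rewrite lt_min => /andP[ht he]; have := tP _ ht.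
rewrite -/(root1 k) => h1; split.
  apply: contraTneq h1 => ->; rewrite subrr sub0r ncN -ltNge.
  by rewrite mulrC ltr_pdivrMr// nh ltr_pMr// ltr1n.
have -> : root1 k - 1 = (root1 k - 1 - h) + h by rewrite subrK.
rewrite (le_lt_trans (ncD _ _))//; lra.
Qed.

Definition root_mean N g : C := N.+1%:R^-1 * \sum_(j < N.+1) g (root1 N ^+ j).

Lemma root_mean_bound N g M : (forall w, nc w = 1 -> nc (g w) <= M) ->
  nc (root_mean N g) <= M.
Proof.
move=> gM; rewrite ncM ncV nc_nat ler_pdivrMl//.
rewrite (le_trans (nc_sum _ _ _))//.
rewrite (le_trans (ler_sum _ (G := fun=> M) _))//.
  by move=> j _; apply: gM; rewrite ncX nc_root1 expr1n.
by rewrite sumr_const card_ord mulr_natl.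
Qed.

(** Multiplication by a root of unity permutes the roots of unity. *)
Lemma root_mean_shift N g : root_mean N (fun w => g (root1 N * w)) = root_mean N g.
Proof.
rewrite /root_mean big_ord_recr [in RHS]big_ord_recl /= -exprS root1X expr0.
rewrite [RHS]mulrDr addrC mulrDr; congr (_ + _ * _).
by apply: eq_bigr => j _; rewrite -exprS.
Qed.

Lemma root_mean_scalar N : scalar (root_mean N).
Proof.
move=> a g h; rewrite /root_mean big_split /= -mulr_sumr mulrDr mulrCA.
by congr (_ + _); rewrite mulr_sumr.
Qed.

HB.instance Definition _ N :=
  GRing.isLinear.Build C (C -> C) C *%R (root_mean N) (root_mean_scalar N).

(** For a continuous function this is its integral over the circle against the
    normalized angular measure; the generalized limit extends it linearly to all
    functions, so that means can be handled without integrability conditions. *)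
Definition mean g : C := ulim (root_mean ^~ g).

Lemma mean_scalar : scalar mean.
Proof.
move=> a g h; rewrite /mean -[RHS]ulim_scalar; congr ulim.
by apply/funext => N; rewrite root_mean_scalar.
Qed.

HB.instance Definition _ := GRing.isLinear.Build C (C -> C) C *%R mean mean_scalar.

Lemma mean_bound g M : (forall w, nc w = 1 -> nc (g w) <= M) -> nc (mean g) <= M.
Proof. by move=> gM; apply: (ulim_bound (N := 0)) => k _; exact: root_mean_bound. Qed.

Lemma mean_cst c : mean (fun=> c) = c.
Proof.
rewrite /mean -[RHS]ulim_cst; congr ulim; apply/funext => N.
by rewrite /root_mean sumr_const card_ord -[X in _ * X]mulr_natl mulKf// pnatr_eq0.
Qed.

Lemma eq_mean g h : (forall w, nc w = 1 -> g w = h w) -> mean g = mean h.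
Proof.
move=> gh; apply/eqP; rewrite -subr_eq0 -linearB; apply/eqP/nc_le0.
apply: mean_bound => w w1.
by rewrite -[X in nc X]/(g w - h w) gh// subrr nc0.
Qed.

Lemma meanB g h : mean (fun w => g w - h w) = mean g - mean h.
Proof. exact: linearB. Qed.

Lemma meanZ a g : mean (fun w => a * g w) = a * mean g.
Proof. exact: (linearZ_LR (mean : {linear _ -> _ | *%R})). Qed.

Lemma mean_sum (I : Type) (r : seq I) (P : pred I) (G : I -> C -> C) :
  mean (fun w => \sum_(i <- r | P i) G i w) = \sum_(i <- r | P i) mean (G i).
Proof.
rewrite -linear_sum; congr mean; apply/funext => w.
by rewrite fct_sumE.
Qed.

(** Uniformity of the remainder on [S] is what allows an average of
    first order expansions to be estimated. *)
Definition udiff (S : set C) F f := forall e : R, 0 < e ->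
  exists2 d : R, 0 < d & forall x y, S x -> S y -> nc (y - x) < d ->
    nc (F y - F x - f x * (y - x)) <= e * nc (y - x).

Definition circle : set C := [set w | nc w = 1].

Lemma circleV w : nc w = 1 -> nc w^-1 = 1.
Proof. by rewrite ncV => ->; rewrite invr1. Qed.

Lemma circle_neq0 w : nc w = 1 -> w != 0.
Proof. by move=> w1; rewrite -nc_gt0 w1. Qed.

Lemma nc_unitX_sub1 (q : C) k : nc q = 1 -> nc (q ^+ k - 1) <= k%:R * nc (q - 1).
Proof.
move=> q1; rewrite subrX1 ncM mulrC ler_wpM2r//.
rewrite (le_trans (nc_sum _ _ _))// -[in leRHS](card_ord k) -sumr_const ler_sum// => i _.
by rewrite ncX q1 expr1n.
Qed.

(** The mean over the roots of unity does not change under a rotation by the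
    generator [root1 N]; dividing the increment by [root1 N - 1] gives the
    derivative in the limit. *)
Lemma mean_by_parts F f m M : udiff circle F f ->
  (forall w, nc w = 1 -> nc (F w) <= M) ->
  mean (fun w => f w * w * w^-1 ^+ m) = m%:R * mean (fun w => F w * w^-1 ^+ m).
Proof.
move=> FD FM; rewrite -meanZ; apply: eq_ulim => e e0.
have M0 : 0 <= M by apply: le_trans (FM 1 (nc1 _)).
have [d d0 dP] := FD _ (divr_gt0 e0 (ltr0Sn _ 1)).
pose B := (m * m)%:R * M + 1; have B0 : 0 < B by rewrite ltr_wpDl// mulr_ge0.
have ed : 0 < Num.min d (e / 2 / B) by rewrite lt_min d0 !divr_gt0.
have [N NP] := root1_near1 ed; exists N => k /NP[q1].
set q := root1 k in q1 *; have nq : nc q = 1 by exact: nc_root1.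
rewrite lt_min => /andP[qd qe].
pose L g := root_mean k g.
have LZ a g : L (fun w => a * g w) = a * L g by exact: (linearZ_LR (root_mean k)).
pose Fm := fun w => F w * w^-1 ^+ m.
pose E := fun w => (F (q * w) - F w - f w * (q * w - w)) * w^-1 ^+ m.
have q0 : q - 1 != 0 by rewrite subr_eq0.
(* The mean of [Fm] is invariant under the rotation by [q]; the increment of [F] is
   expanded to the first order, with remainder [E]. *)
have EL : (q - 1) * L (fun w => f w * w * w^-1 ^+ m) + L E = (q ^+ m - 1) * L Fm.
  have sh : L (fun w => F (q * w) * w^-1 ^+ m) = q ^+ m * L Fm.
    rewrite -[L Fm]root_mean_shift -LZ; congr root_mean; apply/funext => w.
    rewrite /Fm invfM exprMn mulrCA; congr (_ * _).
    by rewrite mulrA -exprMn divff ?expr1n ?mul1r// circle_neq0.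
  rewrite [in RHS]mulrBl mul1r -sh -LZ -[LHS](linearD (root_mean k)) -linearB.
  congr root_mean; apply/funext => w /=.
  by rewrite -[LHS]/(_ * _ + _) -[RHS]/(_ - _) /E /Fm; ring.
have EB : nc (L E) <= e / 2 * nc (q - 1).
  apply: root_mean_bound => w w1.
  rewrite ncM ncX circleV// expr1n mulr1.
  have qw : nc (q * w - w) = nc (q - 1) by rewrite -{2}[w]mul1r -mulrBl ncM w1 mulr1.
  by have := dP w (q * w); rewrite qw; apply => //; rewrite /circle /= ncM nq w1 mulr1.
have -> : L (fun w => f w * w * w^-1 ^+ m) - root_mean k (fun w => m%:R * Fm w) =
    - (L E / (q - 1)) + (\sum_(i < m) (q ^+ i - 1)) * L Fm.
  rewrite -[root_mean _ _]/(L _) LZ sumrB sumr_const card_ord.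
  have A : L (fun w => f w * w * w^-1 ^+ m) =
      ((q ^+ m - 1) * L Fm - L E) / (q - 1) by rewrite -EL addrK mulrAC divff ?mul1r.
  by rewrite A subrX1; field.
rewrite (le_trans (ncD _ _))// ncN [leRHS]splitr lerD//.
  by rewrite ncM ncV ler_pdivrMr ?nc_gt0.
have h1 : nc (\sum_(i < m) (q ^+ i - 1)) <= (m * m)%:R * nc (q - 1).
  rewrite (le_trans (nc_sum _ _ _))// natrM -mulrA -[in leRHS](card_ord m) mulr_natl.
  rewrite -sumr_const card_ord ler_sum// => i _; rewrite (le_trans (nc_unitX_sub1 _ nq))//.
  by rewrite ler_wpM2r// ler_nat ltnW.
have h2 : nc (L Fm) <= M.
  by apply: root_mean_bound => w w1; rewrite ncM ncX circleV// expr1n mulr1 FM.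
rewrite ncM (le_trans (ler_pM _ _ h1 h2))// mulrAC.
rewrite (@le_trans _ _ (B * nc (q - 1)))//.
  by rewrite ler_wpM2r// lerDl.
by rewrite mulrC -ler_pdivlMr// ltW.
Qed.

(** Integration by parts with [F = 1] and [f = 0]. *)
Lemma mean_negX k : (0 < k)%N -> mean (fun w => w^-1 ^+ k) = 0.
Proof.
move=> k0; have D1 : udiff circle (fun=> 1) (fun=> 0).
  by move=> e e0; exists 1 => // x y _ _ _; rewrite subrr mul0r subrr nc0 mulr_ge0 ?nc_ge0 ?ltW.
have D2 w : nc w = 1 -> nc (1 : C) <= 1 by rewrite nc1.
have := mean_by_parts k D1 D2.
rewrite (_ : mean _ = 0); last first.
  by rewrite -[RHS](mean_cst 0); apply: eq_mean => w _ /=; rewrite !mul0r.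
move=> /esym/eqP; rewrite mulf_eq0 pnatr_eq0 eqn0Ngt k0 /= => /eqP <-.
by apply: eq_mean => w _ /=; rewrite mul1r.
Qed.

End circle_mean.

(** * Goursat's lemma and primitives *)

Section goursat.
Variable R : realType.
Local Notation C := R[i].
Implicit Types (z w a b c : C) (F f g : C -> C) (S : set C).

Let mid a b : C := (a + b) / 2.

Let midC a b : mid a b = mid b a. Proof. by rewrite /mid addrC. Qed.

Let mid_subl a b : mid a b - a = (b - a) / 2. Proof. by rewrite /mid; field. Qed.
Let mid_subr a b : b - mid a b = (b - a) / 2. Proof. by rewrite /mid; field. Qed.

Let nc_half z : nc (z / 2) = nc z / 2.
Proof. by rewrite ncM ncV nc_nat. Qed.

Definition midpoint_closed S := forall a b, S a -> S b -> S ((a + b) / 2).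

Lemma disc_midpoint_closed z (r : R) : midpoint_closed [set x | nc (x - z) <= r].
Proof.
move=> a b /= ha hb.
have -> : (a + b) / 2 - z = (a - z) / 2 + (b - z) / 2 by field.
rewrite (le_trans (ncD _ _))// !nc_half; lra.
Qed.

Lemma midpoint_closedI S T : midpoint_closed S -> midpoint_closed T ->
  midpoint_closed (S `&` T).
Proof. by move=> mS mT a b [Sa Ta] [Sb Tb]; split; [exact: mS|exact: mT]. Qed.

(** Left Riemann sums over the [2 ^ n] equal parts of a segment, defined by
    bisection because triangles will be bisected. *)
Fixpoint dyadic_sum n f a b : C :=
  if n is n'.+1 then dyadic_sum n' f a ((a + b) / 2) + dyadic_sum n' f ((a + b) / 2) b
  else (b - a) * f a.

Let dyadic_sum_pt k f b : dyadic_sum k f b b = 0.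
Proof.
elim: k => [|k IH] /=; first by rewrite subrr mul0r.
by rewrite (_ : (b + b) / 2 = b) ?IH ?addr0//; field.
Qed.

Let dyadic_sumB n f g a b :
  dyadic_sum n (fun z => f z - g z) a b = dyadic_sum n f a b - dyadic_sum n g a b.
Proof.
elim: n a b => [|n IH] a b /=; first by rewrite mulrBr.
by rewrite !IH; ring.
Qed.

Let dyadic_sum_affine n (u v : C) a b : dyadic_sum n (fun z => u * z + v) a b =
  u * ((b ^+ 2 - a ^+ 2) / 2 - (b - a) ^+ 2 / 2 ^+ n.+1) + v * (b - a).
Proof.
elim: n a b => [|n IH] a b /=; first by field.
rewrite !IH !exprS; field.
by rewrite expf_neq0// pnatr_eq0.
Qed.

Let dyadic_sum_near n f a b v (e : R) S : midpoint_closed S -> S a -> S b ->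
  (forall z, S z -> nc (f z - v) <= e) ->
  nc (dyadic_sum n f a b - (b - a) * v) <= nc (b - a) * e.
Proof.
move=> mS + + fv; elim: n a b => [|n IH] a b Sa Sb /=.
  by rewrite -mulrBr ncM ler_wpM2l// fv.
have Sm : S ((a + b) / 2) by exact: mS.
have h1 := IH _ _ Sa Sm; have h2 := IH _ _ Sm Sb.
rewrite -/(mid a b) mid_subl in h1; rewrite -/(mid a b) mid_subr in h2.
rewrite -/(mid a b).
have -> : dyadic_sum n f a (mid a b) + dyadic_sum n f (mid a b) b - (b - a) * v =
  (dyadic_sum n f a (mid a b) - (b - a) / 2 * v) +
  (dyadic_sum n f (mid a b) b - (b - a) / 2 * v) by field.
rewrite (le_trans (ncD _ _))// (le_trans (lerD h1 h2))// nc_half; lra.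
Qed.

Let dyadic_sum_step n f a b (e : R) S : midpoint_closed S -> S a -> S b ->
  (forall x y, S x -> S y -> nc (y - x) <= nc (b - a) / 2 ^+ n -> nc (f y - f x) <= e) ->
  nc (dyadic_sum n.+1 f a b - dyadic_sum n f a b) <= nc (b - a) * e.
Proof.
move=> mS; elim: n a b => [|n IH] a b Sa Sb fe.
  have Sm : S (mid a b) by exact: mS.
  have -> : dyadic_sum 1 f a b - dyadic_sum 0 f a b = (b - a) / 2 * (f (mid a b) - f a).
    by rewrite /= /mid; field.
  rewrite ncM; apply: ler_pM => //.
    by rewrite nc_half; have := nc_ge0 (b - a); lra.
  apply: fe => //; rewrite mid_subl nc_half expr0 divr1.
  by have := nc_ge0 (b - a); lra.
have Sm : S (mid a b) by exact: mS.
have h1 : nc (dyadic_sum n.+1 f a (mid a b) - dyadic_sum n f a (mid a b)) <= nc (b - a) / 2 * e.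
  rewrite -nc_half -mid_subl; apply: IH => // x y Sx Sy xy; apply: fe => //.
  by rewrite (le_trans xy)// mid_subl nc_half exprS invfM mulrA.
have h2 : nc (dyadic_sum n.+1 f (mid a b) b - dyadic_sum n f (mid a b) b) <= nc (b - a) / 2 * e.
  rewrite -nc_half -mid_subr; apply: IH => // x y Sx Sy xy; apply: fe => //.
  by rewrite (le_trans xy)// mid_subr nc_half exprS invfM mulrA.
rewrite -[dyadic_sum n.+2 _ _ _]/(dyadic_sum n.+1 f a (mid a b) + dyadic_sum n.+1 f (mid a b) b).
rewrite -[dyadic_sum n.+1 _ _ b in X in _ - X]/(dyadic_sum n f a (mid a b) + dyadic_sum n f (mid a b) b).
rewrite opprD addrACA (le_trans (ncD _ _))// (le_trans (lerD h1 h2))//; lra.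
Qed.

Let dyadic_sum_rev n f a b (e : R) S : midpoint_closed S -> S a -> S b ->
  (forall x y, S x -> S y -> nc (y - x) <= nc (b - a) / 2 ^+ n -> nc (f y - f x) <= e) ->
  nc (dyadic_sum n f a b + dyadic_sum n f b a) <= nc (b - a) * e.
Proof.
move=> mS; elim: n a b => [|n IH] a b Sa Sb fe /=.
  rewrite -(opprB b a) mulNr -mulrBr ncM ler_wpM2l// fe//.
  by rewrite nc_distC expr0 divr1.
have Sm : S (mid a b) by exact: mS.
have h1 : nc (dyadic_sum n f a (mid a b) + dyadic_sum n f (mid a b) a) <= nc (b - a) / 2 * e.
  rewrite -nc_half -mid_subl; apply: IH => // x y Sx Sy xy; apply: fe => //.
  by rewrite (le_trans xy)// mid_subl nc_half exprS invfM mulrA.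
have h2 : nc (dyadic_sum n f (mid a b) b + dyadic_sum n f b (mid a b)) <= nc (b - a) / 2 * e.
  rewrite -nc_half -mid_subr; apply: IH => // x y Sx Sy xy; apply: fe => //.
  by rewrite (le_trans xy)// mid_subr nc_half exprS invfM mulrA.
rewrite -/(mid a b) -/(mid b a) (midC b a).
rewrite [X in _ + X]addrC addrACA (le_trans (ncD _ _))// (le_trans (lerD h1 h2))//; lra.
Qed.

Definition ucont S f := forall e : R, 0 < e -> exists2 d : R, 0 < d &
  forall x y, S x -> S y -> nc (y - x) < d -> nc (f y - f x) <= e.

(** The curve integral along a segment, as a generalized limit.  Uniform continuity
    on a set closed under midpoints gives the two properties that Goursat's argument
    uses: splitting at the midpoint and change of sign with the orientation. *)
Definition seg_int f a b : C := ulim (fun n => dyadic_sum n f a b).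

Lemma seg_intB f g a b :
  seg_int (fun z => f z - g z) a b = seg_int f a b - seg_int g a b.
Proof.
rewrite -[RHS]linearB; congr ulim; apply/funext => n; exact: dyadic_sumB.
Qed.

Let small_pow (M d : R) : 0 < d ->
  exists N, forall n, (N <= n)%N -> M / 2 ^+ n < d.
Proof.
move=> d0; exists (Num.truncn (M / d)) => n Nn.
rewrite ltr_pdivrMr ?exprn_gt0// -ltr_pdivrMl// mulrC (lt_le_trans (truncnS_gt _))//.
by rewrite -natrX ler_nat (leq_trans _ (ltn_expl n _)).
Qed.

Lemma seg_int_affine u v a b :
  seg_int (fun z => u * z + v) a b = u * ((b ^+ 2 - a ^+ 2) / 2) + v * (b - a).
Proof.
apply: ulim_lim => e e0.
have [N NP] := small_pow (nc u * nc (b - a) ^+ 2) e0.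
exists N => k /NP Nk; rewrite dyadic_sum_affine.
set X := (b - a) ^+ 2 / _; set Y := _ / 2.
have -> : u * (Y - X) + v * (b - a) - (u * Y + v * (b - a)) = - (u * X) by ring.
rewrite ncN ncM /X ncM ncX ncV ncX nc_nat.
apply: le_trans (ltW Nk); rewrite mulrA; apply: ler_wpM2l.
  by rewrite mulr_ge0 ?exprn_ge0.
by rewrite lef_pV2 ?posrE ?exprn_gt0// exprS ler_peMl ?exprn_ge0 ?ler1n.
Qed.

Lemma seg_int_near f a b v (e : R) S : midpoint_closed S -> S a -> S b ->
  (forall z, S z -> nc (f z - v) <= e) ->
  nc (seg_int f a b - (b - a) * v) <= nc (b - a) * e.
Proof.
by move=> mS Sa Sb fv; apply: (ulim_near (N := 0)) => n _; exact: dyadic_sum_near Sa Sb fv.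
Qed.

Section ucont.
Variables (S : set C) (f : C -> C).
Hypotheses (mS : midpoint_closed S) (uf : ucont S f).

Let small_osc a b (e : R) : 0 < e -> exists N, forall n, (N <= n)%N ->
  forall x y, S x -> S y -> nc (y - x) <= nc (b - a) / 2 ^+ n -> nc (f y - f x) * nc (b - a) <= e.
Proof.
move=> e0; have c0 : 0 < 1 + nc (b - a) by rewrite ltr_pwDl.
have [d d0 dP] := uf (divr_gt0 e0 c0); have [N NP] := small_pow (nc (b - a)) d0.
exists N => n /NP Nn x y Sx Sy xy.
have h := dP _ _ Sx Sy (le_lt_trans xy Nn).
rewrite (@le_trans _ _ (e / (1 + nc (b - a)) * (1 + nc (b - a))))//.
  by apply: ler_pM => //; rewrite lerDr.
by rewrite divfK// gt_eqF.
Qed.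

(** The sum of the [n]-th Riemann sums of the halves is the Riemann sum of order
    [n + 1] of the segment, which differs little from the one of order [n]. *)
Lemma seg_int_half a b : S a -> S b ->
  seg_int f a b = seg_int f a ((a + b) / 2) + seg_int f ((a + b) / 2) b.
Proof.
move=> Sa Sb; rewrite -[RHS]linearD; apply/esym/eq_ulim => e e0.
have [ab|ab] := eqVneq a b.
  exists 0%N => n _; have -> : (a + b) / 2 = b by rewrite ab; field.
  by rewrite ab -[X in nc (X - _)]/(_ + _) !dyadic_sum_pt !addr0 subrr nc0 ltW.
have ba : 0 < nc (b - a) by rewrite nc_gt0 subr_eq0 eq_sym.
have [N NP] := small_osc a b e0; exists N => n /NP Nn.
rewrite -[X in nc (X - _)]/(dyadic_sum n.+1 f a b).
rewrite (le_trans (@dyadic_sum_step n f a b (e / nc (b - a)) S mS Sa Sb _))//.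
  by move=> x y Sx Sy /(Nn _ _ Sx Sy); rewrite ler_pdivlMr.
by rewrite mulrC divfK// gt_eqF.
Qed.

(** Reversal turns left Riemann sums into right ones, which differ by the oscillation
    of [f] over the small parts. *)
Lemma seg_int_rev a b : S a -> S b -> seg_int f b a = - seg_int f a b.
Proof.
move=> Sa Sb; apply/eqP; rewrite -subr_eq0 opprK; apply/eqP.
rewrite addrC -[LHS]linearD; apply: ulim_lim => e e0; rewrite ?subr0.
have [ab|ab] := eqVneq a b.
  by exists 0%N => n _; rewrite ab subr0 -[X in nc X]/(_ + _) !dyadic_sum_pt addr0 nc0 ltW.
have ba : 0 < nc (b - a) by rewrite nc_gt0 subr_eq0 eq_sym.
have [N NP] := small_osc a b e0; exists N => n /NP Nn.
rewrite subr0 -[X in nc X]/(_ + _).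
rewrite (le_trans (@dyadic_sum_rev n f a b (e / nc (b - a)) S mS Sa Sb _))//.
  by move=> x y Sx Sy /(Nn _ _ Sx Sy); rewrite ler_pdivlMr.
by rewrite mulrC divfK// gt_eqF.
Qed.

End ucont.

(** Complex differentiability at [z] relative to [S], with derivative [d]. *)
Definition pdiff S f z d := forall e : R, 0 < e -> exists2 t : R, 0 < t &
  forall y, S y -> nc (y - z) < t -> nc (f y - f z - d * (y - z)) <= e * nc (y - z).

Section triangles.
Variables (r : R) (f : C -> C).
Let D : set C := [set z | nc z <= r].
Hypotheses (uf : ucont D f) (df : forall z, D z -> exists d, pdiff D f z d).

Let mD : midpoint_closed D.
Proof.
by have := disc_midpoint_closed (z := 0) (r := r); under eq_set => z do rewrite subr0.
Qed.

Let bdry g a b c := seg_int g a b + seg_int g b c + seg_int g c a.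
Let per a b c : R := nc (b - a) + nc (c - b) + nc (a - c).

Let bdry_subdiv a b c : D a -> D b -> D c -> bdry f a b c =
  bdry f a (mid a b) (mid c a) + bdry f (mid a b) b (mid b c) +
  bdry f (mid c a) (mid b c) c + bdry f (mid a b) (mid b c) (mid c a).
Proof.
move=> Da Db Dc.
have Dab : D (mid a b) by exact: mD.
have Dbc : D (mid b c) by exact: mD.
have Dca : D (mid c a) by exact: mD.
rewrite /bdry (seg_int_half mD uf Da Db) (seg_int_half mD uf Db Dc) (seg_int_half mD uf Dc Da).
rewrite (seg_int_rev mD uf Dca Dab) (seg_int_rev mD uf Dab Dbc) (seg_int_rev mD uf Dbc Dca).
by rewrite -!/(mid _ _); ring.
Qed.

Let T := (C * C * C)%type.
Let tri (t : T) := [/\ D t.1.1, D t.1.2 & D t.2].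
Let tbdry (t : T) := bdry f t.1.1 t.1.2 t.2.
Let tper (t : T) := per t.1.1 t.1.2 t.2.

(** One of the four triangles cut out by the midpoints of the sides carries at least
    a quarter of the boundary integral. *)
Let step (t : T) : exists t' : T, tri t ->
  [/\ tri t', nc (tbdry t) <= 4 * nc (tbdry t'), tper t' = tper t / 2 &
      nc (t'.1.1 - t.1.1) <= tper t / 2].
Proof.
have [tt|] := pselect (tri t); last by exists t.
case: t tt => [[a b] c] [/= Da Db Dc].
have Dab : D (mid a b) by exact: mD.
have Dbc : D (mid b c) by exact: mD.
have Dca : D (mid c a) by exact: mD.
have E : tbdry (a, b, c) = tbdry (a, mid a b, mid c a) + tbdry (mid a b, b, mid b c) +
    tbdry (mid c a, mid b c, c) + tbdry (mid a b, mid b c, mid c a) := bdry_subdiv Da Db Dc.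
have P u v w (x y z : C) : v - u = x / 2 -> w - v = y / 2 -> u - w = z / 2 ->
    tper (u, v, w) = (nc x + nc y + nc z) / 2.
  by move=> h1 h2 h3; rewrite /tper /per /= h1 h2 h3 !nc_half; field.
pose ok (t' : T) := nc (tbdry (a, b, c)) <= 4 * nc (tbdry t').
have [h|] := pselect (ok (a, mid a b, mid c a)).
  exists (a, mid a b, mid c a) => _; split => //=.
    by rewrite (P _ _ _ (b - a) (c - b) (a - c)) /mid//; field.
  by rewrite subrr nc0 divr_ge0// !addr_ge0.
have [h _|] := pselect (ok (mid a b, b, mid b c)).
  exists (mid a b, b, mid b c) => _; split => //=.
    by rewrite (P _ _ _ (b - a) (c - b) (a - c)) /mid//; field.
  rewrite mid_subl nc_half ler_wpM2r ?invr_ge0// /tper /per /= -addrA.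
  by rewrite lerDl addr_ge0.
have [h _ _|] := pselect (ok (mid c a, mid b c, c)).
  exists (mid c a, mid b c, c) => _; split => //=.
    by rewrite (P _ _ _ (b - a) (c - b) (a - c)) /mid//; field.
  rewrite nc_distC mid_subr nc_half ler_wpM2r ?invr_ge0// /tper /per /=.
  by rewrite lerDr addr_ge0.
move=> h3 h2 h1; exists (mid a b, mid b c, mid c a) => _; split => //=.
- move: h1 h2 h3; rewrite /ok => /negP + /negP + /negP; rewrite -!ltNge => h1 h2 h3.
  have := ncD (tbdry (a, mid a b, mid c a) + tbdry (mid a b, b, mid b c) +
    tbdry (mid c a, mid b c, c)) (tbdry (mid a b, mid b c, mid c a)).
  have := ncD (tbdry (a, mid a b, mid c a) + tbdry (mid a b, b, mid b c))
    (tbdry (mid c a, mid b c, c)).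
  have := ncD (tbdry (a, mid a b, mid c a)) (tbdry (mid a b, b, mid b c)).
  rewrite -E; lra.
- rewrite (P _ _ _ (c - a) (a - b) (b - c)); [|by rewrite /mid; field..].
  by rewrite /tper /per /= !(nc_distC a) (nc_distC c b); ring.
- rewrite mid_subl nc_half ler_wpM2r ?invr_ge0// /tper /per /= -addrA.
  by rewrite lerDl addr_ge0.
Qed.

(** Goursat's argument.  The nested triangles shrink to a point [l]; near [l] the
    function differs from its affine part [g], whose boundary integral is 0, by
    a small multiple of the perimeter, and the factor 4 of each bisection is
    compensated by the square of the perimeter. *)
Lemma goursat_triangle a b c : D a -> D b -> D c ->
  seg_int f a b + seg_int f b c + seg_int f c a = 0.
Proof.
move=> Da Db Dc; pose t0 : T := (a, b, c); rewrite -[LHS]/(tbdry t0).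
have t0D : tri t0 by [].
pose t n := iter n (fun t => projT1 (cid (step t))) t0.
have stepP n := projT2 (cid (step (t n))); rewrite -/(t _) in stepP.
have tD n : tri (t n) by elim: n => [//|n /(stepP n)[]].
have tb n : nc (tbdry t0) <= 4 ^+ n * nc (tbdry (t n)).
  elim: n => [|n IH]; first by rewrite expr0 mul1r.
  have [_ h _ _] := stepP n (tD n).
  by rewrite (le_trans IH)// exprSr -mulrA ler_wpM2l// exprn_ge0.
have tp n : tper (t n) = tper t0 / 2 ^+ n.
  elim: n => [|n IH]; first by rewrite expr0 divr1.
  have [_ _ -> _] := stepP n (tD n).
  by rewrite IH exprSr invfM mulrA.
pose z n := (t n).1.1.
have zc m k : nc (z (m + k)%N - z m) <= tper (t m) - tper (t (m + k)%N).
  elim: k => [|k IH]; first by rewrite addn0 !subrr nc0.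
  rewrite addnS (le_trans (nc_triangle (z (m + k)%N) _ _))//.
  have [_ _ h1 h2] := stepP _ (tD (m + k)%N); rewrite -/(t (m + k).+1) in h1 h2.
  rewrite -/(z (m + k).+1) -/(z (m + k)%N) in h2; lra.
have per0 n : 0 <= tper (t n) by rewrite !addr_ge0.
pose l := ulim z.
have zl m : nc (l - z m) <= tper (t m).
  apply: (ulim_near (N := m)) => k /subnKC <-; apply: le_trans (zc _ _) _.
  by rewrite gerBl.
have Dl : D l by apply: (ulim_bound (N := 0)) => k _; have [] := tD k.
have [d dP] := df Dl.
suff main e : 0 < e -> nc (tbdry t0) <= 2 * e * tper t0 ^+ 2.
  apply: nc_eq_small => e e0.
  have p0 : 0 < 2 * (1 + tper t0 ^+ 2) by rewrite mulr_gt0// ltr_pwDl// sqr_ge0.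
  rewrite (le_trans (main _ (divr_gt0 e0 p0)))//.
  have X0 : 0 <= tper t0 ^+ 2 by exact: sqr_ge0.
  move: (tper t0 ^+ 2) X0 {p0} => X X0; have X1 : 0 < 1 + X by rewrite ltr_pwDl.
  have -> : 2 * (e / (2 * (1 + X))) * X = e * X / (1 + X) by field; rewrite gt_eqF.
  rewrite ler_pdivrMr//; apply: ler_wpM2l; first exact: ltW.
  by rewrite lerDr.
move=> e0; have [s s0 sP] := dP _ e0.
have [n np] := small_pow (2 * tper t0) s0.
have {}np : 2 * tper (t n) < s by rewrite tp mulrA np.
pose g w := d * w + (f l - d * l).
have bg : bdry g (t n).1.1 (t n).1.2 (t n).2 = 0.
  by rewrite /bdry !seg_int_affine; ring.
pose S := D `&` [set w | nc (w - z n) <= tper (t n)].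
have mS : midpoint_closed S by apply: midpoint_closedI => //; exact: disc_midpoint_closed.
have [Ta Tb Tc] := tD n.
have S1 : S (t n).1.1 by split => //=; rewrite subrr nc0.
have S2 : S (t n).1.2 by split => //=; rewrite /tper /per -addrA lerDl addr_ge0.
have S3 : S (t n).2 by split => //=; rewrite [leLHS]nc_distC /tper /per lerDr addr_ge0.
have fg w : S w -> nc (f w - g w - 0) <= 2 * e * tper (t n).
  move=> [Dw /= wz]; have wl : nc (w - l) <= 2 * tper (t n).
    rewrite (le_trans (nc_triangle (z n) _ _))// [X in _ + X]nc_distC.
    have := zl n; lra.
  have := sP _ Dw (le_lt_trans wl np).
  have -> : f w - f l - d * (w - l) = f w - g w - 0 by rewrite /g; ring.
  move=> h; apply: (le_trans h); rewrite (mulrC 2) -mulrA.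
  by apply: ler_wpM2l => //; exact: ltW.
have est a' b' : S a' -> S b' ->
    nc (seg_int f a' b' - seg_int g a' b') <= nc (b' - a') * (2 * e * tper (t n)).
  by move=> Sa Sb; have := seg_int_near mS Sa Sb fg; rewrite mulr0 subr0 seg_intB.
have : nc (tbdry (t n)) <= 2 * e * tper (t n) ^+ 2.
  rewrite -[tbdry _]subr0 -bg /tbdry /bdry.
  set J1 := seg_int f _ _; set J2 := seg_int f _ _; set J3 := seg_int f _ _.
  set K1 := seg_int g _ _; set K2 := seg_int g _ _; set K3 := seg_int g _ _.
  have -> : J1 + J2 + J3 - (K1 + K2 + K3) = (J1 - K1) + (J2 - K2) + (J3 - K3) by ring.
  rewrite (le_trans (ncD _ _))// (le_trans (lerD (le_trans (ncD _ _) (lerD (est _ _ S1 S2) (est _ _ S2 S3))) (est _ _ S3 S1)))//.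
  by rewrite -!mulrDl mulrC expr2 mulrA.
move=> h; rewrite (le_trans (tb n))// (le_trans (ler_wpM2l _ h)) ?exprn_ge0//.
rewrite tp expr_div_n -exprM mulnC exprM (_ : 2 ^+ 2 = 4 :> R); last by ring.
rewrite mulrCA [X in _ * X]mulrCA divff ?mulr1//.
Qed.

(** The integral from 0 is a primitive, since by Goursat's lemma its increments are
    integrals along short segments. *)
Lemma primitive_exists : exists F, udiff D F f /\
  forall M, (forall z, D z -> nc (f z) <= M) -> forall z, D z -> nc (F z) <= r * M.
Proof.
have [r0|r0] := leP 0 r; last first.
  have D0 x : ~ D x.
    by move=> xr; have := le_lt_trans (nc_ge0 x) (le_lt_trans xr r0); rewrite ltxx.
  by exists (fun=> 0); split=> [e e0|M _ z /D0//]; exists 1 => // x y /D0.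
have D0 : D 0 by rewrite /D /= nc0.
exists (seg_int f 0); split; last first.
  move=> M fM z Dz; have M0 : 0 <= M := le_trans (nc_ge0 _) (fM _ D0).
  have h w : D w -> nc (f w - 0) <= M by rewrite subr0; exact: fM.
  have := seg_int_near mD D0 Dz h; rewrite mulr0 !subr0 => {}h.
  by rewrite (le_trans h)// ler_wpM2r.
move=> e /uf[d d0 dP]; exists d => // x y Dx Dy xy.
have := goursat_triangle D0 Dx Dy.
rewrite (seg_int_rev mD uf D0 Dy) => /eqP; rewrite subr_eq0 => /eqP <-.
rewrite [X in nc (X - _)]addrAC subrr add0r mulrC [leRHS]mulrC.
apply: (@seg_int_near _ _ _ _ _ (D `&` [set w | nc (w - x) <= nc (y - x)])).
- by apply: midpoint_closedI => //; exact: disc_midpoint_closed.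
- by split => //=; rewrite subrr nc0.
- by split => /=.
- by move=> w [Dw /= wx]; apply: dP => //; exact: le_lt_trans xy.
Qed.

End triangles.

End goursat.

(** * Compactness in the complex plane *)

Section complex_compactness.
Variable R : realType.
Local Notation C := R[i].
Implicit Types (z w : C) (f : C -> C).

Lemma nbhs_ncP z (A : set C) :
  nbhs z A <-> exists2 e : R, 0 < e & forall w, nc (w - z) < e -> A w.
Proof.
split=> [/nbhs_ballP[e /= e0 eA]|[e e0 eA]]; last first.
  apply/nbhs_ballP; exists e%:C => /=; first by rewrite ltcR.
  by move=> w; rewrite -ball_normE /= distrC normr_normc ltcR; exact: eA.
case: e e0 eA => a b; rewrite ltcE /= => /andP[/eqP -> a0] eA.
exists a => // w wz; apply: eA.
by rewrite -ball_normE /= distrC normr_normc ltcR.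
Qed.

Definition square (r : R) : set C :=
  [set z | `|complex.Re z| <= r /\ `|complex.Im z| <= r].

(** Squares rather than discs, because they are products of real segments. *)
Lemma compact_square r : compact (square r).
Proof.
pose g (x : R * R) : C := x.1 +i* x.2.
have -> : square r = g @` (`[- r, r]%classic `*` `[- r, r]%classic).
  apply/seteqP; split=> [[a b] [/= ha hb]|_ [[a b] [/= ha hb] <-]].
    by exists (a, b) => //=; split; rewrite /= in_itv /= -ler_norml.
  by move: ha hb; rewrite /= !in_itv /= -!ler_norml.
apply: continuous_compact; last by apply: compact_setX; exact: segment_compact.
apply: continuous_subspaceT => -[a b] A /nbhs_ncP[e e0 eA].
have e2 : 0 < e / 2 by rewrite divr_gt0.
exists (ball a (e / 2), ball b (e / 2)); first by split; exact: nbhsx_ballx.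
move=> [c d] [/= ca db]; apply: eA.
rewrite (le_lt_trans (normc_le_ReIm _))// [ltRHS]splitr.
by move: ca db; rewrite -!ball_normE /= !(distrC _ c) !(distrC _ d) => ? ?; rewrite ltrD.
Qed.

Lemma disc_square z (r : R) : nc z <= r -> square r z.
Proof.
move=> zr; split; first exact: le_trans (Re_le_normc _) zr.
exact: le_trans (Im_le_normc _) zr.
Qed.

(** Compactness of the disc, for statements whose quality is measured by an integer,
    such as bounds and moduli of continuity. *)
Lemma disc_uniformly (r : R) (P : nat -> C -> Prop) :
  (forall m n z, (m <= n)%N -> P m z -> P n z) ->
  (forall z, nc z <= r -> exists n (e : R), 0 < e /\
     forall w, nc w <= r -> nc (w - z) < e -> P n w) ->
  exists n, forall z, nc z <= r -> P n z.
Proof.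
move=> Pm Pn; have := @compact_square r.
move=> /compact_near_coveringP/(_ nat \oo (fun n z => nc z <= r -> P n z) _).
case=> [z _|N _ NP].
  have [zr|zr] := leP (nc z) r.
    have [n [e [e0 eP]]] := Pn z zr.
    exists ([set w | nc (w - z) < e], [set k | (n <= k)%N]).
      by split; [apply/nbhs_ncP; exists e|exists n].
    by move=> [w k] [/= wz nk] wr; apply: (Pm n) => //; exact: eP.
  exists ([set w | nc (w - z) < nc z - r], setT).
    split; last exact: filterT.
    by apply/nbhs_ncP; exists (nc z - r) => //; rewrite subr_gt0.
  move=> [w k] [/= wz _] wr; have := nc_triangle w z 0; rewrite !subr0.
  by rewrite nc_distC => h; exfalso; lra.
by exists N => z zr; apply: (NP N) => //=; exact: disc_square.
Qed.

Section pdiff_on_disc.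
Variables (r : R) (f : C -> C).
Let D : set C := [set z | nc z <= r].
Hypothesis df : forall z, D z -> exists d, pdiff D f z d.

Let near_lip z : D z -> exists (M e : R), 0 < e /\ 0 < M /\
  forall w, D w -> nc (w - z) < e -> nc (f w - f z) <= M * nc (w - z).
Proof.
move=> /df[d /(_ 1 ltr01)[t t0 tP]]; exists (nc d + 1), t; do 2?split => //.
  by rewrite ltr_wpDl.
move=> w Dw wz; have -> : f w - f z = (f w - f z - d * (w - z)) + d * (w - z) by ring.
rewrite (le_trans (ncD _ _))// ncM mulrDl addrC lerD2l; exact: tP.
Qed.

Lemma pdiff_bounded : exists2 M : R, 0 <= M & forall z, D z -> nc (f z) <= M.
Proof.
have [n nP] : exists n : nat, forall z, nc z <= r -> nc (f z) <= n%:R.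
  apply: disc_uniformly => [m n z mn h|z Dz]; first by rewrite (le_trans h)// ler_nat.
  have [M [e [e0 [M0 MP]]]] := near_lip Dz.
  exists (Num.truncn (M * e + nc (f z))).+1, e; split => // w Dw wz.
  rewrite (le_trans _ (ltW (truncnS_gt _)))//.
  have -> : f w = (f w - f z) + f z by rewrite subrK.
  by rewrite (le_trans (ncD _ _))// lerD2r (le_trans (MP _ Dw wz))// ler_wpM2l// ltW.
by exists n%:R.
Qed.

Lemma pdiff_ucont : ucont D f.
Proof.
move=> e e0.
have [n nP] : exists n : nat, forall z, nc z <= r ->
    forall y, D y -> nc (y - z) < n.+1%:R^-1 -> nc (f y - f z) <= e.
  apply: disc_uniformly => [m n z mn h y Dy yz|z Dz].
    by apply: h => //; rewrite (lt_le_trans yz)// lef_pV2 ?posrE// ler_nat.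
  have [M [t [t0 [M0 MP]]]] := near_lip Dz.
  pose s := Num.min t (e / (2 * M)) / 2.
  have s0 : 0 < s by rewrite divr_gt0// lt_min t0 !divr_gt0// mulr_gt0.
  exists (Num.truncn s^-1), s; split => // w Dw wz y Dy yw.
  have {}yw : nc (y - w) < s.
    rewrite (lt_le_trans yw)// invf_ple ?posrE//.
    exact: ltW (truncnS_gt _).
  have yz : nc (y - z) < 2 * s by have := nc_triangle w y z; lra.
  have ms : 2 * s = Num.min t (e / (2 * M)) by rewrite /s; field.
  have {}ms : 2 * s <= t /\ 2 * s <= e / (2 * M) by rewrite ms !ge_min !lexx orbT.
  have [ms1 ms2] := ms.
  have B x : D x -> nc (x - z) < 2 * s -> nc (f x - f z) <= e / 2.
    move=> Dx xz; rewrite (le_trans (MP _ Dx (lt_le_trans xz ms1)))//.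
    rewrite (@le_trans _ _ (M * (e / (2 * M))))//.
      by apply: ler_wpM2l; [exact: ltW|exact: le_trans (ltW xz) ms2].
    by apply: eq_ler; field; rewrite gt_eqF.
  have h1 := B _ Dy yz.
  have h2 : nc (f w - f z) <= e / 2 by apply: B => //; lra.
  by have := nc_triangle (f z) (f y) (f w); rewrite [nc (f z - f w)]nc_distC; lra.
by exists n.+1%:R^-1 => // x y Dx Dy xy; exact: nP.
Qed.

End pdiff_on_disc.

End complex_compactness.

(** * Cauchy's integral formula on the unit disc *)

Section cauchy_formula.
Variable R : realType.
Local Notation C := R[i].
Implicit Types (z w : C) (F f : C -> C).

Lemma expr_small (a e : R) : 0 <= a -> a < 1 -> 0 < e -> exists K, a ^+ K < e.
Proof.
move=> a0 a1 e0; have na : `|a| < 1 by rewrite ger0_norm.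
have /cvgrPdist_lt/(_ e e0)[N _ NP] := cvg_expr na.
exists N; have := NP N (leqnn _) => /=.
by rewrite sub0r normrN ger0_norm// exprn_ge0.
Qed.

(** A function on the unit interval whose derivative is 0, uniformly, is constant:
    telescope over a fine subdivision. *)
Lemma udiff_const_01 (phi : R -> C) :
  (forall e : R, 0 < e -> exists2 d : R, 0 < d &
    forall s t, 0 <= s <= 1 -> 0 <= t <= 1 -> `|t - s| < d ->
      nc (phi t - phi s) <= e * `|t - s|) ->
  phi 1 = phi 0.
Proof.
move=> H; apply/eqP; rewrite -subr_eq0; apply/eqP; apply: nc_eq_small => e /H[d d0 dP].
pose N := (Num.truncn d^-1).+1; have N0 : (0 : R) < N%:R by rewrite ltr0n.
have Nd : N%:R^-1 < d by rewrite invf_plt ?posrE//; exact: truncnS_gt.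
pose u k := phi (k%:R / N%:R).
have -> : phi 1 - phi 0 = \sum_(0 <= k < N) (u k.+1 - u k).
  by rewrite telescope_sumr// /u mul0r divff// gt_eqF.
rewrite (le_trans (nc_sum _ _ _))//.
rewrite (@le_trans _ _ (\sum_(0 <= k < N) e * N%:R^-1))//.
  rewrite big_nat [leRHS]big_nat ler_sum// => k /andP[_ kN].
  have kk : k.+1%:R / N%:R - k%:R / N%:R = N%:R^-1 :> R.
    by rewrite -mulrBl -natrB// subSnn mul1r.
  have := dP (k%:R / N%:R) (k.+1%:R / N%:R); rewrite kk gtr0_norm ?invr_gt0//.
  have le01 j : (j <= N)%N -> 0 <= (j%:R / N%:R : R) <= 1.
    by move=> jN; rewrite divr_ge0//= ler_pdivrMr// mul1r ler_nat.
  by apply => //; apply: le01 => //; exact: ltnW.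
by rewrite sumr_const_nat subn0 -[leLHS]mulr_natr divfK// gt_eqF.
Qed.

Lemma kernel_neq0 z w : nc z = 1 -> nc w < 1 -> z - w != 0.
Proof. by move=> z1; apply: contraTneq => /subr0_eq <-; rewrite z1 ltxx. Qed.

Lemma kernel_ge z w : nc z = 1 -> 1 - nc w <= nc (z - w).
Proof. by move=> <-; rewrite -(ncN w) nc_geB. Qed.

Lemma kernel_le z w : nc z = 1 -> nc w < 1 -> nc (z / (z - w)) <= (1 - nc w)^-1.
Proof.
move=> z1 w1; rewrite ncM z1 mul1r ncV lef_pV2 ?posrE ?kernel_ge ?subr_gt0//.
by rewrite nc_gt0 kernel_neq0.
Qed.

(** The Cauchy kernel is the sum of a geometric series. *)
Lemma geometric_kernel K z w : nc z = 1 -> nc w < 1 ->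
  z / (z - w) - \sum_(k < K) w ^+ k * z^-1 ^+ k = w ^+ K * z^-1 ^+ K * (z / (z - w)).
Proof.
move=> z1 w1; have zw := kernel_neq0 z1 w1; have z0 := circle_neq0 z1.
have h : w * z^-1 - 1 = - ((z - w) / z) by field.
have h0 : w * z^-1 - 1 != 0 by rewrite h oppr_eq0 mulf_neq0// invr_eq0.
have hz : z / (z - w) = - (w * z^-1 - 1)^-1 by rewrite h invrN opprK invf_div.
under eq_bigr => k _ do rewrite -exprMn.
rewrite -exprMn -[\sum_(_ < _) _](mulKf h0) -subrX1 hz; ring.
Qed.

Lemma mean_id : mean (fun z : C => z) = 0.
Proof.
have D1 : udiff (@circle R) id (fun=> 1).
  move=> e e0; exists 1 => // x y _ _ _.
  by rewrite mul1r subrr nc0 mulr_ge0 ?nc_ge0 ?ltW.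
have D2 (w : C) : nc w = 1 -> nc w <= 1 by move=> ->.
have := mean_by_parts 0 D1 D2.
rewrite mul0r => <-; apply: eq_mean => w _.
by rewrite expr0 mulr1 mul1r.
Qed.

Lemma mean_kernel w : nc w < 1 -> mean (fun z => z / (z - w)) = 1.
Proof.
move=> w1; apply/eqP; rewrite -subr_eq0; apply/eqP; apply: nc_eq_small => e e0.
have d0 : 0 < 1 - nc w by rewrite subr_gt0.
have [K KP] := expr_small (nc_ge0 w) w1 (mulr_gt0 e0 d0).
have {KP} : nc w ^+ K.+1 <= e * (1 - nc w).
  by rewrite exprS (le_trans _ (ltW KP))// ler_piMl ?exprn_ge0// ltW.
have -> : 1 = mean (fun z : C => \sum_(k < K.+1) w ^+ k * z^-1 ^+ k).
  rewrite mean_sum big_ord_recl big1 ?addr0.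
    by rewrite meanZ expr0 mul1r -[LHS](mean_cst (1 : C)); apply: eq_mean => z _; rewrite expr0.
  by move=> i _; rewrite meanZ mean_negX// mulr0.
move=> wK; rewrite -meanB; apply: mean_bound => z z1.
rewrite geometric_kernel// ncM ncM !ncX circleV// expr1n mulr1.
rewrite (le_trans (ler_pM _ _ wK (kernel_le z1 w1))) ?exprn_ge0 ?nc_ge0//.
by rewrite mulfK// gt_eqF.
Qed.

Let D : set C := [set z | nc z <= 1].

Section primitive.
Variables (F f : C -> C) (M : R).
Hypotheses (Ff : udiff D F f) (FM : forall z, D z -> nc (F z) <= M)
  (fM : forall z, D z -> nc (f z) <= M).

Let M0 : 0 <= M.
Proof. by apply: le_trans (nc_ge0 (F 0)) (FM _); rewrite /D /= nc0. Qed.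

Let D_conv w z (t : R) : D w -> D z -> 0 <= t <= 1 -> D (w + t%:C * (z - w)).
Proof.
move=> Dw Dz /andP[t0 t1].
have -> : w + t%:C * (z - w) = (1 - t)%:C * w + t%:C * z.
  by rewrite rmorphB rmorph1; ring.
rewrite /D /= (le_trans (ncD _ _))// !ncM !nc_posreal ?subr_ge0//.
rewrite -[leRHS](subrK t) lerD//; first by rewrite -[leRHS]mulr1 ler_wpM2l ?subr_ge0.
by rewrite -[leRHS]mulr1 ler_wpM2l.
Qed.

(** The mean of [F (w + t (z - w))] against the kernel does not depend on [t] in the
    unit interval: its derivative is the mean of [f (w + t (z - w)) * z], which is 0 by
    integration by parts.  It is [F w] for [t = 0]. *)
Lemma cauchy_primitive w : nc w < 1 -> mean (fun z => F z * (z / (z - w))) = F w.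
Proof.
move=> w1; have Dw : D w by exact: ltW.
have Dc z : nc z = 1 -> D z by move=> z1; rewrite /D /= z1.
pose phi (t : R) := mean (fun z => F (w + t%:C * (z - w)) * (z / (z - w))).
have -> : mean (fun z => F z * (z / (z - w))) = phi 1.
  by congr mean; apply/funext => z; rewrite rmorph1 mul1r addrCA subrr addr0.
have <- : phi 0 = F w.
  rewrite /phi -[RHS]mulr1 -(mean_kernel w1) -meanZ; congr mean; apply/funext => z.
  by rewrite rmorph0 mul0r addr0.
apply: udiff_const_01 => e /Ff[d d0 dP]; exists (d / 2); first by rewrite divr_gt0.
move=> s t s01 t01 st.
have f0 : mean (fun z => f (w + s%:C * (z - w)) * z) = 0.
  have [s0|s0] := eqVneq s 0.
    rewrite s0 -[RHS](mulr0 (f w)) -mean_id -meanZ; congr mean; apply/funext => z.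
    by rewrite rmorph0 mul0r addr0.
  have G : udiff (@circle R) (fun z => F (w + s%:C * (z - w)))
      (fun z => s%:C * f (w + s%:C * (z - w))).
    move=> c c0; have [h h0 hP] := Ff c0; exists h => // x y x1 y1 xy.
    have -> : s%:C * f (w + s%:C * (x - w)) * (y - x) = f (w + s%:C * (x - w)) *
        ((w + s%:C * (y - w)) - (w + s%:C * (x - w))) by ring.
    have es : nc ((w + s%:C * (y - w)) - (w + s%:C * (x - w))) <= nc (y - x).
      have -> : (w + s%:C * (y - w)) - (w + s%:C * (x - w)) = s%:C * (y - x) by ring.
      by case/andP: s01 => s1 s2; rewrite ncM nc_posreal// ler_piMl.
    have := hP _ _ (D_conv Dw (Dc _ x1) s01) (D_conv Dw (Dc _ y1) s01) (le_lt_trans es xy).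
    move=> {}hP; apply: (le_trans hP).
    by apply: ler_wpM2l => //; exact: ltW.
  have GM z : nc z = 1 -> nc (F (w + s%:C * (z - w))) <= M.
    by move=> z1; apply: FM; apply: D_conv => //; exact: Dc.
  have := mean_by_parts 0 G GM.
  rewrite mul0r (_ : (fun z => _) = fun z => s%:C * (f (w + s%:C * (z - w)) * z)); last first.
    by apply/funext => z; rewrite expr0 mulr1 mulrA.
  rewrite meanZ => /eqP; rewrite mulf_eq0 => /orP[/eqP/complexI|/eqP//].
  by move=> h; rewrite h eqxx in s0.
have -> : phi t - phi s = mean (fun z =>
    (F (w + t%:C * (z - w)) - F (w + s%:C * (z - w)) -
     f (w + s%:C * (z - w)) * ((w + t%:C * (z - w)) - (w + s%:C * (z - w)))) * (z / (z - w))).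
  rewrite -[LHS]subr0 -[0 in LHS](mulr0 (t - s)%:C) -f0 -meanZ -!meanB; apply: eq_mean => z z1.
  by rewrite rmorphB; field; exact: kernel_neq0.
apply: mean_bound => z z1; have zw := kernel_neq0 z1 w1.
have es : nc ((w + t%:C * (z - w)) - (w + s%:C * (z - w))) = `|t - s| * nc (z - w).
  have -> : (w + t%:C * (z - w)) - (w + s%:C * (z - w)) = (t - s)%:C * (z - w).
    by rewrite rmorphB; ring.
  by rewrite ncM nc_real.
have h : nc ((w + t%:C * (z - w)) - (w + s%:C * (z - w))) < d.
  rewrite es (@le_lt_trans _ _ (`|t - s| * 2))//.
    by rewrite ler_wpM2l// (le_trans (ncB _ _))// z1; move: w1; lra.
  by rewrite -ltr_pdivlMr.
have := dP _ _ (D_conv Dw (Dc _ z1) s01) (D_conv Dw (Dc _ z1) t01) h.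
rewrite es ncM => {}h; rewrite (le_trans (ler_wpM2r _ h))// ncM z1 mul1r ncV.
by rewrite -!mulrA mulfV ?mulr1// gt_eqF// nc_gt0.
Qed.

(** Difference quotients at [w] of the formula for [F]. *)
Lemma cauchy_derivative w : nc w < 1 -> mean (fun z => F z * (z / (z - w) ^+ 2)) = f w.
Proof.
move=> w1; have Dw : D w by exact: ltW.
set A := mean _; pose a := 1 - nc w; have a0 : 0 < a by rewrite subr_gt0.
pose B := M / (a ^+ 2 * (a / 2)); have B0 : 0 <= B.
  by rewrite divr_ge0// mulr_ge0 ?sqr_ge0// divr_ge0// ltW.
apply/eqP; rewrite -subr_eq0; apply/eqP; apply: nc_eq_small => e e0.
have e2 : 0 < e / 2 by rewrite divr_gt0.
have [d d0 dP] := Ff e2.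
pose h : R := Num.min (d / 2) (Num.min (a / 2) (e / 2 / (1 + B))).
have h0 : 0 < h by rewrite !lt_min !divr_gt0//= ltr_pwDl.
have hd : h < d.
  by rewrite (@le_lt_trans _ _ (d / 2)) ?ge_min ?lexx// ltr_pdivrMr// ltr_pMr// ltr1n.
have ha : h <= a / 2 by rewrite !ge_min lexx !orbT.
have hB : h * B <= e / 2.
  have : h <= e / 2 / (1 + B) by rewrite !ge_min lexx !orbT.
  rewrite ler_pdivlMr ?ltr_pwDl//; apply: le_trans.
  by rewrite mulrDr mulr1 lerDr ltW.
have wh : nc (w + h%:C) < 1.
  rewrite (le_lt_trans (ncD _ _))// (nc_posreal (ltW h0)); rewrite /a in ha a0; lra.
have ne0 : h%:C != 0 :> C by rewrite -nc_gt0 (nc_posreal (ltW h0)).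
have hh : (w + h%:C) - w = h%:C by ring.
have := dP w (w + h%:C) Dw (ltW wh); rewrite hh (nc_posreal (ltW h0)) => /(_ hd) h1.
have h2 : nc (F (w + h%:C) - F w - h%:C * A) <= h * (h * B).
  rewrite -(cauchy_primitive wh) -(cauchy_primitive w1) /A -meanZ -!meanB.
  apply: mean_bound => z z1; have zw := kernel_neq0 z1 w1; have zwh := kernel_neq0 z1 wh.
  have -> : F z * (z / (z - (w + h%:C))) - F z * (z / (z - w)) -
      h%:C * (F z * (z / (z - w) ^+ 2)) =
      h%:C ^+ 2 * (F z * (z / ((z - w) ^+ 2 * (z - (w + h%:C))))).
    by field; rewrite zw zwh.
  rewrite ncM ncX (nc_posreal (ltW h0)) [leRHS]mulrA -[X in _ <= X * _]expr2.
  apply: ler_wpM2l; first exact: sqr_ge0.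
  rewrite ncM; apply: ler_pM => //; first by apply: FM; rewrite /D /= z1.
  rewrite ncM z1 mul1r ncV lef_pV2 ?posrE ?nc_gt0 ?mulf_neq0 ?expf_neq0//; last first.
    by rewrite mulr_gt0 ?exprn_gt0// divr_gt0.
  rewrite ncM ncX; apply: ler_pM; [exact: sqr_ge0|by rewrite divr_ge0 ?(ltW a0)| |].
    by rewrite lerXn2r ?nnegrE ?(ltW a0)//; exact: kernel_ge.
  apply: le_trans (kernel_ge _ z1).
  have := ncD w h%:C; rewrite (nc_posreal (ltW h0)) /a; rewrite /a in ha; lra.
have : nc (h%:C * (A - f w)) <= h * e.
  have -> : h%:C * (A - f w) = (F (w + h%:C) - F w - f w * h%:C) -
     (F (w + h%:C) - F w - h%:C * A) by ring.
  rewrite (le_trans (ncB _ _))// (le_trans (lerD h1 h2))//.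
  have := ler_wpM2l (ltW h0) hB; lra.
by rewrite ncM (nc_posreal (ltW h0)) ler_pM2l.
Qed.

(** Integration by parts moves the derivative from the kernel to [F]. *)
Lemma cauchy_by_parts w : nc w < 1 -> mean (fun z => f z * (z / (z - w))) = f w.
Proof.
move=> w1; rewrite -(cauchy_derivative w1).
have a0 : 0 < 1 - nc w by rewrite subr_gt0.
pose k z := (z - w)^-1; pose a := (1 - nc w)^-1.
have ap : 0 < a by rewrite invr_gt0.
have ka z : nc z = 1 -> nc (k z) <= a.
  move=> z1; rewrite ncV lef_pV2 ?posrE ?kernel_ge//.
  by rewrite nc_gt0 kernel_neq0.
have G : udiff (@circle R) (fun z => F z * k z) (fun z => f z * k z - F z * k z ^+ 2).
  move=> e e0.
  pose B := a * (1 + M * a + M * a ^+ 2).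
  have Ma : 0 <= M * a by rewrite mulr_ge0// ltW.
  have Ma2 : 0 <= M * a ^+ 2 by rewrite mulr_ge0// sqr_ge0.
  have B0 : 0 < B by rewrite mulr_gt0// -addrA ltr_pwDl// addr_ge0.
  have [d d0 dP] := Ff (divr_gt0 e0 B0).
  exists (Num.min d (e / B)); first by rewrite lt_min d0 divr_gt0.
  move=> x y x1 y1; rewrite lt_min => /andP[xy1 xy2].
  have xw := kernel_neq0 x1 w1; have yw := kernel_neq0 y1 w1.
  have Dx : D x by rewrite /D /= x1. have Dy : D y by rewrite /D /= y1.
  have -> : F y * k y - F x * k x - (f x * k x - F x * k x ^+ 2) * (y - x) =
    (F y - F x - f x * (y - x)) * k y - f x * k x * k y * (y - x) ^+ 2 +
    F x * (k x ^+ 2 * k y) * (y - x) ^+ 2.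
    by rewrite /k; field; rewrite xw yw.
  set u := nc (y - x).
  have u0 : 0 <= u by exact: nc_ge0.
  have h1 : nc ((F y - F x - f x * (y - x)) * k y) <= e / B * u * a.
    by apply: nc_mul_le; [exact: dP|exact: ka].
  have h2 : nc (f x * k x * k y * (y - x) ^+ 2) <= M * a * a * u ^+ 2.
    apply: nc_mul_le; last by rewrite ncX.
    by do 2?apply: nc_mul_le; [exact: fM|exact: ka|exact: ka].
  have h3 : nc (F x * (k x ^+ 2 * k y) * (y - x) ^+ 2) <= M * (a ^+ 2 * a) * u ^+ 2.
    apply: nc_mul_le; last by rewrite ncX.
    apply: nc_mul_le; first exact: FM.
    apply: nc_mul_le; last exact: ka.
    by rewrite ncX lerXn2r ?nnegrE ?(ltW ap)//; exact: ka.
  rewrite (le_trans (ncD _ _))// (le_trans (lerD (ncB _ _) (lexx _)))//.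
  rewrite (le_trans (lerD (lerD h1 h2) h3))//.
  have uu : u ^+ 2 <= e / B * u by rewrite expr2 ler_wpM2r// ltW.
  have c1 : 0 <= M * a * a + M * (a ^+ 2 * a).
    by rewrite [M * (_ * _)]mulrA -mulrDl mulr_ge0 ?(ltW ap)// addr_ge0.
  have := ler_wpM2l c1 uu.
  have -> : e * u = e / B * u * a + (M * a * a + M * (a ^+ 2 * a)) * (e / B * u).
    have : e / B * B = e by rewrite divfK// gt_eqF.
    by move=> {1}<-; rewrite {2}/B; ring.
  lra.
have GM z : nc z = 1 -> nc (F z * k z) <= M * a.
  by move=> z1; apply: nc_mul_le; [apply: FM; rewrite /D /= z1|exact: ka].
have := mean_by_parts 0 G GM; rewrite mul0r => e.
apply/eqP; rewrite -subr_eq0 -meanB -e; apply/eqP; apply: eq_mean => z z1.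
by rewrite expr0 mulr1 /k; field; exact: kernel_neq0.
Qed.

End primitive.

(** The formula for the derivative of a primitive of [f], which exists by Goursat's
    lemma. *)
Lemma cauchy_formula f w : (forall z, nc z <= 1 -> exists d, pdiff D f z d) ->
  nc w < 1 -> mean (fun z => f z * (z / (z - w))) = f w.
Proof.
move=> df; have [M M0 fM] := pdiff_bounded df.
have [F [Ff FM]] := primitive_exists (pdiff_ucont df) df.
by apply: (@cauchy_by_parts F f (1 * M) Ff (FM _ fM)); rewrite mul1r.
Qed.

End cauchy_formula.

(** * Differentiability with explicit estimates *)

Section differentiability.
Variable R : realType.
Local Notation C := R[i].

Lemma derivable_line_pdiff (V : normedModType C) (S : set C) (f : V -> C) z v :
  derivable f z v -> pdiff S (fun t => f (z + t *: v)) 0 ('D_v f z).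
Proof.
move=> df e e0.
have /cvgrPdist_le/(_ e%:C) := df.
rewrite ltcR => /(_ e0) /nbhs_ncP[t t0 tP].
exists t => // y _; rewrite subr0 => y0; have [->|yn0] := eqVneq y 0.
  by rewrite scale0r mulr0 !subr0 subrr nc0 mulr0.
have := tP y; rewrite subr0 => /(_ y0 yn0).
rewrite normr_normc lecR => h.
have nz : 0 < nc y by rewrite nc_gt0.
rewrite -ler_pdivrMr// -ncV -ncM; apply: le_trans h.
rewrite nc_distC; apply: eq_ler; congr nc.
rewrite -[y^-1 *: _]/(y^-1 * (f (y *: v + z) - f z)).
by rewrite -[lim _]/('D_v f z) scale0r addr0 (addrC z); field.
Qed.

Lemma derivable_pdiff (S : set C) (f : C -> C) z :
  derivable f z 1 -> exists d, pdiff S f z d.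
Proof.
move=> /(@derivable_line_pdiff _ setT) H; exists ('D_1 f z) => e /H[t t0 tP].
exists t => // y _ yz; have := tP (y - z) I; rewrite !subr0 => /(_ yz).
have e1 x : z + x *: (1 : C) = z + x by rewrite -[_ *: _]/(_ * _) mulr1.
by rewrite !e1 addr0 [z + (y - z)]addrC subrK.
Qed.

Lemma differentiable_pdiff (S : set C) (f : C -> C) z :
  differentiable f z -> exists d, pdiff S f z d.
Proof. by move=> /derivable1_diffP; exact: derivable_pdiff. Qed.

Variable n : nat.
Local Notation Cn := 'rV[C]_n.
Implicit Types (z h : Cn).

(** The sum norm, for which estimates of bilinear expressions are immediate. *)
Definition snorm h : R := \sum_j nc (h 0 j).

Lemma snorm_ge0 h : 0 <= snorm h. Proof. exact: sumr_ge0. Qed.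

Lemma nc_le_snorm h j : nc (h 0 j) <= snorm h.
Proof. by rewrite /snorm (bigD1 j)//= lerDl sumr_ge0. Qed.

Lemma dotC_linear (a : Cn) : linear (dotC a : Cn -> C).
Proof.
move=> c x y; rewrite /dotC -[_ *: _ in RHS]/(_ * _) mulr_sumr -big_split /=.
by apply: eq_bigr => j _; rewrite !mxE; ring.
Qed.

HB.instance Definition _ a := GRing.isLinear.Build C Cn C *:%R (dotC a) (dotC_linear a).

Lemma dotCC (a b : Cn) : dotC a b = dotC b a.
Proof. by apply: eq_bigr => j _; rewrite mulrC. Qed.

Lemma nbhs_rowP z (A : set Cn) :
  nbhs z A <-> exists2 e : R, 0 < e & forall w : Cn, (forall j, nc (w 0 j - z 0 j) < e) -> A w.
Proof.
split=> [/nbhs_ballP[e /= e0 eA]|[e e0 eA]]; last first.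
  apply/nbhs_ballP; exists e%:C => /=; first by rewrite ltcR.
  move=> w zw; apply: eA => j; have := zw.2 0 j.
  by rewrite -ball_normE /= distrC normr_normc ltcR.
case: e e0 eA => a b; rewrite ltcE /= => /andP[/eqP -> a0] eA.
exists a => // w wz; apply: eA; split; first by rewrite ltcE /= eqxx.
move=> i j; rewrite ord1 -ball_normE /= distrC normr_normc ltcR.
exact: wz.
Qed.

Lemma row_norm_ge h : exists2 m : R, `|h| = m%:C & forall j, nc (h 0 j) <= m.
Proof.
have [m hm] : exists m : R, `|h| = m%:C.
  by apply/complex_realP; exact: normr_real.
exists m => // j; apply/ler_addgt0Pr => e e0.
have : ball (0 : Cn) (m + e)%:C h.
  by rewrite -ball_normE /= sub0r normrN hm ltcR ltrDl.
move=> [_ /(_ 0 j)]; rewrite -ball_normE /= mxE sub0r normrN normr_normc ltcR.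
exact: ltW.
Qed.

(** A second order estimate identifies the differential. *)
Lemma quadratic_differentiable (G : Cn -> C) z (a : Cn) (K d : R) : 0 < d ->
  (forall h, snorm h < d -> nc (G (z + h) - G z - dotC a h) <= K * snorm h ^+ 2) ->
  differentiable G z /\ forall j, 'D_(delta_mx 0 j) G z = a 0 j.
Proof.
move=> d0 H.
have H0 h : snorm h < d -> nc (G (z + h) - G z - dotC a h) <= `|K| * snorm h ^+ 2.
  move=> /H h1; apply: (le_trans h1); apply: ler_wpM2r; first exact: sqr_ge0.
  exact: ler_norm.
have ca : continuous (dotC a : Cn -> C).
  by move=> w; apply: differentiable_continuous; exact: differentiable_dotC.
have E : (G \o shift z = cst (G z) + (dotC a : Cn -> C) +o_ (0 : Cn) id).
  apply/eqaddoP => e' e'0.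
  have [e ee e0] : exists2 e : R, e' = e%:C & 0 < e.
    by case: e' e'0 => u v; rewrite ltcE /= => /andP[/eqP -> u0]; exists u.
  pose k : R := n.+1%:R; have k0 : 0 < k by rewrite ltr0n.
  pose c := 1 + `|K| * k ^+ 2; have c0 : 0 < c by rewrite ltr_pwDl// mulr_ge0 ?sqr_ge0.
  apply/nbhs_rowP; exists (Num.min (d / k) (e / c)); first by rewrite lt_min !divr_gt0.
  move=> h hj; have [m hm hjm] := row_norm_ge h.
  have m0 : 0 <= m by rewrite -ler0c -hm normr_ge0.
  have sm : snorm h <= k * m.
    rewrite (@le_trans _ _ (\sum_(j < n) m)) ?ler_sum//.
    by rewrite sumr_const card_ord -mulr_natl ler_wpM2r// ler_nat.
  have [hd he] : snorm h < d /\ m <= e / c.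
    split.
      case: (ltnP 0 n) => [n0|]; last first.
        rewrite leqn0 => /eqP n0; rewrite /snorm big1// => j.
        by have := ltn_ord j; rewrite {2}n0.
      rewrite (@lt_le_trans _ _ (\sum_(j < n) d / k))//.
        apply: ltr_sum => [|j _]; first by apply/hasP; exists (Ordinal n0); rewrite ?mem_index_enum.
        by have := hj j; rewrite mxE subr0 lt_min => /andP[].
      rewrite sumr_const card_ord -[leLHS]mulr_natr mulrAC ler_pdivrMr//.
      by rewrite ler_wpM2l ?(ltW d0)// ler_nat.
    have : ball (0 : Cn) (e / c)%:C h.
      split; first by rewrite ltcR divr_gt0.
      move=> i j; rewrite ord1 -ball_normE /= distrC normr_normc ltcR.
      by have := hj j; rewrite lt_min => /andP[].
    by rewrite -ball_normE /= sub0r normrN hm ltcR => /ltW.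
  rewrite hm ee -rmorphM normr_normc lecR.
  have := H0 _ hd.
  rewrite -[X in nc X <= _ -> _]/(_ - _ - _) => h1.
  have -> : (G \o shift z - (cst (G z) + (dotC a : Cn -> C))) h = G (z + h) - G z - dotC a h.
    by rewrite -[LHS]/(G (h + z) - (G z + dotC a h)) opprD addrA addrC (addrC h) addrC.
  rewrite (le_trans h1)// (@le_trans _ _ (`|K| * (k * m) ^+ 2))//.
    by apply: ler_wpM2l => //; rewrite lerXn2r ?nnegrE ?snorm_ge0// mulr_ge0// ltW.
  rewrite exprMn mulrA expr2 mulrA; apply: ler_wpM2r => //.
  rewrite (@le_trans _ _ (c * m))//; first by rewrite ler_wpM2r// lerDr.
  by rewrite mulrC -ler_pdivlMr.
have dz := diff_unique ca E.
have dG : differentiable G z by apply/diff_locallyP; rewrite dz.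
split=> // j; rewrite deriveE// dz -[LHS]/(\sum_i a 0 i * delta_mx 0 j 0 i).
rewrite (bigD1 j)//= big1 ?addr0.
  by rewrite mxE !eqxx mulr1.
by move=> i ij; rewrite mxE (negbTE ij) andbF mulr0.
Qed.

(** Change of the coordinate [j] to [t], written as a motion along a line so that it
    is differentiable in [t]. *)
Definition upd z (j : 'I_n) (t : C) : Cn := z + (t - z 0 j) *: delta_mx 0 j.

Lemma updE z j t i : upd z j t 0 i = if i == j then t else z 0 i.
Proof.
rewrite !mxE eqxx /=; case: eqVneq => [->|_]; last by rewrite mulr0 addr0.
by rewrite mulr1 addrC subrK.
Qed.

Lemma differentiable_line z h t : differentiable (fun t : C => z + t *: h) t.
Proof.
apply: differentiableD; first exact: differentiable_cst.
exact: (@differentiableZl _ _ _ id).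
Qed.

Lemma differentiable_upd z j t : differentiable (upd z j) t.
Proof.
rewrite (_ : upd z j = fun t => (z - z 0 j *: delta_mx 0 j) + t *: delta_mx 0 j).
  exact: differentiable_line.
by apply/funext => s; rewrite /upd scalerBl addrA addrAC.
Qed.

End differentiability.

(** * Consequences of Cauchy's formula in one variable *)

Section one_variable.
Variable R : realType.
Local Notation C := R[i].
Implicit Types (z w : C) (f : C -> C).

Let D : set C := [set z | nc z <= 1].
Definition holdisc f := forall z, nc z <= 1 -> exists d, pdiff D f z d.

Lemma differentiable_holdisc f : (forall z, differentiable f z) -> holdisc f.
Proof. by move=> df z _; exact: differentiable_pdiff. Qed.

Lemma mean_value f : holdisc f -> mean f = f 0.
Proof.
move=> hf; rewrite -(cauchy_formula hf (w := 0)) ?nc0 ?ltr01//.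
by apply: eq_mean => z z1; rewrite subr0 divff ?mulr1// circle_neq0.
Qed.

Lemma mean_posX k : (0 < k)%N -> mean (fun z : C => z ^+ k) = 0.
Proof.
move=> k0; rewrite mean_value ?expr0n ?gtn_eqF//.
by move=> z _; apply: derivable_pdiff; exact: exprn_derivable.
Qed.

Lemma mean_monomial a b : mean (fun z : C => z ^+ b * z^-1 ^+ a) = (a == b)%:R.
Proof.
have [ab|ab|->] := ltngtP a b.
- rewrite -[RHS](@mean_posX (b - a)) ?subn_gt0//; apply: eq_mean => z z1.
  have z0 := circle_neq0 z1; rewrite -{1}(subnK (ltnW ab)) exprD -mulrA -exprMn.
  by rewrite divff// expr1n mulr1.
- rewrite -[RHS](@mean_negX _ (a - b)) ?subn_gt0//; apply: eq_mean => z z1.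
  have z0 := circle_neq0 z1; rewrite -{1}(subnK (ltnW ab)) exprD mulrC -mulrA -exprMn.
  by rewrite mulVf// expr1n mulr1.
- rewrite -[RHS](mean_cst 1); apply: eq_mean => z z1.
  by rewrite -exprMn divff ?expr1n// circle_neq0.
Qed.

(** Expansion of the Cauchy kernel to the second order. *)
Lemma second_order f (M : R) w : holdisc f -> (forall z, nc z = 1 -> nc (f z) <= M) ->
  nc w <= 2^-1 -> nc (f w - f 0 - w * mean (fun z => f z * z^-1)) <= 2 * M * nc w ^+ 2.
Proof.
move=> hf fM w2; have w1 : nc w < 1 by rewrite (le_lt_trans w2)// invf_lt1// ltr1n.
have M0 : 0 <= M by apply: le_trans (fM 1 (nc1 _)).
rewrite -{1}(cauchy_formula hf w1) -(mean_value hf) -meanZ -!meanB.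
apply: mean_bound => z z1; have z0 := circle_neq0 z1; have zw := kernel_neq0 z1 w1.
have -> : f z * (z / (z - w)) - f z - w * (f z * z^-1) = f z * (w ^+ 2 * (z^-1 * (z - w)^-1)).
  by field; rewrite zw z0.
rewrite (ncM (f z)) (ncM (w ^+ 2)) ncX ncM !ncV z1 invr1 mul1r.
have -> : 2 * M * nc w ^+ 2 = M * (nc w * (nc w * 2)) by ring.
have h : 0 <= nc w * (nc w / nc (z - w)) by rewrite !mulr_ge0 ?invr_ge0 ?nc_ge0.
rewrite -[X in nc (f z) * X]mulrA; apply: ler_pM => //; first exact: fM.
do 2!apply: ler_wpM2l => //.
rewrite invf_ple ?posrE ?nc_gt0//.
by apply: le_trans (kernel_ge _ z1); move: w2; lra.
Qed.

(** Both numbers are the limit of the difference quotients at 0, the mean by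
    [second_order]. *)
Lemma derivative_mean f d : holdisc f -> pdiff D f 0 d -> mean (fun z => f z * z^-1) = d.
Proof.
move=> hf df; have [M M0 fM] := pdiff_bounded hf.
apply/eqP; rewrite -subr_eq0; apply/eqP; apply: nc_eq_small => e e0.
have [t t0 tP] := df _ (divr_gt0 e0 (ltr0Sn _ 1)).
pose h : R := Num.min (t / 2) (Num.min 2^-1 (e / 2 / (2 * M + 1))).
have M1 : 0 < 2 * M + 1 by rewrite ltr_wpDl// mulr_ge0.
have h0 : 0 < h by rewrite !lt_min invr_gt0 ltr0n !divr_gt0.
have ht : h < t by rewrite (@le_lt_trans _ _ (t / 2)) ?ge_min ?lexx//; lra.
have h2 : h <= 2^-1 by rewrite !ge_min lexx !orbT.
have he : 2 * M * h <= e / 2.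
  have : h <= e / 2 / (2 * M + 1) by rewrite !ge_min lexx !orbT.
  by rewrite ler_pdivlMr//; apply: le_trans; rewrite mulrC ler_wpM2l ?(ltW h0)// lerDl.
have nh : nc (h%:C : C) = h by rewrite (nc_posreal (ltW h0)).
have h1 : h <= 1 by rewrite (le_trans h2)// invf_le1// ler1n.
have := tP h%:C; rewrite /D /= subr0 nh => /(_ h1 ht) e1.
have fc z : nc z = 1 -> nc (f z) <= M by move=> z1; apply: fM; rewrite /D /= z1.
have := second_order hf fc (w := h%:C); rewrite nh => /(_ h2) e2.
set m := mean _ in e2 *.
have : nc (h%:C * (m - d)) <= h * e.
  have -> : h%:C * (m - d) = (f h%:C - f 0 - d * h%:C) - (f h%:C - f 0 - h%:C * m) by ring.
  rewrite (le_trans (ncB _ _))// (le_trans (lerD e1 e2))//.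
  have := ler_wpM2l (ltW h0) he; lra.
by rewrite ncM nh ler_pM2l.
Qed.

End one_variable.

(** * Taylor expansion of entire functions of several variables *)

Section taylor.
Variables (R : realType) (n : nat).
Local Notation C := R[i].
Local Notation Cn := 'rV[C]_n.
Implicit Types (z w : Cn) (f g : Cn -> C) (a b : 'I_n -> nat) (s : seq 'I_n).

Definition polysquare (r : R) : set Cn := [set z | forall j, square r (z 0 j)].

Lemma compact_polysquare r : compact (polysquare r).
Proof. by apply: (@rV_compact _ _ (fun=> square r)) => _; exact: compact_square. Qed.

Lemma entire_bounded f (r : R) : entire f ->
  exists2 M : R, 0 <= M & forall z, (forall j, nc (z 0 j) <= r) -> nc (f z) <= M.
Proof.
move=> fe; have := @compact_polysquare r.
move=> /compact_near_coveringP/(_ nat \oo (fun k z => nc (f z) <= k%:R) _).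
case=> [z _|N _ NP]; last first.
  exists N%:R => // z zr; apply: (NP N) => //= j; exact: disc_square.
have /nbhs_ncP : nbhs (f z) [set y | nc (y - f z) < 1] by apply/nbhs_ncP; exists 1.
case=> e e0 eP; have fz : continuous_at z f by apply: differentiable_continuous; exact: fe.
exists (f @^-1` [set y | nc (y - f z) < 1], [set k | (Num.truncn (nc (f z) + 1) < k)%N]).
  split; last by exists (Num.truncn (nc (f z) + 1)).+1.
  by apply: fz; apply/nbhs_ncP; exists e.
move=> [w k] [/= h1 h2]; rewrite (@le_trans _ _ (nc (f z) + 1))//.
  by have := nc_triangle (f z) (f w) 0; rewrite !subr0; move: h1; lra.
by rewrite (le_trans (ltW (truncnS_gt _)))// ler_nat.
Qed.

Lemma entire_scale f (r : C) : entire f -> entire (fun z => f (r *: z)).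
Proof.
by move=> fe z; apply: (@differentiable_comp _ _ _ _ (fun z => r *: z) f).
Qed.

(** * The mean over the torus *)

Definition pmean (j : 'I_n) g : Cn -> C := fun z => mean (fun t => g (upd z j t)).
Definition smean s g : Cn -> C := foldr pmean g s.

Lemma smean_scalar s (c : C) f g z :
  smean s (c *: f + g) z = c * smean s f z + smean s g z.
Proof.
elim: s z => [//|j s IH] z /=; rewrite /pmean -[RHS]mean_scalar.
by congr mean; apply/funext => t; rewrite IH.
Qed.

Lemma smean_bound s g z M :
  (forall w, (forall j, if j \in s then nc (w 0 j) = 1 else w 0 j = z 0 j) ->
    nc (g w) <= M) -> nc (smean s g z) <= M.
Proof.
elim: s z => [|j s IH] z gM /=; first exact: gM.
apply: mean_bound => t t1; apply: IH => w wP; apply: gM => i.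
have := wP i; rewrite inE updE; case: (i \in s) => //=; first by rewrite orbT.
by rewrite orbF; case: eqP => [_ ->|].
Qed.

Lemma smean_ext s g z w : (forall j, j \in s \/ z 0 j = w 0 j) ->
  smean s g z = smean s g w.
Proof.
elim: s z w => [|j s IH] z w zw /=.
  by congr g; apply/rowP => j; have [] := zw j.
congr mean; apply/funext => t; apply: IH => i.
have := zw i; rewrite inE !updE; case: (i == j) => /=; first by right.
by [].
Qed.

Lemma smean_pull s g (k : C -> C) j z : j \notin s ->
  smean s (fun z => k (z 0 j) * g z) z = k (z 0 j) * smean s g z.
Proof.
elim: s z => [//|i s IH] z; rewrite inE negb_or => /andP[ji js] /=.
rewrite -[RHS]meanZ; congr mean; apply/funext => t.
by rewrite IH// updE (negbTE ji).
Qed.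

Lemma smean_prod s (g : 'I_n -> C -> C) z : uniq s ->
  smean s (fun z => \prod_(j <- s) g j (z 0 j)) z = \prod_(j <- s) mean (g j).
Proof.
elim: s z => [z _|j s IH z /=]; first by rewrite /= !big_nil.
move=> /andP[js us]; rewrite big_cons mulrC -[RHS]meanZ; congr mean; apply/funext => t.
rewrite (_ : (fun z => _) = fun z => g j (z 0 j) * \prod_(i <- s) g i (z 0 i)).
  by rewrite smean_pull// updE eqxx IH// mulrC.
by apply/funext => w; rewrite big_cons.
Qed.

Definition kernel (t c : C) := t / (t - c).

(** Cauchy's formula in one variable, applied to the coordinates in turn: the
    outermost mean sees a function of one variable after the inner ones have
    reproduced [f]. *)
Lemma smean_cauchy s f w : uniq s -> entire f -> (forall j, nc (w 0 j) < 1) ->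
  smean s (fun z => f z * \prod_(j <- s) kernel (z 0 j) (w 0 j)) w = f w.
Proof.
move=> + fe w1; rewrite -[X in smean s _ X]/(w : Cn).
suff H z : uniq s -> (forall j, j \in s -> z 0 j = w 0 j) ->
    smean s (fun z => f z * \prod_(j <- s) kernel (z 0 j) (w 0 j)) z = f z.
  by move=> us; apply: H.
elim: s z => [|j s IH] z /=; first by rewrite big_nil mulr1.
move=> /andP[js us] zw; rewrite /pmean.
transitivity (mean (fun t => f (upd z j t) * (t / (t - w 0 j)))); last first.
  rewrite -(zw j) ?mem_head//; rewrite cauchy_formula.
  - by rewrite /upd subrr scale0r addr0.
  - move=> t _; apply: differentiable_pdiff; apply: differentiable_comp; last exact: fe.
    exact: differentiable_upd.
  - by rewrite zw ?mem_head.
congr mean; apply/funext => t.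
rewrite (_ : (fun z => _) = fun z => kernel (z 0 j) (w 0 j) *
    (f z * \prod_(i <- s) kernel (z 0 i) (w 0 i))); last first.
  by apply/funext => v; rewrite big_cons mulrCA.
rewrite (@smean_pull s _ (kernel ^~ (w 0 j)) j _ js) updE eqxx mulrC IH// => i si.
rewrite updE; case: eqP => [e|_]; first by rewrite -e si in js.
by rewrite zw// inE si orbT.
Qed.

Definition torus_mean g : C := smean (enum 'I_n) g 0.

Lemma torus_mean_scalar : scalar torus_mean.
Proof. by move=> c f g; exact: smean_scalar. Qed.

HB.instance Definition _ :=
  GRing.isLinear.Build C (Cn -> C) C *%R torus_mean torus_mean_scalar.

Definition torus : set Cn := [set z | forall j, nc (z 0 j) = 1].

Lemma torus_mean_bound g M : (forall z, torus z -> nc (g z) <= M) ->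
  nc (torus_mean g) <= M.
Proof.
by move=> gM; apply: smean_bound => w wP; apply: gM => j; have := wP j; rewrite mem_enum.
Qed.

Lemma torus_meanB f g : torus_mean (fun z => f z - g z) = torus_mean f - torus_mean g.
Proof. exact: linearB. Qed.

Lemma torus_meanZ c g : torus_mean (fun z => c * g z) = c * torus_mean g.
Proof. exact: (linearZ_LR (torus_mean : {linear _ -> _ | *%R})). Qed.

Lemma torus_mean_sum (I : Type) (r : seq I) (P : pred I) (G : I -> Cn -> C) :
  torus_mean (fun z => \sum_(i <- r | P i) G i z) = \sum_(i <- r | P i) torus_mean (G i).
Proof.
by rewrite -linear_sum; congr torus_mean; apply/funext => z; rewrite fct_sumE.
Qed.

Lemma torus_mean_prod (g : 'I_n -> C -> C) :
  torus_mean (fun z => \prod_j g j (z 0 j)) = \prod_j mean (g j).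
Proof.
rewrite -[RHS]big_enum -(smean_prod _ 0 (enum_uniq _)) /torus_mean.
by congr smean; apply/funext => z; rewrite big_enum.
Qed.

Lemma torus_mean_cauchy f w : entire f -> (forall j, nc (w 0 j) < 1) ->
  torus_mean (fun z => f z * \prod_j kernel (z 0 j) (w 0 j)) = f w.
Proof.
move=> fe w1; rewrite -[RHS](@smean_cauchy (enum 'I_n) f w (enum_uniq _) fe w1).
rewrite /torus_mean (@smean_ext _ _ 0 w); last by move=> j; left; rewrite mem_enum.
by congr smean; apply/funext => z; rewrite big_enum.
Qed.

(** * Taylor coefficients *)

Definition mono a z : C := \prod_j z 0 j ^+ a j.
Definition tdeg a : nat := \sum_j a j.

Lemma monoZ a (r : C) z : mono a (r *: z) = r ^+ tdeg a * mono a z.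
Proof.
rewrite /mono (eq_bigr (fun j => r ^+ a j * z 0 j ^+ a j)) => [|j _].
  by rewrite big_split /= prodrXr.
by rewrite mxE exprMn.
Qed.

Definition imono a z : C := \prod_j (z 0 j)^-1 ^+ a j.

Lemma nc_imono_torus a z : torus z -> nc (imono a z) = 1.
Proof. by move=> z1; rewrite nc_prod big1// => j _; rewrite ncX circleV ?expr1n. Qed.

Lemma torus_mean_mono a b :
  torus_mean (fun z => mono b z * imono a z) = [forall j, a j == b j]%:R.
Proof.
rewrite (_ : (fun z => _) = fun z => \prod_j (z 0 j ^+ b j * (z 0 j)^-1 ^+ a j)); last first.
  by apply/funext => z; rewrite /mono /imono -big_split.
rewrite (torus_mean_prod (fun j t => t ^+ b j * t^-1 ^+ a j)).
under eq_bigr => j _ do rewrite mean_monomial.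
case: forallP => [h|/forallP]; first by rewrite big1// => j _; rewrite h.
by rewrite negb_forall => /existsP[j h]; rewrite (bigD1 j)//= (negbTE h) mul0r.
Qed.

(** The coefficient is defined as a mean over the unit torus; for an entire function
    the mean over any other torus gives the same coefficient, see [taylor_scale]. *)
Definition taylor f a : C := torus_mean (fun z => f z * imono a z).

Lemma taylor_scalar a : scalar (taylor ^~ a).
Proof.
move=> c f g; rewrite /taylor -[RHS]torus_mean_scalar; congr torus_mean.
by apply/funext => z; rewrite mulrDl -mulrA.
Qed.

Local Notation box K := {ffun 'I_n -> 'I_K}.
Definition idx K (a : box K) : 'I_n -> nat := fun j => a j.

(** Exponents range over boxes because the sum of the monomials over a box is a
    product of sums in one variable. *)
Definition taylor_sum K f z : C := \sum_(a : box K) taylor f (idx a) * mono (idx a) z.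

Definition box_error K : R := 4 ^+ n / 2 ^+ K.

Lemma box_error_small (M e : R) : 0 < e -> exists K0, forall K, (K0 <= K)%N -> M * box_error K <= e.
Proof.
move=> e0; exists (Num.truncn (M * 4 ^+ n / e)) => K hK.
rewrite mulrA ler_pdivrMr ?exprn_gt0// -ler_pdivrMl// [leLHS]mulrC ltW//.
rewrite (lt_le_trans (truncnS_gt _))// -(natrX R 2 K) ler_nat.
exact: leq_ltn_trans hK (ltn_expl _ _).
Qed.

Lemma nc_prod_sub1 s (y : 'I_n -> C) (x : R) : 0 <= x -> x <= 1 ->
  (forall j, nc (y j) <= x) -> nc (1 - \prod_(j <- s) (1 - y j)) <= 2 ^+ size s * x.
Proof.
move=> x0 x1 yx.
have P t : nc (\prod_(j <- t) (1 - y j)) <= 2 ^+ size t.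
  rewrite nc_prod; elim: t => [|j t IH]; first by rewrite big_nil.
  rewrite big_cons exprS; apply: ler_pM => //; first by apply: prodr_ge0.
  by rewrite (le_trans (ncB _ _))// nc1 lerD2l (le_trans (yx j)).
suff H : nc (1 - \prod_(j <- s) (1 - y j)) <= (2 ^+ size s - 1) * x.
  by apply: le_trans H _; rewrite ler_wpM2r// gerBl.
elim: s => [|j s IH]; first by rewrite big_nil !subrr nc0 mul0r.
rewrite big_cons /= exprS.
set Q := \prod_(_ <- _) _ in IH *.
have -> : 1 - (1 - y j) * Q = (1 - Q) + y j * Q by ring.
rewrite (le_trans (ncD _ _))//.
have h : nc (y j * Q) <= x * 2 ^+ size s by apply: nc_mul_le; [exact: yx|exact: P].
by rewrite (le_trans (lerD IH h))//; apply: eq_ler; ring.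
Qed.

(** The partial sum is the mean of [f] against the product of the truncated
    geometric series, and each truncation changes the kernel by a factor
    [1 - (w_j / z_j) ^ K]. *)
Lemma taylor_approx_half f w M K : entire f -> (forall z, torus z -> nc (f z) <= M) ->
  (forall j, nc (w 0 j) <= 2^-1) -> nc (f w - taylor_sum K f w) <= M * box_error K.
Proof.
move=> fe fM w2.
have w1 j : nc (w 0 j) < 1 by rewrite (le_lt_trans (w2 j))// invf_lt1// ltr1n.
pose S z := \sum_(a : box K) mono (idx a) w * imono (idx a) z.
have -> : taylor_sum K f w = torus_mean (fun z => f z * S z).
  rewrite /taylor_sum (_ : (fun z => _) = fun z =>
      \sum_(a : box K) mono (idx a) w * (f z * imono (idx a) z)).
    by rewrite torus_mean_sum; apply: eq_bigr => a _; rewrite torus_meanZ mulrC.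
  by apply/funext => z; rewrite mulr_sumr; apply: eq_bigr => a _; rewrite mulrCA.
rewrite -{1}(torus_mean_cauchy fe w1) -torus_meanB.
apply: torus_mean_bound => z z1; rewrite -mulrBr.
apply: nc_mul_le; first exact: fM.
pose y j := w 0 j ^+ K * (z 0 j)^-1 ^+ K.
have -> : S z = (\prod_j kernel (z 0 j) (w 0 j)) * \prod_j (1 - y j).
  transitivity (\prod_j \sum_(k < K) w 0 j ^+ k * (z 0 j)^-1 ^+ k).
    rewrite bigA_distr_bigA /=; apply: eq_bigr => a _.
    by rewrite /mono /imono -big_split.
  rewrite -big_split /=; apply: eq_bigr => j _.
  have := geometric_kernel K (z1 j) (w1 j); rewrite -/(kernel _ _) -/(y j) => h.
  by rewrite mulrBr mulr1 [_ * y j]mulrC -h subKr.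
rewrite -{1}[\prod_j kernel _ _]mulr1 -mulrBr.
have -> : box_error K = 2 ^+ n * (2 ^+ n * 2^-1 ^+ K).
  by rewrite /box_error mulrA -exprMn exprVn; congr (_ ^+ _ / _); ring.
apply: nc_mul_le.
  rewrite nc_prod -[n in leRHS]card_ord -prodr_const ler_prod// => j _.
  rewrite nc_ge0 (le_trans (kernel_le (z1 j) (w1 j)))// invf_ple ?posrE ?subr_gt0//.
  by have := w2 j; lra.
have := @nc_prod_sub1 (index_enum 'I_n) y (2^-1 ^+ K).
rewrite /index_enum -enumT size_enum_ord; apply.
- by rewrite exprn_ge0 ?invr_ge0.
- by rewrite exprn_ile1 ?invr_ge0// invf_le1// ler1n.
- move=> j; rewrite ncM !ncX circleV// expr1n mulr1.
  by rewrite lerXn2r ?nnegrE ?invr_ge0.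
Qed.

(** Uniform approximation on the torus by partial sums determines the
    coefficients. *)
Lemma taylor_unique g (c : ('I_n -> nat) -> C) a :
  (forall e : R, 0 < e -> exists K0, forall K, (K0 <= K)%N -> forall z, torus z ->
     nc (g z - \sum_(b : box K) c (idx b) * mono (idx b) z) <= e) ->
  taylor g a = c a.
Proof.
move=> H; apply/eqP; rewrite -subr_eq0; apply/eqP; apply: nc_eq_small => e /H[K0 K0P].
pose K := maxn K0 (\max_j a j).+1.
have aK j : (a j < K)%N by rewrite /K leq_max ltnS (leq_bigmax j) orbT.
pose a' : box K := [ffun j => Ordinal (aK j)].
have aE : idx a' = a by apply/funext => j; rewrite /idx ffunE.
have -> : c a = torus_mean (fun z => (\sum_(b : box K) c (idx b) * mono (idx b) z) * imono a z).
  rewrite (_ : (fun z => _) = fun z => \sum_(b : box K)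
     c (idx b) * (mono (idx b) z * imono a z)).
    rewrite torus_mean_sum (bigD1 a')//= big1 ?addr0.
      rewrite torus_meanZ aE torus_mean_mono (_ : [forall _, _]); last by apply/forallP.
      by rewrite mulr1.
    move=> b ba; rewrite torus_meanZ torus_mean_mono.
    rewrite (_ : [forall _, _] = false) ?mulr0//; apply: contraNF ba => /forallP h.
    by apply/eqP/ffunP => j; apply/val_inj; rewrite ffunE /= (eqP (h j)).
  apply/funext => z; rewrite mulr_suml; apply: eq_bigr => b _.
  by rewrite mulrA.
rewrite /taylor -torus_meanB; apply: torus_mean_bound => z z1.
rewrite -mulrBl ncM nc_imono_torus// mulr1.
by apply: K0P => //; rewrite leq_maxl.
Qed.

(** The Taylor polynomials of [f] at [r *: z] approximate [f (r *: z)] on the torus. *)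
Lemma taylor_scale_small f (r : C) a : entire f -> nc r <= 2^-1 ->
  taylor (fun z => f (r *: z)) a = r ^+ tdeg a * taylor f a.
Proof.
move=> fe r2; have [M M0 fM] := @entire_bounded f 1 fe.
apply: (taylor_unique (c := fun a => r ^+ tdeg a * taylor f a)) => e e0.
have [K0 K0P] := box_error_small M e0; exists K0 => K /K0P KP z z1.
apply: le_trans KP.
rewrite (_ : \sum_(b : box K) _ = taylor_sum K f (r *: z)).
  apply: taylor_approx_half => //; first by move=> v v1; apply: fM => j; rewrite v1.
  by move=> j; rewrite mxE ncM z1 mulr1.
by apply: eq_bigr => b _; rewrite monoZ; ring.
Qed.

(** [f] and [fun z => f (r *: z)] are both contractions, by factors of modulus at most
    1/2, of one rescaling [g] of [f]. *)
Lemma taylor_scale f (r : C) a : entire f ->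
  taylor (fun z => f (r *: z)) a = r ^+ tdeg a * taylor f a.
Proof.
move=> fe; pose B : R := 2 * (1 + nc r).
have B0 : 0 < B by rewrite mulr_gt0// ltr_pwDl.
have Bn : B%:C != 0 by rewrite -nc_gt0 (nc_posreal (ltW B0)).
pose g z := f (B%:C *: z); have ge : entire g by exact: entire_scale.
have fg : f = fun z => g (B%:C^-1 *: z).
  by apply/funext => z; rewrite /g scalerA divff// scale1r.
rewrite {2}fg (@taylor_scale_small g _ a ge); last first.
  rewrite ncV (nc_posreal (ltW B0)) lef_pV2 ?posrE// /B ler_peMr// lerDl.
  exact: nc_ge0.
rewrite (_ : (fun z => _) = fun z => g (r / B%:C *: z)); last first.
  by apply/funext => z; rewrite /g scalerA mulrCA divff// mulr1.
rewrite (@taylor_scale_small g _ a ge); first by rewrite exprMn mulrA.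
rewrite ncM ncV (nc_posreal (ltW B0)) ler_pdivrMr// /B mulrA mulVf// mul1r.
by rewrite lerDr.
Qed.

(** By [taylor_scale] the coefficient is a mean over the torus of radius [r]. *)
Lemma cauchy_estimate f (r M : R) a : entire f -> 0 <= r ->
  (forall z, (forall j, nc (z 0 j) = r) -> nc (f z) <= M) ->
  nc (taylor f a) * r ^+ tdeg a <= M.
Proof.
move=> fe r0 fM.
have -> : nc (taylor f a) * r ^+ tdeg a = nc (taylor (fun z => f (r%:C *: z)) a).
  by rewrite taylor_scale// ncM ncX nc_posreal// mulrC.
apply: torus_mean_bound => z z1; rewrite ncM nc_imono_torus// mulr1; apply: fM => j.
by rewrite mxE ncM z1 mulr1 nc_posreal.
Qed.

Lemma taylor_approx f w (r M : R) K : entire f -> 0 < r ->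
  (forall z, (forall j, nc (z 0 j) = r) -> nc (f z) <= M) ->
  (forall j, nc (w 0 j) <= r / 2) -> nc (f w - taylor_sum K f w) <= M * box_error K.
Proof.
move=> fe r0 fM wr.
have rn : r%:C != 0 by rewrite -nc_gt0 (nc_posreal (ltW r0)).
have ge : entire (fun z => f (r%:C *: z)) by exact: entire_scale.
have := @taylor_approx_half _ (r%:C^-1 *: w) M K ge.
rewrite scalerA divff// scale1r.
rewrite (_ : taylor_sum _ _ _ = taylor_sum K f w).
  apply; first by move=> z z1; apply: fM => j; rewrite mxE ncM z1 mulr1 (nc_posreal (ltW r0)).
  move=> j; rewrite mxE ncM ncV (nc_posreal (ltW r0)) mulrC ler_pdivrMr// mulrC.
  exact: wr.
apply: eq_bigr => a _; rewrite taylor_scale// monoZ mulrACA -exprMn divff//.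
by rewrite expr1n mul1r.
Qed.

End taylor.

(** * Continuous functionals on the space of functions of exponential type *)

Section functionals.
Variables (R : realType) (E : preTopologicalLmodType R[i]).
Implicit Types (f g : E) (T : strong_dual E).

Lemma dualP T a f g : \val T (a *: f + g) = a * \val T f + \val T g.
Proof. by have [Tl _] := set_mem (valP T); exact: Tl. Qed.

Lemma dual0 T : \val T 0 = 0.
Proof. by have := dualP T (-1) 0 0; rewrite scaler0 addr0 mulN1r addNr. Qed.

Lemma dualZ T a f : \val T (a *: f) = a * \val T f.
Proof. by have := dualP T a f 0; rewrite dual0 !addr0. Qed.

Lemma dualD T f g : \val T (f + g) = \val T f + \val T g.
Proof. by have := dualP T 1 f g; rewrite scale1r mul1r. Qed.

Lemma dualB T f g : \val T (f - g) = \val T f - \val T g.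
Proof. by rewrite addrC -scaleN1r dualP mulN1r addrC. Qed.

Lemma dual_sum T (I : Type) (r : seq I) (P : pred I) (F : I -> E) :
  \val T (\sum_(i <- r | P i) F i) = \sum_(i <- r | P i) \val T (F i).
Proof. by elim/big_ind2 : _ => [|x1 x2 y1 y2 <- <-|//]; [exact: dual0|rewrite dualD]. Qed.

End functionals.

Section exp_functionals.
Variables (R : realType) (n : nat).
Local Notation C := R[i].
Local Notation Cn := 'rV[C]_n.
Local Notation Exp := (Exp R n).
Implicit Types (z w h : Cn) (f g : Exp) (T : strong_dual Exp).

Definition expbound (A M : R) (f : Cn -> C) :=
  forall z, nc (f z) <= M * expR (A * enorm z).

Lemma expbound_ge0 A M (f : Cn -> C) : expbound A M f -> 0 <= M.
Proof.
move=> fM; rewrite -(pmulr_lge0 _ (expR_gt0 (A * enorm (0 : Cn)))).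
by apply: le_trans (fM 0).
Qed.

Lemma expboundS A B M N (f : Cn -> C) : A <= B -> M <= N -> expbound A M f -> expbound B N f.
Proof.
move=> AB MN fM z; have M0 := expbound_ge0 fM.
rewrite (le_trans (fM z))// ler_pM ?expR_ge0// ler_expR ler_wpM2r//.
exact: enorm_ge0.
Qed.

Lemma exp_expbound f : exists A M, 0 < A /\ expbound A M (\val f).
Proof.
have /exptypeP[_ [A [M fM]]] := valP f.
exists (Num.max 1 A), M; split; first by rewrite lt_max ltr01.
by apply: (expboundS _ (lexx M) fM); rewrite le_max lexx orbT.
Qed.

Lemma exp_entire f : entire (\val f).
Proof. by have /exptypeP[] := valP f. Qed.

Lemma expbound_expnorm A M f : expbound A M (\val f) -> (expnorm A (\val f) <= M%:E)%E.
Proof.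
move=> fM; apply: ge_ereal_sup => _ [z _ <-]; rewrite lee_fin expRN.
by rewrite ler_pdivrMr ?expR_gt0.
Qed.

Lemma expnorm_expbound A M f : (expnorm A (\val f) <= M%:E)%E -> expbound A M (\val f).
Proof.
move=> fM z; rewrite -ler_pdivrMr ?expR_gt0// -expRN -lee_fin (le_trans _ fM)//.
by apply: ereal_sup_ubound; exists z.
Qed.

(** A functional is bounded by 1 on a neighbourhood of 0, which contains a ball of the
    step [E_A]; homogeneity does the rest. *)
Lemma dual_bound T A : 0 < A -> exists2 K : R, 0 <= K &
  forall f M, expbound A M (\val f) -> nc (\val T f) <= K * M.
Proof.
move=> A0; have [_ Tc] := set_mem (valP T).
have : nbhs (0 : Exp) (\val T @^-1` [set y | nc y < 1]).
  by apply: Tc; rewrite dual0; apply/nbhs_ncP; exists 1 => // w; rewrite subr0.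
move=> /indlim_nbhsP[W [_ /(_ A A0)[e e0 eW]] WV].
exists (2 / e) => [|f M fM]; first by rewrite divr_ge0// ltW.
have M0 := expbound_ge0 fM.
have [M1|M1] := eqVneq M 0.
  rewrite M1 mulr0 (_ : f = 0) ?dual0 ?nc0//; apply/val_inj/funext => z.
  by apply: nc_le0; have := fM z; rewrite M1 mul0r.
have {}M0 : 0 < M by rewrite lt_def M1.
pose c : R := e / (2 * M); have c0 : 0 < c by rewrite divr_gt0// mulr_gt0.
have : W (c%:C *: f).
  apply: eW; apply: (le_lt_trans (expnormZ_le _ (expbound_expnorm fM))).
  rewrite lte_fin nc_posreal ?(ltW c0)// (_ : c * M = e / 2); first by lra.
  by rewrite /c; field.
move=> /WV; rewrite add0r /= dualZ ncM nc_posreal ?(ltW c0)// => h.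
have h' : nc (\val T f) < c^-1 by rewrite -[ltRHS]mulr1 ltr_pdivlMl.
by apply: (le_trans (ltW h')); rewrite /c invf_div mulrAC.
Qed.

(** The universal property of the inductive limit, with the balls of [E_A] described
    by their bounds. *)
Lemma dual_intro (u : Exp -> C) : scalar u ->
  (forall A : R, 0 < A -> exists K : R, forall f M, expbound A M (\val f) -> nc (u f) <= K * M) ->
  u \in @continuous_functional R Exp.
Proof.
move=> ul uK; apply: mem_set; split => //.
pose u' : {linear Exp -> C} := HB.pack u (GRing.isLinear.Build C Exp C *:%R u ul).
apply/(indlim_universal u') => A A0 V /nbhs_ncP[e e0 eV].
have [K KP] := uK A A0; have K1 : 0 < `|K| + 1 by rewrite ltr_wpDl.
exists (e / (`|K| + 1)); first by rewrite divr_gt0.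
move=> f /expnorm_lt_le[c /andP[c0 ce] fc]; apply: eV; rewrite subr0.
rewrite (le_lt_trans (KP _ _ (expnorm_expbound fc)))//.
rewrite (@le_lt_trans _ _ ((`|K| + 1) * c))//; last by rewrite mulrC -ltr_pdivlMr.
by rewrite ler_wpM2r// (le_trans (ler_norm _))// lerDl.
Qed.

Definition mk_dual (u : Exp -> C) (ul : scalar u)
    (ub : forall A : R, 0 < A -> exists K : R, forall f M, expbound A M (\val f) -> nc (u f) <= K * M) :
  strong_dual Exp := exist _ u (dual_intro ul ub).

(** * Multiplication in the algebra of functions of exponential type *)

Lemma enorm_le_snorm z : enorm z <= snorm z.
Proof.
rewrite -[leRHS]ger0_norm ?snorm_ge0// -sqrtr_sqr ler_sqrt ?sqr_ge0//.
rewrite /snorm; elim: (index_enum _) => [|j s IH]; first by rewrite !big_nil expr0n.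
rewrite !big_cons sqrrD -addrA lerD2l (le_trans IH)// lerDr mulrn_wge0//.
by rewrite mulr_ge0// sumr_ge0.
Qed.

Lemma exptypeM (f g : Cn -> C) : f \in @exptype R n -> g \in @exptype R n ->
  (fun z => f z * g z) \in @exptype R n.
Proof.
move=> /exptypeP[fe [A [M fM]]] /exptypeP[ge [B [N gN]]]; apply/exptypeP; split.
  by move=> z; exact: differentiableM.
exists (A + B), (M * N) => z; rewrite mulrDl expRD mulrACA.
exact: nc_mul_le.
Qed.

Definition emul f g : Exp := exist (fun u : Cn -> C => u \in @exptype R n) _ (exptypeM (valP f) (valP g)).

Lemma exptype_cst (c : C) : (fun=> c) \in @exptype R n.
Proof.
apply/exptypeP; split; first by move=> z; exact: differentiable_cst.
by exists 0, (nc c) => z; rewrite mul0r expR0 mulr1.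
Qed.

Lemma exptype_coord j : (fun z => z 0 j) \in @exptype R n.
Proof.
apply/exptypeP; split; first by move=> z; exact: differentiable_coord.
exists 1, 1 => z; rewrite !mul1r (le_trans (coord_le_enorm _ _))//.
by rewrite (le_trans _ (expR_ge1Dx _))// lerDr.
Qed.

Definition ecoord j : Exp := exist (fun u : Cn -> C => u \in @exptype R n) _ (exptype_coord j).
Definition ecst c : Exp := exist (fun u : Cn -> C => u \in @exptype R n) _ (exptype_cst c).

Lemma exptype_mono a : mono a \in @exptype R n.
Proof.
rewrite /mono; elim: (index_enum _) => [|j s IH].
  by under eq_fun => z do rewrite big_nil; exact: exptype_cst.
under eq_fun => z do rewrite big_cons.
apply: exptypeM => //; elim: (a j) => [|k IHk]; first exact: exptype_cst.
by under eq_fun => z do rewrite exprS; apply: exptypeM => //; exact: exptype_coord.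
Qed.

Definition emono a : Exp := exist (fun u : Cn -> C => u \in @exptype R n) _ (exptype_mono a).

Lemma exptype_poly (p : mpoly n C) : (fun z => meval (fun j => z 0 j) p) \in @exptype R n.
Proof.
rewrite (_ : (fun z => _) = \sum_(m <- msupp p) mcoeff m p *: (mono (fun j => m j) : Cn -> C)).
  by apply: rpred_sum => m _; apply: rpredZ; exact: exptype_mono.
by apply/funext => z; rewrite mevalE fct_sumE.
Qed.

Definition epoly p : Exp := exist (fun u : Cn -> C => u \in @exptype R n) _ (exptype_poly p).

(** * The exponentials *)

Lemma nc_cexp_le (z : C) : nc (cexp z) <= expR (nc z).
Proof.
by rewrite normc_cexp ler_expR (le_trans (ler_norm _))// Re_le_normc.
Qed.

Lemma nc_dotC_enorm z w : nc (dotC z w) <= snorm z * enorm w.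
Proof.
rewrite (le_trans (nc_sum _ _ _))// mulr_suml ler_sum// => j _.
by rewrite ncM ler_wpM2l// coord_le_enorm.
Qed.

Lemma expker_bound z : expbound (snorm z) 1 (expker z).
Proof.
by move=> w; rewrite mul1r (le_trans (nc_cexp_le _))// ler_expR nc_dotC_enorm.
Qed.

Lemma differentiable_cexp (z : C) : differentiable (@cexp R : C -> C) z.
Proof. by apply/derivable1_diffP; have [] := is_derive_cexp z. Qed.

Lemma udiff_cexp (c : C) (S : set C) (M : R) : (forall x, S x -> nc x <= M) ->
  udiff S (fun z : C => cexp (c * z)) (fun z : C => c * cexp (c * z)).
Proof.
move=> SM e e0.
have k0 : 0 < expR (nc c * M) * (nc c + 1) by rewrite mulr_gt0 ?expR_gt0// ltr_wpDl.
have [t t0 tP] := cexp_near0 (divr_gt0 e0 k0).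
have c1 : 0 < nc c + 1 by rewrite ltr_wpDl.
exists (t / (nc c + 1)); first by rewrite divr_gt0.
move=> x y Sx Sy xy.
have -> : cexp (c * y) - cexp (c * x) - c * cexp (c * x) * (y - x) =
   cexp (c * x) * (cexp (c * (y - x)) - 1 - c * (y - x)).
  by rewrite -{1}[y](subrK x) mulrDr cexpD; ring.
have cy : nc (c * (y - x)) <= (nc c + 1) * nc (y - x).
  by rewrite ncM ler_wpM2r// lerDl.
have h : nc (c * (y - x)) < t.
  by rewrite (le_lt_trans cy)// mulrC -ltr_pdivlMr.
have h1 : nc (cexp (c * x)) <= expR (nc c * M).
  rewrite (le_trans (nc_cexp_le _))// ler_expR ncM ler_wpM2l//; exact: SM.
apply: (le_trans (nc_mul_le h1 (tP _ h))).
apply: (le_trans (ler_wpM2l (expR_ge0 _) (ler_wpM2l (ltW (divr_gt0 e0 k0)) cy))).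
apply: eq_ler; field.
by rewrite !gt_eqF ?expR_gt0.
Qed.

(** The Taylor coefficients of the exponential, by integration by parts instead of
    its power series. *)
Lemma mean_cexp (c : C) k : mean (fun t => cexp (c * t) * t^-1 ^+ k) = c ^+ k / k`!%:R.
Proof.
have hc : holdisc (fun t : C => cexp (c * t)).
  apply: differentiable_holdisc => t.
  apply: (@differentiable_comp _ _ _ _ (fun t => c * t) (@cexp R)); last exact: differentiable_cexp.
  exact: (@differentiableZ _ _ _ id).
elim: k => [|k IH].
  rewrite expr0 fact0 divr1 -[RHS](@cexp0 R) -[in RHS](mulr0 c) -(mean_value hc).
  by apply: eq_mean => t _; rewrite mulr1.
have D1 : udiff (@circle R) (fun z : C => cexp (c * z)) (fun z : C => c * cexp (c * z)).
  by apply: (@udiff_cexp c _ 1) => x; rewrite /circle /= => ->.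
have B1 (w : C) : nc w = 1 -> nc (cexp (c * w)) <= expR (nc c).
  by move=> w1; rewrite (le_trans (nc_cexp_le _))// ncM w1 mulr1.
have := mean_by_parts k.+1 D1 B1.
rewrite (_ : mean _ = c * (c ^+ k / k`!%:R)); last first.
  rewrite -IH -meanZ; apply: eq_mean => t t1; rewrite exprS.
  by field; exact: circle_neq0.
have k0 : (k.+1%:R : C) != 0 by rewrite pnatr_eq0.
move=> /(congr1 (fun x => k.+1%:R^-1 * x)); rewrite mulKf// => <-.
by rewrite factS natrM exprS invfM; ring.
Qed.

Definition afact (a : 'I_n -> nat) : nat := (\prod_j (a j)`!)%N.

Lemma afact_neq0 a : (afact a)%:R != 0 :> C.
Proof. by rewrite pnatr_eq0 -lt0n prodn_gt0// => j; exact: fact_gt0. Qed.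

Lemma expker_prod z w : expker z w = \prod_j cexp (z 0 j * w 0 j).
Proof.
rewrite /expker /dotC; elim/big_rec2 : _ => [|j x y _ <-]; first exact: cexp0.
exact: cexpD.
Qed.

Lemma taylor_expker z a : taylor (expker z) a = mono a z / (afact a)%:R.
Proof.
rewrite /taylor (_ : (fun w => _) = fun w => \prod_j (cexp (z 0 j * w 0 j) * (w 0 j)^-1 ^+ a j)).
  rewrite (torus_mean_prod (fun j t => cexp (z 0 j * t) * t^-1 ^+ a j)).
  under eq_bigr => j _ do rewrite mean_cexp.
  rewrite big_split /= /afact natr_prod /mono; congr (_ * _).
  by rewrite prodfV.
by apply/funext => w; rewrite expker_prod /imono -big_split.
Qed.

End exp_functionals.

(** * The Fourier-Borel transformation *)

Section fourier_borel_transform.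
Variables (R : realType) (n : nat).
Local Notation C := R[i].
Local Notation Cn := 'rV[C]_n.
Local Notation Exp := (Exp R n).
Implicit Types (z w h : Cn) (f g : Exp) (T : strong_dual Exp).

(** [second_order] after rescaling the disc of radius [2 |s| + 1] to the unit disc,
    which takes [s] to a point of modulus at most 1/2. *)
Lemma cexp_second_order (s : C) :
  nc (cexp s - 1 - s) <= 2 * expR (2 * nc s + 1) * nc s ^+ 2.
Proof.
pose B : R := 2 * nc s + 1; have B1 : 1 <= B by rewrite lerDr mulr_ge0.
have B0 : 0 < B by exact: lt_le_trans B1.
have nB : nc (B%:C : C) = B by rewrite nc_posreal// ltW.
have B0' : B%:C != 0 :> C by rewrite -nc_gt0 nB.
have hc : holdisc (fun t : C => cexp (B%:C * t)).
  apply: differentiable_holdisc => t.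
  apply: (@differentiable_comp _ _ _ _ (fun t => B%:C * t) (@cexp R)); last exact: differentiable_cexp.
  exact: (@differentiableZ _ _ _ id).
have Bm (z : C) : nc z = 1 -> nc (cexp (B%:C * z)) <= expR B.
  by move=> z1; rewrite (le_trans (nc_cexp_le _))// ncM z1 mulr1 nB.
have := second_order hc Bm (w := s / B%:C).
rewrite mulr0 cexp0 mulrCA divff// mulr1.
rewrite (_ : mean _ = B%:C); last first.
  by rewrite -[RHS]expr1 -[RHS]divr1; exact: mean_cexp B%:C 1.
rewrite divfK// ncM ncV nB => H; apply: (le_trans (H _)).
  by rewrite ler_pdivrMr// /B; lra.
apply: ler_wpM2l; first by rewrite mulr_ge0 ?expR_ge0.
rewrite lerXn2r ?nnegrE ?divr_ge0 ?(ltW B0)//.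
by rewrite ler_pdivrMr// ler_peMr.
Qed.

(** Differentiation under the functional: the second order remainder of the
    exponential is small in one step of the inductive system, on which the
    functional is bounded. *)
Lemma fb_derivative T g z :
  differentiable (fun z => \val T (emul g (expkerE z))) z /\
  forall j, 'D_(delta_mx 0 j) (fun z => \val T (emul g (expkerE z))) z =
    \val T (emul (emul (ecoord R j) g) (expkerE z)).
Proof.
have [A [M [A0 gM]]] := exp_expbound g; have M0 := expbound_ge0 gM.
pose A' := A + snorm z + 4; have A'0 : 0 < A' by rewrite !ltr_wpDr// snorm_ge0.
have [K K0 KP] := dual_bound T A'0.
pose a : Cn := \row_j \val T (emul (emul (ecoord R j) g) (expkerE z)).
suff H h : snorm h < 1 -> nc (\val T (emul g (expkerE (z + h))) -
    \val T (emul g (expkerE z)) - dotC a h) <= K * (M * (2 * expR 1)) * snorm h ^+ 2.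
  have [H1 H2] := @quadratic_differentiable _ _
    (fun z => \val T (emul g (expkerE z))) z a _ _ ltr01 H.
  by split => // j; rewrite H2 mxE.
move=> h1.
pose F := emul g (expkerE (z + h)) - emul g (expkerE z) -
  \sum_j h 0 j *: emul (emul (ecoord R j) g) (expkerE z).
have -> : \val T (emul g (expkerE (z + h))) - \val T (emul g (expkerE z)) - dotC a h = \val T F.
  rewrite !dualB dual_sum; congr (_ - _); apply: eq_bigr => j _.
  by rewrite dualZ mxE mulrC.
rewrite -mulrA; apply: KP => w.
have -> : \val F w = \val g w * (cexp (dotC z w) * (cexp (dotC h w) - 1 - dotC h w)).
  have -> : \val F w = \val g w * cexp (dotC (z + h) w) - \val g w * cexp (dotC z w) -
      \sum_j h 0 j * (w 0 j * \val g w * cexp (dotC z w)).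
    rewrite -[LHS]/(\val g w * cexp (dotC (z + h) w) - \val g w * cexp (dotC z w) -
      \val (\sum_j h 0 j *: emul (emul (ecoord R j) g) (expkerE z)) w); congr (_ - _).
    by rewrite raddf_sum fct_sumE; apply: eq_bigr.
  have -> : dotC (z + h) w = dotC z w + dotC h w by rewrite !(dotCC _ w) linearD.
  rewrite cexpD (_ : \sum_j _ = dotC h w * (\val g w * cexp (dotC z w))).
    by ring.
  by rewrite mulr_suml; apply: eq_bigr => j _; ring.
pose e := enorm w; have e0 : 0 <= e by exact: enorm_ge0.
have sh : nc (dotC h w) <= snorm h * e by exact: nc_dotC_enorm.
have s1 : nc (dotC h w) <= e by rewrite (le_trans sh)// ler_piMl// ltW.
have ee : e ^+ 2 <= expR (2 * e).
  rewrite expRM_natl lerXn2r ?nnegrE ?expR_ge0//.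
  by rewrite (le_trans _ (expR_ge1Dx _))// lerDr.
have h2 : nc (cexp (dotC h w) - 1 - dotC h w) <=
    2 * expR 1 * snorm h ^+ 2 * expR (4 * e).
  rewrite (le_trans (cexp_second_order _))//.
  have -> : 2 * expR 1 * snorm h ^+ 2 * expR (4 * e) =
      2 * expR (2 * e + 1) * (snorm h ^+ 2 * expR (2 * e)).
    have -> : 4 * e = 2 * e + 2 * e by ring.
    by rewrite !expRD; ring.
  apply: ler_pM; rewrite ?mulr_ge0 ?expR_ge0 ?sqr_ge0//.
    by rewrite ler_wpM2l// ler_expR lerD2r ler_wpM2l.
  rewrite (@le_trans _ _ ((snorm h * e) ^+ 2))//.
    by rewrite lerXn2r ?nnegrE ?mulr_ge0 ?snorm_ge0.
  by rewrite exprMn ler_wpM2l ?sqr_ge0.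
have h3 : nc (cexp (dotC z w)) <= expR (snorm z * e).
  by have := expker_bound z w; rewrite mul1r.
apply: (le_trans (nc_mul_le (gM w) (nc_mul_le h3 h2))).
by rewrite /A' !mulrDl !expRD -/e; apply: eq_ler; ring.
Qed.

Lemma emul1 f : emul (ecst _ 1) f = f.
Proof. by apply/val_inj/funext => z /=; rewrite mul1r. Qed.

Lemma emulA f g (k : Exp) : emul (emul f g) k = emul f (emul g k).
Proof. by apply/val_inj/funext => z /=; rewrite mulrA. Qed.

Lemma fourier_borelE T : fourier_borel T = fun z => \val T (emul (ecst _ 1) (expkerE z)).
Proof. by apply/funext => z; rewrite emul1. Qed.

Lemma fourier_borel_entire T : entire (fourier_borel T).
Proof. by rewrite fourier_borelE => z; have [] := fb_derivative T (ecst _ 1) z. Qed.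

Lemma fb_mpartial T g m : mpartial m (fun z => \val T (emul g (expkerE z))) =
  fun z => \val T (emul (emul (emono R (fun j => m j)) g) (expkerE z)).
Proof.
have it j k g' : iter k (partial j) (fun z => \val T (emul g' (expkerE z))) =
   fun z => \val T (emul (emul (iter k (emul (ecoord R j)) (ecst _ 1)) g') (expkerE z)).
  elim: k => [|k IH]; first by apply/funext => z /=; rewrite emul1.
  rewrite iterS IH; apply/funext => z; rewrite /partial.
  by have [_ ->] := fb_derivative T (emul (iter k (emul (ecoord R j)) (ecst n 1)) g') z; rewrite -emulA.
rewrite /mpartial.
have fo s : foldr (fun j => iter (m j) (partial j)) (fun z => \val T (emul g (expkerE z))) s =
   fun z => \val T (emul (emul (foldr (fun j => emul (iter (m j) (emul (ecoord R j)) (ecst _ 1)))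
     (ecst _ 1) s) g) (expkerE z)).
  elim: s => [|j s IH]; first by apply/funext => z /=; rewrite emul1.
  by rewrite /= IH it; apply/funext => z; rewrite -emulA.
rewrite fo; apply/funext => z; congr (\val T (emul (emul _ _) _)).
apply/val_inj/funext => w /=; rewrite /mono.
rewrite -big_enum /=; elim: (enum _) => [|j s IH]; first by rewrite big_nil.
rewrite big_cons /= IH; congr (_ * _).
by elim: (m j) => [//|k IHk]; rewrite exprS /= IHk.
Qed.

(** Each [partial j] brings down a factor [w_j] from [exp <z, w>], by
    [fb_derivative]. *)
Lemma dpoly_fourier_borel T p z :
  dpoly p (fourier_borel T) z = \val T (emul (epoly p) (expkerE z)).
Proof.
rewrite /dpoly fct_sumE.
have -> : emul (epoly p) (expkerE z) = \sum_(m <- msupp p) mcoeff m p *: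
    emul (emul (emono R (fun j => m j)) (ecst _ 1)) (expkerE z).
  apply/val_inj/funext => w; rewrite raddf_sum fct_sumE /= mevalE mulr_suml.
  apply: eq_bigr => m _.
  by rewrite -[RHS]/(mcoeff m p * (mono (fun j => m j) w * 1 * expker z w)) mulr1 mulrA.
rewrite dual_sum; apply: eq_bigr => m _; rewrite dualZ.
by rewrite fourier_borelE -[LHS]/(_ * mpartial _ _ _) fb_mpartial.
Qed.

(** * The pairing of Taylor coefficients *)

Local Notation box K := {ffun 'I_n -> 'I_K}.

(** The Fischer pairing [sum_a a! f_a u_a], truncated to a box of exponents. *)
Definition pairing K (f u : Cn -> C) : C :=
  \sum_(a : box K) taylor f (idx a) * ((afact (idx a))%:R * taylor u (idx a)).

Lemma tdeg_geometric K : \sum_(a : box K) (2^-1 : R) ^+ tdeg (idx a) <= 2 ^+ n.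
Proof.
rewrite (eq_bigr (fun a : box K => \prod_j (2^-1 : R) ^+ idx a j)); last first.
  by move=> a _; rewrite prodrXr.
rewrite -(bigA_distr_bigA (fun=> fun k : 'I_K => (2^-1 : R) ^+ k)) /=.
rewrite -[n in leRHS]card_ord -prodr_const ler_prod// => j _.
apply/andP; split; first by apply: sumr_ge0 => k _; rewrite exprn_ge0 ?invr_ge0.
have h : (2^-1 : R) ^+ K - 1 = (2^-1 - 1) * \sum_(k < K) 2^-1 ^+ k by exact: subrX1.
have : 0 <= (2^-1 : R) ^+ K by rewrite exprn_ge0 ?invr_ge0.
move: h; set S := \sum_(_ < _) _; move: ((2^-1 : R) ^+ K) => x h; lra.
Qed.

Lemma fact_le_expn k m : (k <= m)%N -> (k`! <= m ^ k)%N.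
Proof.
elim: k => [//|k IH] km; rewrite factS expnS leq_mul// IH//; exact: ltnW.
Qed.

Lemma afact_le (a : 'I_n -> nat) : (afact a <= (maxn 1 (tdeg a)) ^ tdeg a)%N.
Proof.
rewrite /tdeg [leqRHS]expn_sum; apply: leq_prod => j _; apply: fact_le_expn.
by rewrite leq_max (bigD1 j)//= leq_addr orbT.
Qed.

Definition pair_rate (A : R) : R := expR (A * n.+1%:R).

Lemma enorm_polycircle (r : R) z : 0 <= r -> (forall j, nc (z 0 j) = r) ->
  enorm z <= n.+1%:R * r.
Proof.
move=> r0 zr; rewrite (le_trans (enorm_le_snorm _))// /snorm.
rewrite (eq_bigr (fun=> r)) => [|j _]; last exact: zr.
by rewrite sumr_const card_ord -[leLHS]mulr_natl ler_wpM2r// ler_nat.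
Qed.

(** The growth of [f] makes its Taylor coefficient of degree [d] at most of
    order [pair_rate A ^ d / d ^ d], which absorbs the factorials; only the values
    of [u] on one polycircle enter. *)
Lemma pairing_bound A M S K (f u : Cn -> C) : 0 < A -> entire f -> expbound A M f ->
  entire u -> (forall z, (forall j, nc (z 0 j) = 2 * pair_rate A) -> nc (u z) <= S) ->
  nc (pairing K f u) <= 2 ^+ n * pair_rate A * M * S.
Proof.
move=> A0 fe fM ue uS; have M0 := expbound_ge0 fM.
set q := pair_rate A; have q0 : 0 < q by exact: expR_gt0.
have S0 : 0 <= S.
  apply: le_trans (uS (const_mx (2 * q)%:C) _) => // j.
  by rewrite mxE nc_posreal// mulr_ge0 ?ltW.
rewrite (le_trans (nc_sum _ _ _))//.
rewrite (@le_trans _ _ (\sum_(a : box K) q * M * S * 2^-1 ^+ tdeg (idx a)))//; last first.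
  rewrite -mulr_sumr (le_trans (ler_wpM2l _ (tdeg_geometric K)))//.
    by rewrite !mulr_ge0 ?(ltW q0).
  by apply: eq_ler; ring.
apply: ler_sum => a _; move: (idx a) => {}a; set d := tdeg a.
pose r : R := (maxn 1 d)%:R.
have r1 : 1 <= r by rewrite ler1n leq_max.
have r0 : 0 < r by exact: lt_le_trans r1.
have hf : nc (taylor f a) * r ^+ d <= M * (q * q ^+ d).
  apply: cauchy_estimate => //.
  move=> z zr; apply: (le_trans (fM z)); apply: ler_wpM2l => //.
  rewrite -exprS /q /pair_rate -expRM_natl ler_expR.
  rewrite (@le_trans _ _ (A * (n.+1%:R * r)))//.
    by apply: ler_wpM2l; [exact: ltW|apply: enorm_polycircle => //; exact: ltW].
  rewrite [leLHS]mulrA [leRHS]mulrC; apply: ler_wpM2l; first by rewrite mulr_ge0// ltW.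
  by rewrite ler_nat geq_max leqnSn.
have hu : nc (taylor u a) * (2 * q) ^+ d <= S.
  by apply: cauchy_estimate => //; rewrite mulr_ge0// ltW.
have ha : nc ((afact a)%:R : C) <= r ^+ d.
  by rewrite nc_nat /r -natrX ler_nat afact_le.
rewrite !ncM.
have q2 : 0 < (2 * q) ^+ d by rewrite exprn_gt0// mulr_gt0.
have rd : 0 < r ^+ d by rewrite exprn_gt0.
rewrite -ler_pdivlMr// in hf; rewrite -ler_pdivlMr// in hu.
apply: (le_trans (ler_pM _ _ hf (ler_pM _ _ ha hu))) => //; first exact: mulr_ge0.
apply: eq_ler.
by rewrite exprMn exprVn; field; rewrite !expf_neq0 ?gt_eqF.
Qed.

(** The Taylor approximation on the polydisc of radius [2 (|w| + 1)] around 0, which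
    depends on [w]: the type of the remainder is larger than the type of [f] by a
    fixed factor, and the remainder tends to 0 in the corresponding step. *)
Lemma exp_taylor_approx A M f K : 0 < A -> expbound A M (\val f) ->
  expbound (2 * A * n.+1%:R) (M * expR (2 * A * n.+1%:R) * box_error R n K)
    (fun w => \val f w - taylor_sum K (\val f) w).
Proof.
move=> A0 fM w; pose r := 2 * (enorm w + 1).
have r0 : 0 < r by rewrite mulr_gt0// ltr_wpDl// enorm_ge0.
have M0 := expbound_ge0 fM.
have fr z : (forall j, nc (z 0 j) = r) -> nc (\val f z) <= M * expR (A * (n.+1%:R * r)).
  move=> zr; rewrite (le_trans (fM z))// ler_wpM2l// ler_expR.
  apply: ler_wpM2l; first exact: ltW.
  by apply: enorm_polycircle => //; exact: ltW.
have wr j : nc (w 0 j) <= r / 2.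
  by rewrite /r mulrAC divff// mul1r (le_trans (coord_le_enorm _ _))// lerDl.
rewrite (le_trans (taylor_approx K (exp_entire f) r0 fr wr))//.
apply: eq_ler.
have -> : A * (n.+1%:R * r) = 2 * A * n.+1%:R * enorm w + 2 * A * n.+1%:R.
  by rewrite /r; ring.
by rewrite expRD; ring.
Qed.

Lemma rate_gt0 A : 0 < A -> 0 < 2 * A * n.+1%:R :> R.
Proof. by move=> A0; rewrite !mulr_gt0. Qed.

(** The Taylor series of [f] converges to [f] in a step of the inductive system. *)
Lemma fb_expansion T A : 0 < A -> exists2 K0 : R, 0 <= K0 & forall f M K,
  expbound A M (\val f) ->
  nc (\val T f - \sum_(a : box K) taylor (\val f) (idx a) * \val T (emono R (idx a)))
    <= K0 * M * box_error R n K.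
Proof.
move=> A0; have [K1 K10 K1P] := dual_bound T (rate_gt0 A0).
exists (K1 * expR (2 * A * n.+1%:R)); first by rewrite mulr_ge0// expR_ge0.
move=> f M K fM.
have -> : \val T f - \sum_(a : box K) taylor (\val f) (idx a) * \val T (emono R (idx a)) =
    \val T (f - \sum_(a : box K) taylor (\val f) (idx a) *: emono R (idx a)).
  by rewrite dualB dual_sum; congr (_ - _); apply: eq_bigr => a _; rewrite dualZ.
have -> : K1 * expR (2 * A * n.+1%:R) * M * box_error R n K =
   K1 * (M * expR (2 * A * n.+1%:R) * box_error R n K) by ring.
apply: K1P; have := exp_taylor_approx K A0 fM.
rewrite (_ : (fun w => _) = \val (f - \sum_(a : box K) taylor (\val f) (idx a) *: emono R (idx a)))//.
apply/funext => w; rewrite -[RHS]/(\val f w - \val (\sum_(a : box K) _) w); congr (_ - _).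
by rewrite raddf_sum fct_sumE.
Qed.

(** Applied to [exp <z, .>], the expansion of the functional is a power series in [z]
    with coefficients [T (w ^ a) / a!], which are therefore the Taylor coefficients of
    the transform. *)
Lemma dual_mono T a : \val T (emono R a) = (afact a)%:R * taylor (fourier_borel T) a.
Proof.
have A0 : 0 < n.+1%:R :> R by rewrite ltr0n.
have [K0 K00 K0P] := fb_expansion T A0.
rewrite (taylor_unique (c := fun a => \val T (emono R a) / (afact a)%:R)).
  by rewrite mulrC divfK// afact_neq0.
move=> e e0; have [N NP] := box_error_small n (K0 * 1) e0.
exists N => K /NP KN z z1; apply: le_trans KN.
have zb : expbound n.+1%:R 1 (\val (expkerE z)).
  apply: (expboundS _ (lexx 1) (expker_bound z)); rewrite /snorm.
  rewrite (eq_bigr (fun=> 1)) => [|j _]; last exact: z1.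
  by rewrite sumr_const card_ord ler_nat.
have := K0P (expkerE z) 1 K zb; rewrite (_ : \sum_(a : box K) _ = \sum_(b : box K)
   \val T (emono R (idx b)) / (afact (idx b))%:R * mono (idx b) z)//.
by apply: eq_bigr => b _; rewrite taylor_expker; ring.
Qed.

(** By [dual_mono], [T f] is the limit of the pairings of [f] with the transform.  As
    the polycircle depends on [A] only, the bound is uniform over all functionals. *)
Lemma fourier_borel_bound T A M S f : 0 < A -> expbound A M (\val f) ->
  (forall z, (forall j, nc (z 0 j) = 2 * pair_rate A) -> nc (fourier_borel T z) <= S) ->
  nc (\val T f) <= 2 ^+ n * pair_rate A * M * S.
Proof.
move=> A0 fM TS; have [K0 K00 K0P] := fb_expansion T A0.
apply/ler_addgt0Pr => e e0.
have [N NP] := box_error_small n (K0 * M) e0.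
have := le_trans (K0P f M N fM) (NP N (leqnn _)).
rewrite (_ : \sum_(a : box N) _ = pairing N (\val f) (fourier_borel T)); last first.
  by apply: eq_bigr => a _; rewrite dual_mono.
move=> h; rewrite -[\val T f](subrK (pairing N (\val f) (fourier_borel T))).
rewrite (le_trans (ncD _ _))// addrC lerD//.
by apply: pairing_bound => //; [exact: exp_entire|exact: fourier_borel_entire].
Qed.

Lemma fourier_borel_eq0 T f : (forall z, fourier_borel T z = 0) -> \val T f = 0.
Proof.
move=> T0; have [A [M [A0 fM]]] := exp_expbound f; apply: nc_le0.
have := @fourier_borel_bound T A M 0 f A0 fM; rewrite mulr0; apply => z _.
by rewrite T0 nc0.
Qed.

(** The functional is the limit of the pairing with [u]; at [exp <z, .>] the pairing
    is the Taylor sum of [u] at [z]. *)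
Lemma fourier_borel_surj (u : Cn -> C) : entire u -> exists T, fourier_borel T = u.
Proof.
move=> ue; pose t (f : Exp) := ulim (fun K => pairing K (\val f) u).
have tl : scalar t.
  move=> c f g; rewrite /t -[RHS]ulim_scalar; congr ulim; apply/funext => K.
  rewrite -[RHS]/(c * _ + _) /pairing mulr_sumr -big_split; apply: eq_bigr => a _ /=.
  by rewrite taylor_scalar; ring.
have tb (A : R) : 0 < A -> exists K : R, forall f M, expbound A M (\val f) -> nc (t f) <= K * M.
  move=> A0; have [S S0 uS] := entire_bounded (2 * pair_rate A) ue.
  exists (2 ^+ n * pair_rate A * S) => f M fM.
  apply: (ulim_bound (N := 0)) => K _; rewrite mulrAC.
  apply: pairing_bound => //; first exact: exp_entire.
  by move=> z zr; apply: uS => j; rewrite zr.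
exists (mk_dual tl tb); apply/funext => z; rewrite /fourier_borel /= /t.
apply: ulim_lim => e e0.
pose r := 2 * (snorm z + 1).
have r0 : 0 < r by rewrite mulr_gt0// ltr_wpDl// snorm_ge0.
have [S S0 uS] := entire_bounded r ue; have [N NP] := box_error_small n S e0.
exists N => K /NP; apply: le_trans; rewrite nc_distC.
have -> : pairing K (expker z) u = taylor_sum K u z.
  by apply: eq_bigr => a _; rewrite taylor_expker; field; exact: afact_neq0.
apply: (taylor_approx K ue r0); first by move=> w wr; apply: uS => j; rewrite wr.
by move=> j; rewrite /r mulrAC divff// mul1r (le_trans (nc_le_snorm _ _))// lerDl.
Qed.

End fourier_borel_transform.

(** * Polynomials along lines *)

Section polynomial_lines.
Variables (R : realType) (n : nat).
Local Notation C := R[i].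
Local Notation Cn := 'rV[C]_n.
Local Notation K := (mpoly n C).
Implicit Types (z w v : Cn) (p q : K) (S P Q : {poly K}).

Definition ev z : K -> C := meval (fun j => z 0 j).
HB.instance Definition _ z := GRing.RMorphism.on (ev z).

Lemma evE z p : ev z p = \sum_(m <- msupp p) mcoeff m p * mono (fun j => m j) z.
Proof. exact: mevalE. Qed.

(** Coefficients are means over the torus, hence determined by the values. *)
Lemma mpoly_eval_neq0 p : p != 0 -> exists z, ev z p != 0.
Proof.
move=> p0; apply: contrapT => h; move/eqP: p0; apply.
have ev0 z : ev z p = 0 by apply/eqP; apply: contrapT => /negP h'; apply: h; exists z.
apply/mpolyP => m; rewrite mcoeff0; apply/eqP; apply: contrapT => /negP; rewrite -mcoeff_msupp => mp.
have : torus_mean (fun z => ev z p * imono (fun j => m j) z) = 0.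
  rewrite (_ : (fun z => _) = fun z : Cn => 0 * (0 : C)); first by rewrite torus_meanZ mul0r.
  by apply/funext => z; rewrite ev0 !mul0r.
have E z : ev z p * imono (fun j => m j) z = \sum_(k <- msupp p) mcoeff k p *
   (mono (fun j => k j) z * imono (fun j => m j) z).
  by rewrite evE mulr_suml; apply: eq_bigr => k _; rewrite mulrA.
under eq_fun => z do rewrite E.
rewrite torus_mean_sum (bigD1_seq m) ?msupp_uniq//= big1 ?addr0.
  rewrite torus_meanZ torus_mean_mono (_ : [forall _, _]); last by apply/forallP.
  by rewrite mulr1 => /eqP; apply/negP; rewrite -mcoeff_msupp.
move=> k km; rewrite torus_meanZ torus_mean_mono.
rewrite (_ : [forall _, _] = false) ?mulr0//; apply: contraNF km => /forallP h'.
by apply/eqP/mnmP => j; rewrite (eqP (h' j)).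
Qed.

(** The polynomial [p (z + t *: v)] in the variable [t], whose coefficients are
    polynomials in [z]. *)
Definition line_gen v (j : 'I_n) : {poly K} :=
  (mpolyX C (mnm1 j))%:P + (mpolyC n (v 0 j))%:P * 'X.

Definition line_poly v : K -> {poly K} := mmap (polyC \o @mpolyC n C) (line_gen v).
HB.instance Definition _ v := GRing.RMorphism.on (line_poly v).

Local Notation at_point z := (map_poly (ev z)).

Lemma at_pointC z p : at_point z p%:P = (ev z p)%:P.
Proof. exact: map_polyC. Qed.

Lemma line_polyE v p : line_poly v p =
  \sum_(m <- msupp p) (mpolyC n (mcoeff m p))%:P * \prod_j line_gen v j ^+ m j.
Proof. by []. Qed.

Lemma line_poly_eval v p z t : (at_point z (line_poly v p)).[t] = ev (z + t *: v) p.
Proof.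
rewrite line_polyE rmorph_sum horner_sum evE; apply: eq_bigr => m _.
rewrite rmorphM hornerM /= at_pointC hornerC /ev mevalC; congr (_ * _).
rewrite rmorph_prod horner_prod; apply: eq_bigr => j _.
rewrite rmorphXn horner_exp /=; congr (_ ^+ _).
rewrite /line_gen rmorphD rmorphM /= !at_pointC map_polyX !hornerE /ev.
by rewrite mevalXU mevalC !mxE mulrC.
Qed.

(** [P] has degree at most [k] and coefficient [c] at [k]; this form is multiplicative
    also when [c = 0]. *)
Let topc (k : nat) (P : {poly K}) c := (size P <= k.+1)%N /\ P`_k = c.

Let topcM k l P Q c d : topc k P c -> topc l Q d -> topc (k + l) (P * Q) (c * d).
Proof.
move=> [sP <-] [sQ <-]; split.
  rewrite (leq_trans (size_polyMleq _ _))//.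
  by have := leq_add sP sQ; case: (size P + size Q)%N => // m; rewrite addSn addnS ltnS.
rewrite coefM (bigD1 (Ordinal (leq_addr l k : k < (k + l).+1)%N))//= addKn big1 ?addr0//.
move=> [i /= il]; rewrite -val_eqE /= => ik.
have [ki|ik'] := ltnP k i; first by rewrite [P`_i]nth_default ?mul0r// (leq_trans sP).
rewrite [Q`__]nth_default ?mulr0// (leq_trans sQ)// ltn_subRL ltn_add2r.
by rewrite ltn_neqAle ik.
Qed.

Let topcX k P c : topc 1 P c -> topc k (P ^+ k) (c ^+ k).
Proof.
move=> tP; elim: k => [|k IH]; last by rewrite !exprS -add1n; exact: topcM.
by rewrite !expr0; split; rewrite ?size_polyC ?leq_b1// coefC.
Qed.

Let topc_prod (s : seq 'I_n) (k : 'I_n -> nat) (F : 'I_n -> {poly K}) (c : 'I_n -> K) :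
  (forall j, topc (k j) (F j) (c j)) ->
  topc (\sum_(j <- s) k j) (\prod_(j <- s) F j) (\prod_(j <- s) c j).
Proof.
move=> tF; elim: s => [|j s IH]; last by rewrite !big_cons; exact: topcM.
by rewrite !big_nil; split; rewrite ?size_polyC ?leq_b1// coefC.
Qed.

(** The coefficient of highest degree in [t] is the value at [v] of the leading
    form of [p], hence a nonzero constant for a suitable [v]. *)
Lemma line_poly_lead p : p != 0 -> exists v, exists2 c : C, c != 0 &
  lead_coef (line_poly v p) = mpolyC n c.
Proof.
move=> p0; pose d := (msize p).-1.
have sp : msize p = d.+1 by rewrite /d prednK// lt0n mmeasure_poly_eq0.
pose top := \sum_(m <- msupp p | mdeg m == d) mcoeff m p *: mpolyX C m.
have top0 : top != 0.
  have [m mp md] : exists2 m, m \in msupp p & mdeg m = d.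
    apply: contrapT => h; have : (msize p <= d)%N; last by rewrite sp ltnn.
    rewrite msizeE; apply/bigmax_leqP_seq => m mp _.
    rewrite ltn_neqAle -ltnS -sp msize_mdeg_lt// andbT.
    by apply/eqP => e; apply: h; exists m.
  apply/eqP => /(congr1 (mcoeff m)); rewrite mcoeff0 /top raddf_sum /=.
  rewrite big_mkcond (bigD1_seq m) ?msupp_uniq//= md eqxx big1 ?addr0.
    by rewrite mcoeffZ mcoeffX eqxx mulr1 => /eqP; apply/negP; rewrite -mcoeff_msupp.
  move=> k km; case: ifP => // _; rewrite mcoeffZ mcoeffX (negbTE km) mulr0//.
have [v v0] := mpoly_eval_neq0 top0; exists v, (ev v top) => //.
have tg j : topc 1 (line_gen v j) (mpolyC n (v 0 j)).
  split; last by rewrite /line_gen coefD coefC coefCM coefX mulr1 add0r.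
  rewrite /line_gen (leq_trans (size_polyD _ _))// geq_max.
  rewrite (leq_trans (size_polyC_leq1 _))//= (leq_trans (size_polyMleq _ _))//.
  by rewrite size_polyX addn2 ltnS size_polyC_leq1.
have tm m : topc (mdeg m) (\prod_j line_gen v j ^+ m j) (mpolyC n (mono (fun j => m j) v)).
  rewrite mdegE rmorph_prod; apply: topc_prod => j; rewrite rmorphXn; exact: topcX.
have sl : (size (line_poly v p) <= d.+1)%N.
  rewrite line_polyE (leq_trans (size_sum _ _ _))//; apply/bigmax_leqP_seq => m mp _.
  rewrite (leq_trans (size_polyMleq _ _))//.
  have [sm _] := tm m.
  have := leq_add (size_polyC_leq1 (mpolyC n (mcoeff m p))) sm.
  rewrite add1n; case: (_ + _)%N => // k; rewrite ltnS /= => /leq_trans; apply.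
  by rewrite -sp msize_mdeg_lt.
have cl : (line_poly v p)`_d = mpolyC n (ev v top).
  have evt : ev v top = \sum_(m <- msupp p | mdeg m == d) mcoeff m p * mono (fun j => m j) v.
    by rewrite /ev raddf_sum; apply: eq_bigr => m _; rewrite /= mevalZ mevalX.
  rewrite line_polyE coef_sum evt raddf_sum big_seq [RHS]big_mkcond [RHS]big_seq /=.
  apply: eq_bigr => m mp; rewrite coefCM; have [sm cm] := tm m.
  have [<-|md] := eqVneq (mdeg m) d.
    by rewrite cm -mpolyCM.
  rewrite nth_default ?mulr0// (leq_trans sm)//.
  by have := msize_mdeg_lt mp; rewrite sp ltnS leq_eqVlt (negbTE md).
have dl : size (line_poly v p) = d.+1.
  apply/eqP; rewrite eqn_leq sl /= ltnNge; apply: contra v0 => /leq_sizeP/(_ d (leqnn _)).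
  by rewrite cl => /eqP; rewrite mpolyC_eq0.
by rewrite lead_coefE dl.
Qed.

End polynomial_lines.

(** * Square-free polynomials over an integral domain *)

Section square_factor.
Variable K : idomainType.
Implicit Types (P Q S G : {poly K}).

(** A common factor [G] of [P] and its derivative that is coprime to its own derivative
    satisfies [d *: P = G ^+ 2 * B] for some nonzero [d]; take [S = G * B]. *)
Lemma noncoprime_derivative P : (forall k, (k.+1%:R : K) != 0) -> P != 0 ->
  ~~ coprimep P P^`() ->
  exists S Q, [/\ S != 0, (size S < size P)%N & S ^+ 2 = P * Q].
Proof.
move=> nat0 P0 ncp.
have [G [G1 GP GP' GG]] : exists G : {poly K},
    [/\ (1 < size G)%N, G %| P, G %| P^`() & coprimep G G^`()].
  have : exists G : {poly K}, [/\ (1 < size G)%N, G %| P & G %| P^`()].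
    exists (gcdp P P^`()); rewrite dvdp_gcdl dvdp_gcdr; split => //.
    rewrite ltn_neqAle eq_sym -coprimep_def ncp /= lt0n size_poly_eq0 gcdp_eq0.
    by rewrite negb_and P0.
  case=> G; have [k] := ubnP (size G); elim: k G => // k IH G sG [G1 GP GP'].
  have [GG|GG] := boolP (coprimep G G^`()); first by exists G.
  have G0 : G != 0 by rewrite -size_poly_gt0 ltnW.
  have G'0 : G^`() != 0.
    apply/eqP => /(congr1 (fun Q : {poly K} => Q`_(size G).-2)); rewrite coef0 coef_deriv.
    case: (size G) G1 (lead_coefE G) => [//|[//|s]] _ /= h.
    move=> /eqP; rewrite -mulr_natl mulf_eq0 (negbTE (nat0 _)) /= -h lead_coef_eq0.
    exact/negP.
  have gG := dvdp_gcdl G G^`(); have gG' := dvdp_gcdr G G^`().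
  apply: (IH (gcdp G G^`())).
    rewrite -ltnS (leq_trans _ sG)// !ltnS (leq_ltn_trans (dvdp_leq G'0 gG'))//.
    exact: lt_size_deriv.
  split; [|exact: dvdp_trans gG GP|exact: dvdp_trans gG GP'].
  rewrite ltn_neqAle eq_sym -coprimep_def GG /= lt0n size_poly_eq0 gcdp_eq0.
  by rewrite negb_and G0.
have G0 : G != 0 by rewrite -size_poly_gt0 ltnW.
have [[d1 A] /= d10 eA] := Pdiv.Idomain.dvdpP _ _ GP.
have GA : G %| A.
  rewrite -(Gauss_dvdpl _ GG).
  have h : d1 *: P^`() = A^`() * G + A * G^`() by rewrite -derivZ eA derivM.
  have : G %| d1 *: P^`() by rewrite -mul_polyC dvdp_mull.
  by rewrite h dvdp_addr// dvdp_mull.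
have [[d2 B] /= d20 eB] := Pdiv.Idomain.dvdpP _ _ GA.
have eP : (d2 * d1) *: P = B * G * G.
  by rewrite -scalerA eA scalerAl eB.
have d0 : d2 * d1 != 0 by rewrite mulf_neq0.
have S0 : B * G != 0.
  apply: contra P0 => /eqP BG; move: eP; rewrite BG mul0r => /eqP.
  by rewrite -mul_polyC mulf_eq0 polyC_eq0 (negbTE d0).
exists (B * G), ((d2 * d1)%:P * B); split => //.
  have : size ((d2 * d1) *: P) = size P by rewrite size_scale.
  rewrite eP size_mul// => <-.
  by case: (size G) G1 => [//|[//|s]] _; rewrite !addnS /= ltnS leq_addr.
by rewrite mulrA [P * _]mulrC mul_polyC eP; ring.
Qed.

Lemma coprime_derivative P Q : coprimep P Q ->
  exists (A B : {poly K}) (D : K), D != 0 /\ A * P + B * Q = D%:P.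
Proof.
move=> /Bezout_coprimepP[[u1 u2]] /eqpP[[c1 c2] /andP[/= c10 c20] e].
exists (c1 *: u1), (c1 *: u2), c2; split => //.
by rewrite -!scalerAl -scalerDr e -mul_polyC mulr1.
Qed.

Lemma unit_lead_division P Q : P != 0 -> lead_coef P \is a GRing.unit ->
  exists A B : {poly K}, (size B < size P)%N /\ Q = A * P + B.
Proof.
move=> P0 uP; exists (Q %/ P), (Q %% P); split; first by rewrite ltn_modp.
exact: Pdiv.IdomainUnit.divp_eq.
Qed.

End square_factor.

(** * Reduced polynomials have simple roots on generic lines *)

Section reduced_polynomials.
Variables (R : realType) (n : nat).
Local Notation C := R[i].
Local Notation Cn := 'rV[C]_n.
Local Notation K := (mpoly n C).
Implicit Types (z w v : Cn) (p q : K) (S P Q : {poly K}).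
Local Notation at_point z := (map_poly (ev z)).

Lemma reducedP p : reduced p <->
  forall (q : K) k, (0 < k)%N -> principal_ideal p (q ^+ k) -> principal_ideal p q.
Proof.
split=> [pr q k k0 qk|H].
  by rewrite pr; exists k.
apply/seteqP; split=> [q qp|q [k k0 qk]]; last exact: H qk.
by exists 1%N.
Qed.

(** Translation of the variables [z] by [t *: v], over the polynomials in [t]. *)
Definition slide v S : {poly K} := (map_poly (line_poly v) S).['X].

Lemma slideC v p : slide v p%:P = line_poly v p.
Proof. by rewrite /slide map_polyC hornerC. Qed.

Lemma slideX v : slide v 'X = 'X.
Proof. by rewrite /slide map_polyX hornerX. Qed.

Lemma slideM v P Q : slide v (P * Q) = slide v P * slide v Q.
Proof. by rewrite /slide rmorphM hornerM. Qed.

Lemma slide_sum v (I : Type) (r : seq I) (A : pred I) (F : I -> {poly K}) :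
  slide v (\sum_(i <- r | A i) F i) = \sum_(i <- r | A i) slide v (F i).
Proof. by rewrite /slide rmorph_sum horner_sum. Qed.

Lemma slide_prod v (I : Type) (r : seq I) (A : pred I) (F : I -> {poly K}) :
  slide v (\prod_(i <- r | A i) F i) = \prod_(i <- r | A i) slide v (F i).
Proof. by rewrite /slide rmorph_prod horner_prod. Qed.

Lemma slideXn v P k : slide v (P ^+ k) = slide v P ^+ k.
Proof. by rewrite /slide rmorphXn horner_exp. Qed.

Lemma slideD v P Q : slide v (P + Q) = slide v P + slide v Q.
Proof. by rewrite /slide rmorphD hornerD. Qed.

Lemma line_polyC v (c : C) : line_poly v (mpolyC n c) = (mpolyC n c)%:P.
Proof. exact: mmapC. Qed.

Lemma line_polyX v j : line_poly v (mpolyX C (mnm1 j)) = line_gen v j.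
Proof. by rewrite /line_poly mmapX mmap1U. Qed.

Lemma slideK v : cancel (slide (- v)) (slide v).
Proof.
have sC (p : K) : slide v (line_poly (- v) p) = p%:P.
  rewrite line_polyE slide_sum [in RHS](mpolyE p) rmorph_sum; apply: eq_bigr => m _.
  rewrite slideM slideC line_polyC slide_prod /= -mul_mpolyC rmorphM /=; congr (_ * _).
  rewrite mpolyXE_id rmorph_prod; apply: eq_bigr => j _.
  rewrite slideXn rmorphXn /=; congr (_ ^+ _).
  rewrite {1}/line_gen slideD slideM !slideC slideX line_polyC line_polyX /line_gen.
  by rewrite -addrA -mulrDl mxE mpolyCN polyCN addrN mul0r addr0.
move=> S; rewrite -{1}(coefK S) -[RHS]coefK poly_def !slide_sum; apply: eq_bigr => i _.
rewrite -mul_polyC slideM slideC slideXn slideX slideM sC slideXn slideX.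
by rewrite mul_polyC.
Qed.

Lemma slideKV v : cancel (slide v) (slide (- v)).
Proof. by move=> S; have := slideK (- v) S; rewrite opprK. Qed.

(** Divisibility of all coefficients passes from the square of a polynomial to
    the polynomial, by induction from the lowest coefficient. *)
Lemma reduced_coef p : reduced p -> forall S, (exists Q, S ^+ 2 = p%:P * Q) ->
  exists Q, S = p%:P * Q.
Proof.
move=> /reducedP pr; elim/poly_ind => [|S a IH] [Q SQ].
  by exists 0; rewrite mulr0.
have [b ab] : exists b, a = p * b.
  have [b _ ba] : principal_ideal p a.
    apply: (pr a 2) => //; exists (Q`_0) => //.
    have := congr1 (fun P => P.[0]) SQ.
    by rewrite horner_exp hornerD hornerMX mulr0 add0r !hornerC hornerM hornerC horner_coef0 mulrC => ->.
  by exists b; rewrite -ba mulrC.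
have [Q' SQ'] : exists Q', S = p%:P * Q'.
  apply: IH; pose U := (Q - 2 * S * 'X * b%:P - p%:P * b%:P ^+ 2).
  have e : S ^+ 2 * 'X^2 = p%:P * U.
    by rewrite /U !mulrBr -SQ ab polyCM; ring.
  exists (drop_poly 2 U); apply/polyP => i.
  by rewrite coefCM coef_drop_poly -coefCM -e coefMXn ltnNge leq_addl /= addnK.
by exists (Q' * 'X + b%:P); rewrite SQ' ab polyCM; ring.
Qed.

(** Otherwise there is an [S] of smaller degree whose square is a multiple of
    [p (z + t v)].  Undoing the substitution, the square of the translated [S] is a
    multiple of the constant [p], hence so is the translated [S] itself, and [S] is a
    multiple of [p (z + t v)], against its degree. *)
Lemma reduced_coprime p v (c : C) : reduced p -> c != 0 ->
  lead_coef (line_poly v p) = mpolyC n c ->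
  coprimep (line_poly v p) (line_poly v p)^`().
Proof.
move=> pr c0 lP; apply: contraT => ncp.
have P0 : line_poly v p != 0 by rewrite -lead_coef_eq0 lP mpolyC_eq0.
have nat0 k : (k.+1%:R : K) != 0 by rewrite -mpolyC_nat mpolyC_eq0 pnatr_eq0.
have [S [Q [S0 sS SQ]]] := noncoprime_derivative nat0 P0 ncp.
have [b Sb] : exists b, slide (- v) S = p%:P * b.
  apply: reduced_coef => //; exists (slide (- v) Q).
  by rewrite -slideXn SQ slideM -slideC slideKV.
have SP : S = line_poly v p * slide v b by rewrite -[S](slideK v) Sb slideM slideC.
have sb0 : slide v b != 0 by apply: contra S0; rewrite SP => /eqP ->; rewrite mulr0.
move: sS; rewrite SP size_mul// ltnNge => /negP[]; move: sb0; rewrite -size_poly_gt0.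
by case: (size (slide v b)) => // s _; rewrite addnS /= leq_addr.
Qed.

(** [D] comes from a Bezout relation between [line_poly v p] and its derivative,
    which can be specialized at every [z]. *)
Lemma reduced_separable p v (c : C) : reduced p -> c != 0 ->
  lead_coef (line_poly v p) = mpolyC n c ->
  exists2 D : K, D != 0 & forall z, ev z D != 0 ->
    coprimep (at_point z (line_poly v p)) (at_point z (line_poly v p))^`().
Proof.
move=> pr c0 lP; have [A [B [D [D0 e]]]] := coprime_derivative (reduced_coprime pr c0 lP).
exists D => // z zD; apply/Bezout_eq1_coprimepP.
exists ((ev z D)^-1 *: at_point z A, (ev z D)^-1 *: at_point z B) => /=.
rewrite deriv_map -!scalerAl -scalerDr -!rmorphM -rmorphD /= e map_polyC /=.
by rewrite -mul_polyC -polyCM mulVf.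
Qed.

Lemma line_poly_lead_at p v (c : C) z : c != 0 -> lead_coef (line_poly v p) = mpolyC n c ->
  lead_coef (at_point z (line_poly v p)) = c /\
  size (at_point z (line_poly v p)) = size (line_poly v p).
Proof.
move=> c0 lP; have e : ev z (lead_coef (line_poly v p)) = c by rewrite lP /ev mevalC.
have nz : ev z (lead_coef (line_poly v p)) != 0 by rewrite e.
by rewrite lead_coef_map_id0 ?rmorph0// e size_map_poly_id0.
Qed.

(** The remainder of the division by [line_poly v p], whose leading coefficient is
    invertible, is not 0: at [t = 0] a multiple of [line_poly v p] is a multiple of
    [p].  So some specialization of the remainder is not 0. *)
Lemma nondivisible_on_line p v (c : C) q : c != 0 ->
  lead_coef (line_poly v p) = mpolyC n c -> ~ principal_ideal p q ->
  exists z (P Q : {poly C}), [/\ P != 0, ~~ (P %| Q),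
    forall t, P.[t] = ev (z + t *: v) p & forall t, Q.[t] = ev (z + t *: v) q].
Proof.
move=> c0 lP qp.
have uP : lead_coef (line_poly v p) \is a GRing.unit.
  by rewrite lP; apply: rmorph_unit; rewrite unitfE.
have P0 : line_poly v p != 0 by rewrite -lead_coef_eq0 lP mpolyC_eq0.
have [A [B [sB QP]]] := unit_lead_division (line_poly v q) P0 uP.
have l0 (r : K) : (line_poly v r).[0] = r.
  rewrite line_polyE horner_sum [RHS]mpolyE; apply: eq_bigr => m _.
  rewrite hornerM hornerC horner_prod -mul_mpolyC mpolyXE_id; congr (_ * _).
  apply: eq_bigr => j _; rewrite horner_exp; congr (_ ^+ _).
  by rewrite /line_gen hornerD hornerMX mulr0 addr0 hornerC.
have B0 : B != 0.
  apply/eqP => B0; apply: qp; exists A.[0] => //.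
  by rewrite -[RHS](l0 q) QP B0 addr0 hornerM l0.
have [z zB] : exists z, ev z (lead_coef B) != 0 by apply: mpoly_eval_neq0; rewrite lead_coef_eq0.
have [_ szP] := line_poly_lead_at z c0 lP.
have B0' : at_point z B != 0.
  by apply: contra zB => /eqP B0'; rewrite lead_coefE -(coef_map (ev z)) /= B0' coef0.
exists z, (at_point z (line_poly v p)), (at_point z (line_poly v q)).
split; [|rewrite QP rmorphD rmorphM /= dvdp_addr ?dvdp_mull//|exact: line_poly_eval..].
  by rewrite -size_poly_gt0 szP size_poly_gt0.
apply/negP => /(dvdp_leq B0'); rewrite szP leqNgt => /negP; apply.
by rewrite (leq_ltn_trans _ sB)// size_poly.
Qed.

(** On the line to a point where [D] does not vanish, [D] has only finitely many
    zeros. *)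
Lemma nonzero_dense (D : K) z (e : R) : D != 0 -> 0 < e ->
  exists2 h : Cn, snorm h < e & ev (z + h) D != 0.
Proof.
move=> D0 e0; have [w w0] := mpoly_eval_neq0 D0.
pose P := at_point z (line_poly (w - z) D).
have P0 : P != 0.
  apply: contra w0 => /eqP P0; have := line_poly_eval (w - z) D z 1.
  by rewrite -/P P0 horner0 scale1r addrC subrK => <-.
have s0 : 0 < 1 + snorm (w - z) by rewrite ltr_pwDl// snorm_ge0.
pose t (k : nat) : C := (e / (1 + snorm (w - z)) / k.+2%:R)%:C.
have ti : injective t.
  move=> k l /complexI /(mulfI _) h; have {}h := h (lt0r_neq0 (divr_gt0 e0 s0)).
  by move/invr_inj: h => /eqP; rewrite eqr_nat => /eqP [].
have [k tk] : exists k, ~~ root P (t k).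
  apply: contrapT => h; have := max_poly_roots (rs := [seq t k | k <- iota 0 (size P)]) P0.
  rewrite map_inj_uniq// iota_uniq size_map size_iota ltnn => H.
  suff: false by []; apply: H => //; apply/allP => _ /mapP[k _ ->].
  by apply: contrapT => /negP h'; apply: h; exists k.
exists (t k *: (w - z)); last by rewrite -line_poly_eval.
rewrite /snorm (eq_bigr (fun j => nc (t k) * nc ((w - z) 0 j))) => [|j _]; last by rewrite mxE ncM.
rewrite -mulr_sumr -/(snorm _) nc_posreal; last by rewrite !divr_ge0// ltW.
rewrite mulrAC -mulrA mulrAC ltr_pdivrMr// ltr_pM2l//.
rewrite (@le_lt_trans _ _ (snorm (w - z)))//; last by rewrite ltrDr.
by rewrite ler_pdivrMr// ler_peMr ?snorm_ge0// ler1n.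
Qed.

End reduced_polynomials.


(** * Division of functions of exponential type *)

Section division_one_variable.
Variable R : realType.
Local Notation C := R[i].
Implicit Types (z w a t : C) (P : {poly C}) (h : C -> C).

Lemma cauchy_formula_radius h (r : R) w : (forall z, differentiable h z) -> nc w < r ->
  mean (fun t => h (r%:C * t) * (r%:C * t / (r%:C * t - w))) = h w.
Proof.
move=> dh wr; have r0 : 0 < r by exact: le_lt_trans wr.
have rn : r%:C != 0 :> C by rewrite -nc_gt0 (nc_posreal (ltW r0)).
have hr : holdisc (fun t => h (r%:C * t)).
  apply: differentiable_holdisc => t.
  apply: (@differentiable_comp _ _ _ _ (fun t => r%:C * t) h); last exact: dh.
  exact: (@differentiableZ _ _ _ id).
have w1 : nc (w / r%:C) < 1.
  by rewrite ncM ncV (nc_posreal (ltW r0)) ltr_pdivrMr// mul1r.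
have := cauchy_formula hr w1; rewrite mulrCA divff// mulr1 => <-.
apply: eq_mean => t t1; congr (_ * _).
have -> : r%:C * t - w = r%:C * (t - w / r%:C) by field.
by rewrite -mulf_div divff// mul1r.
Qed.

(** Partial fractions: the poles at common zeros of numerator and denominator do
    not contribute to Cauchy's formula. *)
Lemma cauchy_quotient h (s : seq C) (r : R) w : (forall z, differentiable h z) ->
  uniq s -> (forall a, a \in s -> nc a < r /\ h a = 0) -> nc w < r -> w \notin s ->
  mean (fun t => h (r%:C * t) * (r%:C * t / (r%:C * t - w)) / \prod_(a <- s) (r%:C * t - a)) =
    h w / \prod_(a <- s) (w - a).
Proof.
move=> dh; elim: s w => [|a s IH] w.
  move=> _ _ wr _; rewrite big_nil divr1 -(cauchy_formula_radius dh wr).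
  by apply: eq_mean => t t1; rewrite big_nil divr1.
move=> /= /andP[as' us] sP wr; rewrite inE negb_or => /andP[wa ws].
have [ar ha] := sP a (mem_head _ _).
have sP' b : b \in s -> nc b < r /\ h b = 0 by move=> bs; apply: sP; rewrite inE bs orbT.
have r0 : 0 < r by exact: le_lt_trans wr.
have rt t x : nc t = 1 -> nc x < r -> r%:C * t - x != 0.
  move=> t1 xr; rewrite subr_eq0; apply: contraTneq xr => <-.
  by rewrite ncM t1 mulr1 (nc_posreal (ltW r0)) ltxx.
have wa0 : w - a != 0 by rewrite subr_eq0.
have e1 := IH w us sP' wr ws; have e2 := IH a us sP' ar as'.
rewrite ha mul0r in e2.
transitivity ((w - a)^-1 * (h w / \prod_(b <- s) (w - b) - 0)); last first.
  by rewrite subr0 big_cons invfM mulrCA.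
rewrite -e1 -e2 -meanB -meanZ; apply: eq_mean => t t1; rewrite big_cons.
have n1 := rt t w t1 wr; have n2 := rt t a t1 ar.
rewrite invfM; move: (\prod_(_ <- _) _)^-1 => q.
by field; rewrite n1 n2 wa0.
Qed.

Lemma prod_XsubC_horner (s : seq C) t :
  (\prod_(a <- s) ('X - a%:P)).[t] = \prod_(a <- s) (t - a).
Proof. by rewrite horner_prod; apply: eq_bigr => a _; rewrite hornerXsubC. Qed.

(** [cauchy_quotient] at the point 0, where [s] lists the roots of [P], which are
    simple. *)
Lemma mean_quotient h P (r : R) : (forall z, differentiable h z) ->
  coprimep P P^`() -> (forall a, root P a -> nc a < r /\ h a = 0) -> 0 < r -> P.[0] != 0 ->
  mean (fun t => h (r%:C * t) / P.[r%:C * t]) = h 0 / P.[0].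
Proof.
move=> dh cP Pr r0 P00; have [s Ps] := closed_field_poly_normal P.
set c := lead_coef P in Ps.
have c0 : c != 0.
  by apply: contra P00 => /eqP c0; rewrite Ps c0 scale0r horner0.
have us : uniq s.
  rewrite -separable_prod_XsubC unlock.
  by move: cP; rewrite Ps derivZ coprimepZl// coprimepZr.
have sP a : a \in s -> nc a < r /\ h a = 0.
  by move=> as_; apply: Pr; rewrite Ps rootZ// root_prod_XsubC.
have s0 : 0 \notin s by rewrite -root_prod_XsubC -(rootZ _ _ c0) -Ps.
have nr : nc (0 : C) < r by rewrite nc0.
have := cauchy_quotient dh us sP nr s0 => e.
rewrite Ps hornerZ prod_XsubC_horner invfM mulrCA -e -meanZ.
apply: eq_mean => t t1; rewrite hornerZ prod_XsubC_horner invfM subr0.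
by rewrite divff ?mulr1 1?mulrCA// -nc_gt0 ncM t1 mulr1 (nc_posreal (ltW r0)).
Qed.

(** Cauchy's bound on the roots, in the form of a lower bound. *)
Lemma poly_lower_bound P (B : R) t : P != 0 -> (forall i, nc P`_i <= B) -> 1 < nc t ->
  2 * B <= nc (lead_coef P) * (nc t - 1) -> nc (lead_coef P) / 2 <= nc P.[t].
Proof.
move=> P0 PB t1 tB; pose d := (size P).-1.
have sP : d.+1 = size P by rewrite prednK// size_poly_gt0.
have B0 : 0 <= B by apply: le_trans (PB 0%N).
have l0 : 0 < nc (lead_coef P) by rewrite nc_gt0 lead_coef_eq0.
have E : P.[t] = \sum_(i < d) P`_i * t ^+ i + lead_coef P * t ^+ d.
  by rewrite horner_coef -sP big_ord_recr.
have h1 : nc (\sum_(i < d) P`_i * t ^+ i) <= B * \sum_(i < d) nc t ^+ i.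
  rewrite (le_trans (nc_sum _ _ _))// mulr_sumr ler_sum// => i _.
  by rewrite ncM ncX ler_wpM2r// exprn_ge0.
have td : 1 <= nc t ^+ d by rewrite exprn_ege1// ltW.
have h2 : nc t ^+ d - 1 = (nc t - 1) * \sum_(i < d) nc t ^+ i by exact: subrX1.
set S := \sum_(i < d) nc t ^+ i in h1 h2.
have S0 : 0 <= S by apply: sumr_ge0 => i _; exact: exprn_ge0.
have h3 : nc P.[t] >= nc (lead_coef P) * nc t ^+ d - B * S.
  rewrite E [leRHS](congr1 _ (addrC _ _)); apply: le_trans (nc_geB _ _).
    by rewrite ncM ncX lerB.
have h4 : 2 * (B * S) <= nc (lead_coef P) * (nc t ^+ d - 1).
  by rewrite h2 mulrA (le_trans (ler_wpM2r S0 tB))// mulrA.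
have h5 : nc (lead_coef P) <= nc (lead_coef P) * nc t ^+ d by rewrite ler_peMr// ltW.
lra.
Qed.

(** On the unit circle [t - a] may be replaced by [1 - conj a * t], which has the
    value 1 at 0. *)
Lemma malgrange_bound h P (M : R) : (forall z, differentiable h z) ->
  (forall t, nc t = 1 -> nc (h t * P.[t]) <= M) -> nc (lead_coef P) * nc (h 0) <= M.
Proof.
move=> dh hM; have [s Ps] := closed_field_poly_normal P; set c := lead_coef P in Ps *.
pose Q t := \prod_(a <- s) (1 - a^* * t).
have dQ t : differentiable Q t.
  rewrite /Q; elim: (s) => [|a s' IH].
    by under eq_fun => u do rewrite big_nil; exact: differentiable_cst.
  by under eq_fun => u do rewrite big_cons; apply: differentiableM.
have hQ : holdisc (fun t => h t * Q t).
  by apply: differentiable_holdisc => t; exact: differentiableM.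
have Q0 : Q 0 = 1 by rewrite /Q big1// => a _; rewrite mulr0 subr0.
have e : mean (fun t => c * (h t * Q t)) = c * h 0.
  by rewrite meanZ mean_value// Q0 mulr1.
rewrite -ncM -e; apply: mean_bound => t t1; apply: le_trans (hM t t1).
rewrite Ps hornerZ prod_XsubC_horner mulrCA !ncM /Q !nc_prod.
apply: eq_ler; congr (_ * (_ * _)).
apply: eq_bigr => a _; have t0 := circle_neq0 t1.
have -> : 1 - a^* * t = t * (t - a)^*.
  have tt : t * t^* = 1 by rewrite -sqr_normc normr_normc t1 expr1n.
  by rewrite rmorphB mulrBr tt mulrC.
by rewrite ncM t1 mul1r nc_conj.
Qed.

End division_one_variable.

(** * Division by a reduced polynomial *)

Section mean_of_parameters.
Variables (R : realType) (n : nat).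
Local Notation C := R[i].
Local Notation Cn := 'rV[C]_n.
Implicit Types (z h : Cn).

Lemma snorm0 : snorm (0 : Cn) = 0.
Proof. by rewrite /snorm big1// => j _; rewrite mxE nc0. Qed.

Lemma snormZ (t : C) h : snorm (t *: h) = nc t * snorm h.
Proof. by rewrite /snorm mulr_sumr; apply: eq_bigr => j _; rewrite mxE ncM. Qed.

Lemma snormD z h : snorm (z + h) <= snorm z + snorm h.
Proof. by rewrite -big_split ler_sum// => j _; rewrite mxE ncD. Qed.

Lemma snorm_eq0 h : snorm h = 0 -> h = 0.
Proof.
move=> h0; apply/rowP => j; rewrite mxE; apply: nc_le0.
by rewrite -h0 nc_le_snorm.
Qed.

Lemma differential_sum (f : Cn -> C) z h : differentiable f z ->
  'D_h f z = \sum_j h 0 j * 'D_(delta_mx 0 j) f z.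
Proof.
move=> df; rewrite deriveE// {1}(row_sum_delta h) linear_sum.
by apply: eq_bigr => j _; rewrite linearZ deriveE.
Qed.

(** The second order remainders of holomorphic functions that are bounded together are
    bounded uniformly in the parameter, so the expansion passes to the mean. *)
Lemma mean_differentiable (k : C -> Cn -> C) z M :
  (forall w, nc w = 1 -> forall y, snorm (y - z) <= 1 ->
     differentiable (k w) y /\ nc (k w y) <= M) ->
  differentiable (fun y => mean (fun w => k w y)) z.
Proof.
move=> kP.
have kz w : nc w = 1 -> differentiable (k w) z.
  by move=> w1; have [] := kP w w1 z; rewrite // subrr snorm0 ler01.
pose a : Cn := \row_j mean (fun w => 'D_(delta_mx 0 j) (k w) z).
suff H h : snorm h < 2^-1 -> nc (mean (fun w => k w (z + h)) - mean (fun w => k w z) - dotC a h) <=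
    2 * M * snorm h ^+ 2.
  by have [] := @quadratic_differentiable _ _ (fun y => mean (fun w => k w y)) z a _ 2^-1
    (ltac:(by rewrite invr_gt0)) H.
move=> h2; have -> : dotC a h = mean (fun w => \sum_j h 0 j * 'D_(delta_mx 0 j) (k w) z).
  by rewrite mean_sum; apply: eq_bigr => j _; rewrite meanZ mxE mulrC.
rewrite -!meanB; apply: mean_bound => w w1; rewrite -differential_sum; last exact: kz.
have [s0|s0] := eqVneq (snorm h) 0.
  rewrite (snorm_eq0 s0) addr0 subrr sub0r ncN differential_sum; last exact: kz.
  rewrite big1 ?nc0 ?snorm0 ?expr0n ?mulr0// => j _; by rewrite mxE mul0r.
have sp : 0 < snorm h by rewrite lt_def s0 snorm_ge0.
set s := snorm h in sp *; have ns : nc (s%:C : C) = s by rewrite (nc_posreal (ltW sp)).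
have sn : s%:C != 0 :> C by rewrite -nc_gt0 ns.
pose h1 := s%:C^-1 *: h.
have h1s : snorm h1 = 1 by rewrite snormZ ncV ns mulVf// gt_eqF.
pose phi (t : C) := k w (z + t *: h1).
have inb (t : C) : nc t <= 1 -> snorm (z + t *: h1 - z) <= 1.
  by rewrite addrC addrA addNr add0r snormZ h1s mulr1.
have hphi : holdisc phi.
  move=> t /inb tz; apply: differentiable_pdiff; apply: differentiable_comp => //.
  by have [] := kP w w1 _ tz.
have bphi t : nc t = 1 -> nc (phi t) <= M.
  move=> t1; have tz : nc t <= 1 by rewrite t1.
  by have [] := kP w w1 _ (inb _ tz).
have ws : nc (s%:C : C) <= 2^-1 by rewrite ns ltW.
have dphi := derivable_line_pdiff (v := h1) [set t | nc t <= 1] (diff_derivable (kz w w1)).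
have := second_order hphi bphi ws; rewrite (derivative_mean hphi dphi) ns.
rewrite /phi scale0r addr0 /h1 scalerA divff// scale1r => h3.
apply: le_trans h3; apply: eq_ler; congr (nc (_ - _)).
rewrite !differential_sum//; try exact: kz.
rewrite mulr_sumr; apply: eq_bigr => j _.
by rewrite mxE mulrA [s%:C * _]mulrA divff// mul1r.
Qed.

End mean_of_parameters.

Section exp_division.
Variables (R : realType) (n : nat).
Local Notation C := R[i].
Local Notation Cn := 'rV[C]_n.
Implicit Types (z h : Cn).

Lemma differentiable_germ (f g : Cn -> C) z (e : R) : 0 < e ->
  (forall h, snorm h < e -> f (z + h) = g (z + h)) ->
  differentiable f z -> differentiable g z.
Proof.
move=> e0 fg df; have [cf ef] := (diff_locallyP _ _).1 df.
have fz : f z = g z by rewrite -[z]addr0 fg// snorm0.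
have n0 : nbhs (0 : Cn) [set h | snorm h < e].
  apply/nbhs_rowP; exists (e / n.+1%:R); first by rewrite divr_gt0.
  move=> h hj; rewrite /= (@le_lt_trans _ _ (\sum_(j < n) e / n.+1%:R))//.
    by apply: ler_sum => j _; have := hj j; rewrite mxE subr0 => /ltW.
  by rewrite sumr_const card_ord -[ltLHS]mulr_natr mulrAC ltr_pdivrMr// ltr_pM2l// ltr_nat.
have eg : (g \o shift z = cst (g z) + ('d f z : Cn -> C) +o_ (0 : Cn) id).
  apply/eqaddoP => d d0; have /eqaddoP/(_ d d0) := ef.
  apply: filterS2 n0 => h hs; rewrite /= -[X in `|X| <= _ -> _]/(f (h + z) - (f z + 'd f z h)).
  by rewrite -[X in _ -> `|X| <= _]/(g (h + z) - (g z + 'd f z h)) (addrC h z) fg// fz.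
have dz := diff_unique cf eg.
apply/diff_locallyP; rewrite dz; split; [exact: cf|exact: eg].
Qed.

Lemma ev_entire (p : mpoly n C) : entire (fun z => ev z p).
Proof. exact: (exp_entire (epoly p)). Qed.

Section along_line.
Variables (p D : mpoly n C) (v : Cn) (c : C) (f : Cn -> C).
Hypotheses (c0 : c != 0) (lP : lead_coef (line_poly v p) = mpolyC n c) (D0 : D != 0)
  (sep : forall z, ev z D != 0 -> coprimep (map_poly (ev z) (line_poly v p))
     (map_poly (ev z) (line_poly v p))^`())
  (fe : entire f) (fp : forall z, ev z p = 0 -> f z = 0).

Let P z := map_poly (ev z) (line_poly v p).

Let P_lead z : lead_coef (P z) = c. Proof. by have [] := line_poly_lead_at z c0 lP. Qed.

Let P0 z : P z != 0. Proof. by rewrite -lead_coef_eq0 P_lead. Qed.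

Let PE z t : (P z).[t] = ev (z + t *: v) p. Proof. exact: line_poly_eval. Qed.

Let nc_c : 0 < nc c. Proof. by rewrite nc_gt0. Qed.

(** In particular the zeros of [p] on the lines in the direction [v] through the
    points of norm at most [r] have a parameter of modulus less than [rho]. *)
Let valid (rho r : R) := 0 < rho /\
  forall z, snorm z <= r -> forall t, rho <= nc t -> nc c / 2 <= nc (ev (z + t *: v) p).

Let valid_exists r : exists rho, valid rho r.
Proof.
pose N := size (line_poly v p).
have Bi i : exists B : R, 0 <= B /\ forall z, snorm z <= r -> nc (P z)`_i <= B.
  have [B B0 BP] := entire_bounded r (ev_entire (line_poly v p)`_i).
  exists B; split => // z zr; rewrite coef_map; apply: BP => j.
  exact: le_trans (nc_le_snorm z j) zr.
pose b i := projT1 (cid (Bi i)).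
have b0 i : 0 <= b i by have [] := projT2 (cid (Bi i)).
have bP i z : snorm z <= r -> nc (P z)`_i <= b i by have [_] := projT2 (cid (Bi i)); apply.
pose B := \sum_(i < N) b i; have B0 : 0 <= B by apply: sumr_ge0.
have BP i z : snorm z <= r -> nc (P z)`_i <= B.
  move=> zr; have [iN|Ni] := ltnP i N; last first.
    by rewrite nth_default ?nc0// /P; have [_ ->] := line_poly_lead_at z c0 lP.
  apply: le_trans (bP i z zr) _; rewrite /B (bigD1 (Ordinal iN))//= lerDl.
  by apply: sumr_ge0.
exists (2 + 2 * B / nc c); split; first by rewrite ltr_pwDl// divr_ge0 ?mulr_ge0.
move=> z zr t tr; rewrite -PE -(P_lead z).
have q0 : 0 <= 2 * B / nc c by rewrite divr_ge0 ?mulr_ge0.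
apply: (poly_lower_bound (B := B)) => //; first by move=> i; exact: BP.
  by move: tr; lra.
rewrite P_lead -ler_pdivrMl// mulrC; move: tr; lra.
Qed.

Let G (rho : R) z := mean (fun w => f (z + (rho%:C * w) *: v) / ev (z + (rho%:C * w) *: v) p).

Let G_differentiable rho z : valid rho (snorm z + 1) -> differentiable (G rho) z.
Proof.
move=> [rho0 vr].
have [M M0 fM] := entire_bounded (snorm z + 1 + rho * snorm v) fe.
apply: (@mean_differentiable _ _ (fun w y => f (y + (rho%:C * w) *: v) /
  ev (y + (rho%:C * w) *: v) p) z (M * (nc c / 2)^-1)) => w w1 y yz.
have yr : snorm y <= snorm z + 1.
  by rewrite -[y](subrK z) addrC (le_trans (snormD _ _))// lerD2l.
have tw : nc (rho%:C * w) = rho by rewrite ncM w1 mulr1 (nc_posreal (ltW rho0)).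
have pl := vr y yr (rho%:C * w); rewrite tw in pl; have {}pl := pl (lexx _).
have p0 : ev (y + (rho%:C * w) *: v) p != 0.
  by rewrite -nc_gt0 (lt_le_trans _ pl)// divr_gt0.
have dl (u : Cn) : differentiable (fun y : Cn => y + u) y.
  by apply: differentiableD => //; exact: differentiable_cst.
split.
  apply: differentiableM.
    by apply: (@differentiable_comp _ _ _ _ (fun y => y + (rho%:C * w) *: v) f).
  apply: differentiableV => //.
  apply: (@differentiable_comp _ _ _ _ (fun y => y + (rho%:C * w) *: v) (fun z => ev z p)) => //.
  exact: ev_entire.
apply: nc_mul_le.
  apply: fM => j; rewrite (le_trans (nc_le_snorm _ j))// (le_trans (snormD _ _))//.
  by rewrite snormZ tw lerD2r.
by rewrite ncV lef_pV2 ?posrE ?divr_gt0// nc_gt0.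
Qed.

(** For generic [z] the roots of [p] on the line are simple and [f] vanishes at them,
    so partial fractions apply. *)
Let G_generic rho z : valid rho (snorm z) -> ev z D != 0 -> ev z p != 0 ->
  G rho z = f z / ev z p.
Proof.
move=> [rho0 vr] zD zp.
have dh t : differentiable (fun t : C => f (z + t *: v)) t.
  by apply: differentiable_comp.
have := @mean_quotient _ (fun t => f (z + t *: v)) (P z) rho dh (sep zD).
rewrite PE scale0r addr0 => <- //.
  by rewrite /G; congr mean; apply/funext => w; rewrite PE.
move=> a; rewrite /root PE => /eqP pa; split; last exact: fp.
rewrite ltNge; apply/negP => /(vr z (lexx _)); rewrite pa nc0.
by rewrite leNgt divr_gt0.
Qed.

(** Generic points are dense. *)
Let dense_zero (F : Cn -> C) z : differentiable F z ->
  (forall h, snorm h < 1 -> ev (z + h) D != 0 -> ev (z + h) p != 0 -> F (z + h) = 0) ->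
  F z = 0.
Proof.
move=> dF FP; apply: nc_eq_small => e e0.
have cF : continuous_at z F by exact: differentiable_continuous.
have : nbhs z (F @^-1` [set y | nc (y - F z) < e]).
  by apply: cF; apply/nbhs_ncP; exists e.
move=> /nbhs_rowP[d d0 dP].
have p0 : p != 0.
  by apply: contra (P0 0) => /eqP e1; rewrite /P e1 !rmorph0.
have Dp : D * p != 0 by rewrite mulf_neq0.
have m0 : 0 < Num.min d 1 by rewrite lt_min d0 ltr01.
have [h] := nonzero_dense z Dp m0; rewrite lt_min => /andP[hd h1].
rewrite /ev mevalM mulf_eq0 negb_or => /andP[hD hp].
have := dP (z + h); rewrite /= FP// sub0r ncN => H; apply: ltW; apply: H => j.
by rewrite mxE addrAC subrr add0r (le_lt_trans (nc_le_snorm h j)).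
Qed.

Let valid_le rho r s : s <= r -> valid rho r -> valid rho s.
Proof. by move=> sr [r0 vr]; split => // z zs; apply: vr; exact: le_trans sr. Qed.

Let snorm_near z h : snorm h < 1 -> snorm (z + h) <= snorm z + 1.
Proof. by move=> h1; rewrite (le_trans (snormD _ _))// lerD2l ltW. Qed.

Let G_indep rho rho' z : valid rho (snorm z + 1) -> valid rho' (snorm z + 1) ->
  G rho z = G rho' z.
Proof.
move=> vr vr'; apply/eqP; rewrite -subr_eq0; apply/eqP.
apply: (@dense_zero (fun z => G rho z - G rho' z)).
  by apply: differentiableB; exact: G_differentiable.
move=> h h1 hD hp; have hz := snorm_near z h1.
by rewrite (G_generic (valid_le hz vr))// (G_generic (valid_le hz vr'))// subrr.
Qed.

Let G_quotient rho z : valid rho (snorm z + 1) -> f z = ev z p * G rho z.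
Proof.
move=> vr; apply/eqP; rewrite -subr_eq0; apply/eqP.
apply: (@dense_zero (fun z => f z - ev z p * G rho z)).
  apply: differentiableB; first exact: fe.
  by apply: differentiableM; [exact: ev_entire|exact: G_differentiable].
move=> h h1 hD hp; have hz := snorm_near z h1.
by rewrite (G_generic (valid_le hz vr))// mulrCA divff// mulr1 subrr.
Qed.

(** By density of the generic points, [f = p * G rho] and the value of [G rho] at [z]
    does not depend on [rho].  The radius has to grow with [z], but one radius serves
    for a whole neighbourhood of [z], on which the quotient is therefore holomorphic. *)
Lemma entire_quotient : exists2 g, entire g & forall z, f z = ev z p * g z.
Proof.
pose rho (k : nat) := projT1 (cid (valid_exists k%:R)).
have rhoP k : valid (rho k) k%:R := projT2 (cid (valid_exists k%:R)).
(* The radius chosen for [z] has to be valid on the unit ball around each point at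
   distance at most 1 from [z]. *)
pose N z := (Num.truncn (snorm z)).+3.
have NP z : snorm z + 2 <= (N z)%:R.
  rewrite /N -(addn2 (Num.truncn (snorm z)).+1) natrD lerD2r ltW//.
  exact: truncnS_gt.
have vN z : valid (rho (N z)) (snorm z + 1).
  by apply: valid_le (rhoP _); rewrite (le_trans _ (NP z))// lerD2l; lra.
exists (fun z => G (rho (N z)) z) => z; last exact: G_quotient.
have germ := @differentiable_germ (G (rho (N z))) (fun z => G (rho (N z)) z) z 1 ltr01.
apply: germ; last exact: G_differentiable.
move=> h h1; apply: G_indep; last exact: vN.
apply: valid_le (rhoP _); rewrite (le_trans _ (NP z))//.
by have := snorm_near z h1; lra.
Qed.

(** Malgrange's estimate on the line through [z] in the direction [v]. *)
Lemma quotient_growth g (A M : R) : 0 < A -> entire g -> (forall z, f z = ev z p * g z) ->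
  expbound A M f ->
  expbound (A * n.+1%:R) ((nc c)^-1 * (M * expR (A * snorm v))) g.
Proof.
move=> A0 ge fg fM z; have M0 := expbound_ge0 fM.
have dh t : differentiable (fun t : C => g (z + t *: v)) t.
  by apply: differentiable_comp.
have sz : snorm z <= n%:R * enorm z.
  rewrite /snorm (le_trans (ler_sum _ (G := fun=> enorm z) _))//.
    by move=> j _; exact: coord_le_enorm.
  by rewrite sumr_const card_ord mulr_natl.
have := @malgrange_bound _ (fun t => g (z + t *: v)) (P z)
  (M * expR (A * snorm v) * expR (A * n.+1%:R * enorm z)) dh.
rewrite scale0r addr0 P_lead => H.
rewrite -[leRHS]mulrA ler_pdivlMl//; apply: H => t t1.
rewrite PE mulrC -fg (le_trans (fM _))// -mulrA -expRD ler_wpM2l// ler_expR.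
rewrite -mulrA -mulrDr ler_wpM2l ?(ltW A0)// (le_trans (enorm_le_snorm _))//.
rewrite (le_trans (snormD _ _))// snormZ t1 mul1r addrC lerD2l (le_trans sz)//.
by rewrite ler_wpM2r ?enorm_ge0// ler_nat.
Qed.

End along_line.

(** The quotient is obtained on lines in a direction in which [p] has a constant
    leading coefficient; [reduced_separable] provides the generic points. *)
Lemma exp_division (p : mpoly n C) (f : Exp R n) : reduced p ->
  (forall z, zeros p z -> \val f z = 0) ->
  exists g : Exp R n, f = emul (epoly p) g.
Proof.
move=> pr fp; have [p0|p0] := eqVneq p 0.
  have -> : f = 0 by apply/val_inj/funext => z; rewrite fp// p0 /zeros /= meval0.
  by exists 0; apply/val_inj/funext => z; rewrite /= mulr0.
have [v [c c0 lP]] := line_poly_lead p0.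
have [D D0 sep] := reduced_separable pr c0 lP.
have [g ge fg] := entire_quotient c0 lP D0 sep (exp_entire f) fp.
have [A [M [A0 fM]]] := exp_expbound f.
have gM := quotient_growth c0 lP A0 ge fg fM.
have gexp : g \in @exptype R n.
  by apply/exptypeP; split => //; exists (A * n.+1%:R), ((nc c)^-1 * (M * expR (A * snorm v))).
exists (exist (fun u : Cn -> C => u \in @exptype R n) g gexp).
by apply/val_inj/funext => z; rewrite fg.
Qed.

End exp_division.

(** * Neighbourhoods in the strong dual and bounded sets *)

Section strong_topology.
Variables (R : realType) (E : preTopologicalLmodType R[i]).
Local Notation C := R[i].
Implicit Types (S : strong_dual E) (B : set E) (W : set (strong_dual E)).

Lemma entourage_ncP (A : set (C * C)) :
  entourage A <-> exists2 e : R, 0 < e & forall x y, nc (x - y) < e -> A (x, y).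
Proof.
split=> [|[e e0 eA]].
  rewrite -entourage_ballE => -[e /= e0 eA].
  case: e e0 eA => a b; rewrite ltcE /= => /andP[/eqP -> a0] eA.
  by exists a => // x y xy; apply: eA; rewrite /ball /= /ball_ normr_normc ltcR.
rewrite -entourage_ballE; exists e%:C => /=; first by rewrite ltcR.
by move=> [x y] /=; rewrite /ball /= /ball_ normr_normc ltcR; exact: eA.
Qed.

Lemma family_nbhs (U : choiceType) (fam : set U -> Prop) (f : {family fam, U -> C}) A (e : R) :
  fam A -> 0 < e -> nbhs f [set g : {family fam, U -> C} | forall y, A y -> nc (f y - g y) < e].
Proof.
move=> famA e0; have h : entourage [set xy : C * C | nc (xy.1 - xy.2) < e].
  by apply/entourage_ncP; exists e.
exact: (fam_nbhs f h famA).
Qed.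

Lemma family_cvg (T : Type) (F : set_system T) (U : choiceType) (fam : set U -> Prop)
    (h : T -> {family fam, U -> C}) (f : {family fam, U -> C}) : Filter F ->
  (forall A (e : R), fam A -> 0 < e -> F [set x | forall y, A y -> nc (f y - h x y) < e]) ->
  h @ F --> f.
Proof.
move=> FF H; apply/fam_cvgP => A famA W /uniform_nbhs[V [eV VW]].
have [e e0 eP] := (entourage_ncP V).1 eV.
apply: (@filterS _ F FF _ (fun x => W (h x)) _ (H A e famA e0)) => x hx; apply: VW => y Ay.
exact: (eP _ _ (hx y Ay)).
Qed.

Lemma strong_nbhs S B (e : R) : tvs_bounded B -> 0 < e ->
  nbhs S [set S' | forall b, B b -> nc (\val S b - \val S' b) < e].
Proof.
move=> bB e0; exact: (@initial_continuous _ _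
  (\val : strong_dual E -> {family @tvs_bounded R E, E -> C}) S _
  (@family_nbhs _ (@tvs_bounded R E) (\val S) B e bB e0)).
Qed.

Lemma strong_cvg (T : Type) (F : set_system T) (h : T -> strong_dual E) S : Filter F ->
  (forall B (e : R), tvs_bounded B -> 0 < e ->
     F [set x | forall b, B b -> nc (\val S b - \val (h x) b) < e]) ->
  h @ F --> S.
Proof.
move=> FF H W; rewrite nbhsE => -[U [[A oA AU] US] UW].
apply: (@filterS _ F FF _ (fun x => W (h x)) (fun x => UW (h x))); rewrite -AU.
have : nbhs (\val S : {family @tvs_bounded R E, E -> C}) A.
  by apply: open_nbhs_nbhs; split => //; move: US; rewrite -AU.
exact: (@family_cvg _ F _ _ (fun x => \val (h x) : {family @tvs_bounded R E, E -> C})).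
Qed.

(** The set is absorbed by the neighbourhood of 0 on which the functional is at most 1. *)
Lemma bounded_dual B S : tvs_bounded B ->
  exists2 L : R, 0 <= L & forall b, B b -> nc (\val S b) <= L.
Proof.
move=> bB; have [_ Sc] := set_mem (valP S).
have : nbhs (0 : E) (\val S @^-1` [set y | nc y < 1]).
  by apply: Sc; rewrite dual0; apply/nbhs_ncP; exists 1 => // w; rewrite subr0.
move=> /bB[r r0 rB]; exists (nc r) => // b.
move=> /(rB r); rewrite (ger0_norm (ltW r0)) lexx => /(_ isT)[x /= x1 <-].
by rewrite dualZ ncM ler_piMr// ltW.
Qed.

End strong_topology.

(** * The transform of functionals on the zero set *)

Section dual_of_zeros.
Variables (R : realType) (n : nat) (p : mpoly n R[i]).
Local Notation C := R[i].
Local Notation Cn := 'rV[C]_n.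
Local Notation Exp := (Exp R n).
Local Notation E' := (strong_dual (ExpV p)).
Implicit Types (z w : Cn) (f g : Exp) (S : E') (b : ExpV p).

Definition fbV S : {family compact, Cn -> C} := fourier_borel (transpose_resV S).

Lemma fbVE S z : fbV S z = \val S (resV p (expkerE z)).
Proof. by []. Qed.

Lemma resV_surj b : exists f, resV p f = b.
Proof.
by have [f _ fb] := set_mem (valP b); exists f; apply: val_inj.
Qed.

Lemma resV_eq0 f : (forall z, zeros p z -> \val f z = 0) -> resV p f = 0.
Proof. by move=> f0; apply/val_inj/funext => -[z pz]; apply: f0; exact: set_mem. Qed.

Lemma resV_eq0P f : resV p f = 0 -> forall z, zeros p z -> \val f z = 0.
Proof.
move=> f0 z pz; have := congr1 (fun b : ExpV p => \val b (exist _ z (mem_set pz))) f0.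
by [].
Qed.

Lemma fbV_entire_ker S : entire_ker p (fbV S).
Proof.
split; first exact: fourier_borel_entire.
apply/funext => z; rewrite dpoly_fourier_borel /= resV_eq0 ?dual0// => w pw.
by rewrite /= pw mul0r.
Qed.

Lemma fbV_linear : linear fbV.
Proof. by []. Qed.

(** For the quotient topology, continuity can be tested on the transpose. *)
Lemma dualV_intro (u : ExpV p -> C) : scalar u ->
  (forall A : R, 0 < A -> exists K : R, forall f M, expbound A M (\val f) ->
     nc (u (resV p f)) <= K * M) ->
  u \in @continuous_functional R (ExpV p).
Proof.
move=> ul ub; apply: mem_set; split => //; apply/continuousP => A oA.
have tl : scalar (u \o resV p) by move=> a f g /=; rewrite linearP ul.
have [_ /continuousP tc] := set_mem (dual_intro tl ub).
exact: tc.
Qed.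

Definition mk_dualV (u : ExpV p -> C) (ul : scalar u)
    (ub : forall A : R, 0 < A -> exists K : R, forall f M, expbound A M (\val f) ->
       nc (u (resV p f)) <= K * M) : E' := exist _ u (dualV_intro ul ub).

(** The transform determines the functional on [Exp], and every element of [ExpV p] is
    a restriction. *)
Lemma fbV_inj S S' : (forall z, fbV S z = fbV S' z) -> S = S'.
Proof.
move=> SS'; apply/val_inj/funext => b; have [f <-] := resV_surj b.
apply/eqP; rewrite -subr_eq0; apply/eqP.
apply: (@fourier_borel_eq0 _ _ (transpose_resV S - transpose_resV S')) => z.
by have := SS' z; rewrite /fbV /fourier_borel => e; apply/eqP; rewrite subr_eq0 e.
Qed.

(** If [dpoly p u = 0], the functional with transform [u] kills the multiples of
    [p], which for a reduced [p] are all the functions vanishing on the zeros. *)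
Lemma fbV_surj (u : Cn -> C) : reduced p -> entire u -> dpoly p u = 0 ->
  exists S, fbV S = u.
Proof.
move=> pr ue pu; have [T Tu] := fourier_borel_surj ue.
have [Ap [Mp [Ap0 pM]]] := exp_expbound (epoly p).
(* The functional [g |-> T (p g)] has the transform [dpoly p u]. *)
have kill g : \val T (emul (epoly p) g) = 0.
  have tl : scalar (fun g => \val T (emul (epoly p) g)).
    move=> a f h; rewrite -dualP; congr (\val T _); apply/val_inj/funext => z /=.
    rewrite -[RHS]/(a * (ev z p * \val f z) + ev z p * \val h z).
    by rewrite -[LHS]/(ev z p * (a * \val f z + \val h z)); ring.
  have tb (A : R) : 0 < A -> exists K : R, forall f M, expbound A M (\val f) ->
      nc (\val T (emul (epoly p) f)) <= K * M.
    move=> A0; have [K K0 KP] := dual_bound T (addr_gt0 Ap0 A0).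
    exists (K * Mp) => f M fM; rewrite -mulrA; apply: KP => z.
    rewrite mulrDl expRD mulrACA; exact: nc_mul_le.
  apply: (@fourier_borel_eq0 _ _ (mk_dual tl tb)) => z.
  by rewrite /fourier_borel /= -dpoly_fourier_borel Tu pu.
have fac f g : resV p f = resV p g -> \val T f = \val T g.
  move=> fg; apply/eqP; rewrite -subr_eq0 -dualB; apply/eqP.
  have [|h ->] := @exp_division _ _ p (f - g) pr; last exact: kill.
  by apply: resV_eq0P; rewrite linearB /= fg subrr.
pose lift b := projT1 (cid (resV_surj b)).
have liftK b : resV p (lift b) = b := projT2 (cid (resV_surj b)).
pose s b := \val T (lift b).
have sE f : s (resV p f) = \val T f by apply: fac; exact: liftK.
have sl : scalar s.
  move=> a b c; rewrite /s -dualP; apply: fac.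
  by rewrite liftK linearP /= !liftK.
have sb (A : R) : 0 < A -> exists K : R, forall f M, expbound A M (\val f) ->
    nc (s (resV p f)) <= K * M.
  move=> A0; have [K _ KP] := dual_bound T A0; exists K => f M fM.
  by rewrite sE; exact: KP.
exists (mk_dualV sl sb); rewrite -Tu; apply/funext => z; exact: sE.
Qed.

Lemma compact_snorm_bounded (K : set Cn) : compact K ->
  exists2 r : R, 0 <= r & forall z, K z -> snorm z <= r.
Proof.
move=> /compact_near_coveringP/(_ nat \oo (fun k z => snorm z <= k%:R) _).
case=> [z _|N _ NP]; last by exists N%:R => // z Kz; apply: (NP N) => /=.
exists ([set w | snorm (w - z) < n.+1%:R], [set k | (Num.truncn (snorm z + n.+1%:R) < k)%N]).
  split; last by exists (Num.truncn (snorm z + n.+1%:R)).+1.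
  apply/nbhs_rowP; exists 1 => // w wz /=.
  rewrite (@le_lt_trans _ _ (\sum_(j < n) 1))//.
    by apply: ler_sum => j _; have := wz j; rewrite !mxE => /ltW.
  by rewrite sumr_const card_ord ltr_nat.
move=> [w k] /= [wz kN]; rewrite -[w](subrK z) addrC.
rewrite (le_trans (snormD _ _))// (@le_trans _ _ (snorm z + n.+1%:R))//.
  by rewrite lerD2l ltW.
by rewrite (le_trans (ltW (truncnS_gt _)))// ler_nat.
Qed.

(** The norms of [exp <z, .>] in one step of the inductive system are at most 1 for all
    [z] in the compact set, and a neighbourhood of 0 contains a ball of that step. *)
Lemma bounded_exponentials (K : set Cn) : compact K ->
  tvs_bounded [set resV p (expkerE z) | z in K].
Proof.
move=> /compact_snorm_bounded[r r0 rK] U U0.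
have : nbhs (0 : Exp) (resV p @^-1` U) by apply: resV_continuous; rewrite linear0.
have A0 : 0 < r + 1 by rewrite ltr_wpDl.
move=> /indlim_nbhsP[W [_ /(_ _ A0)[e e0 eW]] WU].
exists (2 / e)%:C; first by rewrite ltcR divr_gt0.
move=> c; rewrite normr_normc lecR => ce _ [z Kz <-].
have c0 : 0 < nc c by rewrite (lt_le_trans _ ce)// divr_gt0.
have cn : c != 0 by rewrite -nc_gt0.
exists (c^-1 *: resV p (expkerE z)); last by rewrite scalerA divff// scale1r.
rewrite -linearZ; have := WU (c^-1 *: expkerE z); rewrite add0r; apply; apply: eW.
have zb : expbound (r + 1) 1 (\val (expkerE z)).
  apply: (expboundS _ (lexx 1) (expker_bound z)).
  by rewrite (le_trans (rK z Kz))// lerDl.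
apply: (le_lt_trans (expnormZ_le _ (expbound_expnorm zb))).
rewrite mulr1 lte_fin ncV invf_plt ?posrE// (lt_le_trans _ ce)//.
by rewrite -[ltLHS]mul1r ltr_pM2r ?invr_gt0// ltr1n.
Qed.

Lemma fbV_continuous : continuous fbV.
Proof.
move=> S; apply: (@family_cvg _ _ _ _ _ fbV (fbV S) (nbhs_filter S)) => K e cK e0.
apply: (@filterS _ _ (nbhs_filter S) _ _ _ (strong_nbhs S (bounded_exponentials cK) e0)).
move=> S' H z Kz; rewrite !fbVE; apply: H.
by exists z.
Qed.

End dual_of_zeros.

(** * The inverse of the transform is continuous *)

Section gliding_hump.
Variables (R : realType) (n : nat) (p : mpoly n R[i]).
Local Notation C := R[i].
Local Notation Cn := 'rV[C]_n.
Local Notation Exp := (Exp R n).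
Local Notation E' := (strong_dual (ExpV p)).
Implicit Types (z w : Cn) (f g : Exp) (S : E') (b : ExpV p) (l : seq (E' * ExpV p)).

(** The transform is at most [s] on the polydisc of radius [m]; these conditions
    describe the neighbourhoods of 0 for uniform convergence on compact sets. *)
Definition fbV_le S (m s : R) := forall z, (forall j, nc (z 0 j) <= m) -> nc (fbV S z) <= s.

Lemma fbV_leS S m m' s s' : m' <= m -> s <= s' -> fbV_le S m s -> fbV_le S m' s'.
Proof.
move=> mm ss Ss z zm; apply: le_trans ss; apply: Ss => j; exact: le_trans mm.
Qed.

(** One point [b] is a restriction from one step of the inductive system, so
    [fourier_borel_bound] applies; the bound depends on [b]. *)
Lemma point_bound b : exists m K : R, [/\ 0 <= m, 0 <= K &
  forall S s, fbV_le S m s -> nc (\val S b) <= K * s].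
Proof.
have [f <-] := resV_surj b; have [A [M [A0 fM]]] := exp_expbound f.
have q0 : 0 <= pair_rate n A := expR_ge0 _.
exists (2 * pair_rate n A), (2 ^+ n * pair_rate n A * M); split.
- by rewrite mulr_ge0.
- by rewrite !mulr_ge0 ?(expbound_ge0 fM)// exprn_ge0.
move=> S s Ss; apply: (fourier_borel_bound (T := transpose_resV S) A0 fM) => z zr.
by apply: Ss => j; rewrite zr.
Qed.

Lemma points_bound l : exists m K : R, [/\ 0 <= m, 0 <= K &
  forall S s, fbV_le S m s -> \sum_(x <- l) nc (\val S x.2) <= K * s].
Proof.
elim: l => [|x l [m [K [m0 K0 H]]]].
  by exists 0, 0; split => // S s _; rewrite big_nil mul0r.
have [m' [K' [m'0 K'0 H']]] := point_bound x.2.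
exists (m + m'), (K + K'); split; [exact: addr_ge0|exact: addr_ge0|].
move=> S s Ss; rewrite big_cons mulrDl addrC lerD//.
  by apply: H; apply: fbV_leS Ss; rewrite // lerDl.
by apply: H'; apply: fbV_leS Ss; rewrite // lerDr.
Qed.

Lemma geometric_tail m N : \sum_(m <= i < N) (2^-1 : R) ^+ i <= 2 * 2^-1 ^+ m.
Proof.
have p0 k : 0 <= (2^-1 : R) ^+ k by rewrite exprn_ge0// invr_ge0.
have [mN|Nm] := leqP m N; last by rewrite big_geq ?(ltnW Nm)// mulr_ge0.
suff <- : \sum_(m <= i < N) (2^-1 : R) ^+ i + 2 * 2^-1 ^+ N = 2 * 2^-1 ^+ m.
  by rewrite lerDl mulr_ge0.
rewrite -(subnKC mN); elim: (N - m)%N => [|k IH].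
  by rewrite addn0 big_geq// add0r.
rewrite -IH addnS big_nat_recr ?leq_addr//= exprS -addrA.
by rewrite [2 * (2^-1 * _)]mulrA divff// mul1r [2 * _]mulr_natl mulr2n.
Qed.

(** Gliding hump: were the bound to fail, there would be functionals [S_k] with
    very small transforms and points [b_k] of [B] such that [S_k] is negligible at
    the earlier points and larger at [b_k] than the sum of the earlier functionals
    on [B]; the sum of the series of the [S_k] would be unbounded on [B]. *)
Lemma fbV_lower_bound (B : set (ExpV p)) (e : R) : tvs_bounded B -> 0 < e ->
  exists m d : R, 0 < d /\ forall S, fbV_le S m d -> forall b, B b -> nc (\val S b) < e.
Proof.
move=> bB e0; apply: contrapT => H.
have {}H m d : 0 < d -> exists S b, [/\ fbV_le S m d, B b & e <= nc (\val S b)].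
  move=> d0; apply: contrapT => H'; apply: H; exists m, d; split => // S Sd b Bb.
  by rewrite ltNge; apply/negP => eb; apply: H'; exists S, b.
have Lex S : exists L : R, 0 <= L /\ forall b, B b -> nc (\val S b) <= L.
  by have [L L0 LP] := bounded_dual S bB; exists L.
pose L S := projT1 (cid (Lex S)).
have L0 S : 0 <= L S by have [] := projT2 (cid (Lex S)).
have LP S b : B b -> nc (\val S b) <= L S by have [_] := projT2 (cid (Lex S)); exact.
pose h k : R := 2^-1 ^+ k; have h0 k : 0 < h k by rewrite exprn_gt0// invr_gt0.
(* The next pair, given the list [l] of the earlier ones: a pair whose transform is
   smaller by the factor [e / D] is scaled up. *)
have hump l : exists x : E' * ExpV p, [/\ B x.2, fbV_le x.1 (size l)%:R (h (size l)),
    \sum_(y <- l) nc (\val x.1 y.2) <= h (size l) &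
    (size l)%:R + 2 + \sum_(y <- l) L y.1 <= nc (\val x.1 x.2)].
  set k := size l; have [m [K [m0 K0 KP]]] := points_bound l.
  pose D := k%:R + 2 + \sum_(y <- l) L y.1.
  have D0 : 0 < D by rewrite ltr_pwDl ?sumr_ge0// ltr_wpDl.
  have K1 : 0 < 1 + K by rewrite ltr_pwDl.
  have De : 0 < D / e by rewrite divr_gt0.
  have [S [b [Sd Bb eb]]] := H (k%:R + m) (h k / (1 + K) / (D / e))
    (divr_gt0 (divr_gt0 (h0 k) K1) De).
  have nDe : nc ((D / e)%:C : C) = D / e by rewrite nc_posreal// ltW.
  have S1 : fbV_le ((D / e)%:C *: S) (k%:R + m) (h k / (1 + K)).
    move=> z zm; rewrite fbVE -[X in nc X]/((D / e)%:C * \val S _) ncM nDe.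
    by rewrite mulrC -ler_pdivlMr//; exact: Sd.
  have hk : h k / (1 + K) * (1 + K) = h k by rewrite divfK// gt_eqF.
  have hK : 0 <= h k / (1 + K) by rewrite divr_ge0 ?ltW.
  exists ((D / e)%:C *: S, b); split => //=.
  - apply: fbV_leS S1; first by rewrite lerDl.
    by rewrite -[leRHS]hk ler_peMr// lerDl.
  - apply: (le_trans (KP _ _ (fbV_leS _ (lexx _) S1))); first by rewrite lerDr.
    by rewrite -[leRHS]hk mulrC ler_wpM2l// lerDr.
  - rewrite -[X in _ <= nc X]/((D / e)%:C * \val S b) ncM nDe.
    by rewrite -mulrA -ler_pdivrMl// mulVf ?gt_eqF// -ler_pdivrMl ?invr_gt0// invrK mulr1.
have [F FP] := choice hump.
pose hist := fix hist k := if k is k'.+1 then F (hist k') :: hist k' else [::].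
have sh k : size (hist k) = k by elim: k => //= k ->.
pose x k := F (hist k).
have xs (G : E' * ExpV p -> R) k : \sum_(y <- hist k) G y = \sum_(0 <= i < k) G (x i).
  elim: k => [|k IH]; first by rewrite big_nil big_geq.
  by rewrite big_nat_recr//= big_cons IH addrC.
have xB k : B (x k).2 by have [] := FP (hist k).
have xle k : fbV_le (x k).1 k%:R (h k) by have [_] := FP (hist k); rewrite sh.
have xprev i k : (i < k)%N -> nc (\val (x k).1 (x i).2) <= h k.
  move=> ik; have [_ _] := FP (hist k); rewrite sh -/(x k).
  rewrite (xs (fun y => nc (\val (x k).1 y.2))) => H1 _; apply: le_trans H1.
  rewrite (big_cat_nat (leq0n i.+1) ik)//= (big_nat_recr _ _ _ (leq0n i))/= -addrA addrCA lerDl.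
  by rewrite addr_ge0// sumr_ge0.
have xnew k : k%:R + 2 + \sum_(0 <= i < k) L (x i).1 <= nc (\val (x k).1 (x k).2).
  by have [_ _ _] := FP (hist k); rewrite sh -/(x k) (xs (fun y => L y.1)).
pose s b := ulim (fun N => \sum_(0 <= i < N) \val (x i).1 b).
have sl : scalar s.
  move=> a b c; rewrite /s -[RHS]ulim_scalar; congr ulim; apply/funext => N.
  rewrite -[RHS]/(a * _ + _) mulr_sumr -big_split; apply: eq_bigr => i _.
  exact: dualP.
have sb (A : R) : 0 < A -> exists K : R, forall f M, expbound A M (\val f) ->
    nc (s (resV p f)) <= K * M.
  move=> A0; pose q := pair_rate n A; have q0 : 0 <= q := expR_ge0 _.
  pose N0 := (Num.truncn (2 * q)).+1.
  have Kex i : exists K : R, forall f M, expbound A M (\val f) ->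
      nc (\val (x i).1 (resV p f)) <= K * M.
    by have [K _ KP] := dual_bound (transpose_resV (x i).1) A0; exists K.
  pose K i := projT1 (cid (Kex i)); have KP i := projT2 (cid (Kex i)).
  exists (\sum_(0 <= i < N0) K i + 2 ^+ n * q * (2 * h N0)) => f M fM.
  have M0 := expbound_ge0 fM.
  (* For [i >= N0] the polydisc of radius [i] contains the polycircle on which a
     transform controls the functional on functions of type [A]. *)
  apply: (ulim_bound (N := N0)) => N N0N.
  rewrite (big_cat_nat _ N0N)//= (le_trans (ncD _ _))// mulrDl lerD//.
    by rewrite (le_trans (nc_sum _ _ _))// mulr_suml ler_sum// => i _; exact: KP.
  rewrite (le_trans (nc_sum _ _ _))//.
  rewrite (@le_trans _ _ (\sum_(N0 <= i < N) 2 ^+ n * q * M * h i))//.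
    rewrite !big_nat; apply: ler_sum => i /andP[N0i _].
    apply: (fourier_borel_bound (T := transpose_resV (x i).1) A0 fM) => z zr.
    apply: xle => j; rewrite zr (le_trans (ltW (truncnS_gt _)))// ler_nat.
    exact: N0i.
  rewrite -mulr_sumr [leRHS]mulrAC ler_wpM2l ?geometric_tail//.
  by rewrite !mulr_ge0// exprn_ge0.
have [Ls _ LsP] := bounded_dual (mk_dualV sl sb) bB.
pose k := (Num.truncn Ls).+1.
have := LsP _ (xB k); rewrite leNgt => /negP; apply.
have kL : Ls < k%:R by exact: truncnS_gt.
(* At [(x k).2] the earlier functionals are bounded by the constants [L] and the
   later ones by a geometric series. *)
have near : nc (s (x k).2 - \val (x k).1 (x k).2) <= \sum_(0 <= i < k) L (x i).1 + 1.
  apply: (ulim_near (N := k.+1)) => N kN.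
  rewrite (big_cat_nat _ kN)//= (big_nat_recr _ _ _ (leq0n k))/= addrAC addrK.
  rewrite (le_trans (ncD _ _))// lerD//.
    by rewrite (le_trans (nc_sum _ _ _))// ler_sum// => i _; exact: LP.
  rewrite (le_trans (nc_sum _ _ _))//.
  rewrite (@le_trans _ _ (\sum_(k.+1 <= i < N) h i))//.
    by rewrite !big_nat; apply: ler_sum => i /andP[ki _]; exact: xprev.
  rewrite (le_trans (geometric_tail _ _))// exprS mulrA divff// mul1r.
  by rewrite exprn_ile1 ?invr_ge0// invf_le1// ler1n.
have := ncD (\val (x k).1 (x k).2 - s (x k).2) (s (x k).2).
rewrite subrK nc_distC => g.
have := xnew k => g2.
rewrite /=; move: g g2 near kL; lra.
Qed.

(** By linearity, [fbV_lower_bound] applied to a difference of functionals. *)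
Lemma fbV_inverse_continuous (g : {family compact, Cn -> C} -> E') :
  {in entire_ker p, cancel g (@fbV R n p)} -> {within entire_ker p, continuous g}.
Proof.
move=> gK; apply/subspace_continuousP => u uk; apply: strong_cvg => B e bB e0.
have [m [d [d0 H]]] := fbV_lower_bound bB e0.
apply: filterS (family_nbhs u (@compact_polysquare _ _ m) d0) => u' u'u u'k b Bb /=.
have := H (g u - g u') _ b Bb; apply => z zm.
rewrite fbVE -[X in nc X]/(fbV (g u) z - fbV (g u') z) !gK ?inE//.
by apply/ltW/u'u => j; exact: disc_square.
Qed.

End gliding_hump.

(** * Nonreduced polynomials *)

Section onto_reduced.
Variables (R : realType) (n : nat) (p : mpoly n R[i]).
Local Notation C := R[i].
Local Notation Cn := 'rV[C]_n.
Local Notation Exp := (Exp R n).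
Implicit Types (z v : Cn) (f g : Exp) (P Q : {poly C}).

Lemma differentiable_horner P (t : C) : differentiable (fun w : C => P.[w]) t.
Proof.
elim/poly_ind: P => [|P c IH].
  by under eq_fun => w do rewrite horner0; exact: differentiable_cst.
under eq_fun => w do rewrite hornerMXaddC.
by apply: differentiableD; [exact: differentiableM|exact: differentiable_cst].
Qed.

(** Common linear factors of [P] and [Q] are cancelled one at a time, until [P] has a
    root that [Q] has not. *)
Lemma nondivisible_root P Q : P != 0 -> ~~ (P %| Q) ->
  exists a j P1 Q1, [/\ P = ('X - a%:P) ^+ j.+1 * P1, Q = ('X - a%:P) ^+ j * Q1 & Q1.[a] != 0].
Proof.
have [k] := ubnP (size P); elim: k P Q => // k IH P Q Pk P0 PQ.
have sP : size P != 1.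
  by apply: contra PQ; rewrite size_poly_eq1 => /eqp_dvdl ->; exact: dvd1p.
have [a /factor_theorem[P' PE]] := closed_rootP P sP.
have [Qa|Qa] := eqVneq Q.[a] 0; last by exists a, 0, P', Q; rewrite expr1 expr0 mul1r mulrC.
have /factor_theorem[Q' QE] : root Q a by exact/rootP.
have P'0 : P' != 0 by apply: contra P0; rewrite PE => /eqP ->; rewrite mul0r.
have sP' : (size P' < k)%N.
  by move: Pk; rewrite PE size_Mmonic ?monicXsubC// size_XsubC addn2.
have PQ' : ~~ (P' %| Q') by apply: contra PQ => h; rewrite PE QE dvdp_mul.
have [b [j [P1 [Q1 [eP eQ Q1b]]]]] := IH P' Q' sP' P'0 PQ'.
have [ab|ab] := eqVneq a b.
  exists b, j.+1, P1, Q1; split => //; first by rewrite PE eP ab !exprS; ring.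
  by rewrite QE eQ ab !exprS; ring.
exists b, j, (('X - a%:P) * P1), (('X - a%:P) * Q1); split.
- by rewrite PE eP; ring.
- by rewrite QE eQ; ring.
by rewrite hornerM hornerXsubC mulf_neq0// subr_eq0 eq_sym.
Qed.

(** On a line on which [p] does not divide [q], take a Taylor coefficient at a root
    whose multiplicity in [p] exceeds its multiplicity in [q]. *)
Lemma separating_functional (q : mpoly n C) : p != 0 -> ~ principal_ideal p q ->
  exists T : strong_dual Exp, \val T (epoly q) != 0 /\
    forall g, \val T (emul (epoly p) g) = 0.
Proof.
move=> p0 qp; have [v [c c0 lP]] := line_poly_lead p0.
have [z [P [Q [P0 zPQ Pp Qq]]]] := nondivisible_on_line c0 lP qp.
have [a [j [P1 [Q1 [eP eQ Q1a]]]]] := nondivisible_root P0 zPQ.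
pose y (w : C) : Cn := z + (a + w) *: v.
pose t f := mean (fun w => \val f (y w) * w^-1 ^+ j).
have tl : scalar t.
  move=> k f g; rewrite /t -[RHS]mean_scalar; congr mean; apply/funext => w.
  have e (x1 x2 x3 : C) : (k * x1 + x2) * x3 = k * (x1 * x3) + x2 * x3 by ring.
  exact: (e (\val f (y w)) (\val g (y w)) (w^-1 ^+ j)).
have dQ S w : differentiable (fun w : C => S.[a + w]) w.
  apply: (@differentiable_comp _ _ _ _ (fun w => a + w) (fun w => S.[w])).
    by apply: differentiableD; first exact: differentiable_cst.
  exact: differentiable_horner.
have tb (A : R) : 0 < A -> exists K : R, forall f M, expbound A M (\val f) -> nc (t f) <= K * M.
  move=> A0; exists (expR (A * (snorm z + (nc a + 1) * snorm v))) => f M fM.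
  have M0 := expbound_ge0 fM; apply: mean_bound => w w1.
  rewrite ncM ncX ncV w1 invr1 expr1n mulr1 (le_trans (fM _))// mulrC ler_wpM2r//.
  rewrite ler_expR ler_wpM2l ?(ltW A0)// (le_trans (enorm_le_snorm _))//.
  rewrite (le_trans (snormD _ _))// lerD2l snormZ ler_wpM2r ?snorm_ge0//.
  by rewrite (le_trans (ncD _ _))// w1.
(* In the coordinate [w] centred at [a], [q] is [w ^+ j * Q1] and [p] is divisible by
   [w ^+ j.+1]. *)
exists (mk_dual tl tb); split.
  rewrite /= /t (_ : mean _ = Q1.[a])//.
  rewrite -[a in RHS]addr0 -(mean_value (f := fun w => Q1.[a + w])).
    apply: eq_mean => w w1; rewrite /= -/(ev _ _) /y -Qq eQ.
    rewrite hornerM horner_exp hornerXsubC addrAC subrr add0r mulrC exprVn mulKf//.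
    by rewrite expf_neq0// circle_neq0.
  by apply: differentiable_holdisc => w; exact: dQ.
move=> g; rewrite /= /t.
pose h w := w * (P1.[a + w] * \val g (y w)).
transitivity (mean h).
  apply: eq_mean => w w1; rewrite /= -/(ev _ _) {1}/y -Pp eP.
  rewrite hornerM horner_exp hornerXsubC addrAC subrr add0r exprS exprVn /h.
  rewrite -[sval g (y w)]/(\val g (y w)).
  by field; rewrite expf_neq0// circle_neq0.
rewrite mean_value ?/h ?mul0r//.
apply: differentiable_holdisc => w; apply: (@differentiableM _ _ id) => //.
apply: differentiableM; first exact: dQ.
apply: (@differentiable_comp _ _ _ _ y (\val g)); last exact: exp_entire.
apply: differentiableD; first exact: differentiable_cst.
by apply: (@differentiable_comp _ _ _ _ (fun w => a + w) (fun t => t *: v)).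
Qed.

(** If [p] divides [q ^+ k] but not [q], then [q] vanishes on the zeros of [p], so that
    every functional on [ExpV p] kills the restriction of [q]; the functional of
    [separating_functional] does not, although its transform is in the kernel of
    [dpoly p]. *)
Lemma onto_reduced : (forall u, entire_ker p u -> exists S, @fbV R n p S = u) -> reduced p.
Proof.
move=> onto; apply/reducedP => q k k0 qk; apply: contrapT => qp.
have p0 : p != 0.
  apply: contra_notN qp => /eqP p0; move: qk; rewrite p0 => -[a _].
  by rewrite mulr0 => /esym/eqP; rewrite expf_eq0 => /andP[_ /eqP ->]; exists 0; rewrite ?mul0r.
have [T [Tq Tp]] := separating_functional p0 qp.
have Tk : entire_ker p (fourier_borel T).
  split; first exact: fourier_borel_entire.
  by apply/funext => z; rewrite dpoly_fourier_borel Tp.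
have [S ST] := onto _ Tk.
have := dpoly_fourier_borel T q 0; rewrite -ST dpoly_fourier_borel /=.
have e0 f : emul f (expkerE 0) = f.
  apply/val_inj/funext => w; rewrite /= /expker dotCC linear0 cexp0 mulr1 //.
rewrite !e0 resV_eq0 ?dual0 => [/esym/eqP|z pz]; first exact/negP.
have [a _ aq] := qk; apply/eqP; have := congr1 (ev z) aq.
rewrite rmorphM rmorphXn /= [ev z p]pz mulr0 => /esym/eqP.
by rewrite expf_eq0 k0.
Qed.

End onto_reduced.

(* The first conjunct says that the composed mapping takes its values in the
   space O_dp of entire solutions of the equation dp(f) = 0. *)
Theorem theorem1p2 (R : realType) (n : nat) (p : mpoly.mpoly n R[i]) :
  (forall S : strong_dual (ExpV p),
     entire_ker p (fourier_borel (transpose_resV S))) /\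
  (top_linear_iso_onto (entire_ker p)
     (fun S : strong_dual (ExpV p) => fourier_borel (transpose_resV S))
   <-> reduced p).
Proof.
split; first exact: fbV_entire_ker.
split=> [[_ [_ _ onto] _ _]|pr].
  by apply: onto_reduced => u /onto[S _ Su]; exists S.
have onto u : entire_ker p u -> exists S, @fbV R n p S = u.
  by move=> [ue pu]; exact: fbV_surj.
have inj : injective (@fbV R n p) by move=> S S' SS'; apply: fbV_inj => z; rewrite SS'.
split.
- exact: fbV_linear.
- split=> [S _|S S' _ _|u /onto[S Su]]; [exact: fbV_entire_ker|exact: inj|].
  by exists S.
- exact: fbV_continuous.
have inv u : exists S, entire_ker p u -> @fbV R n p S = u.
  have [/onto[S Su]|nu] := pselect (entire_ker p u); first by exists S.
  by exists 0.
have [g gP] := choice inv; exists g.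
  by move=> S; apply: inj; apply: gP; exact: fbV_entire_ker.
by apply: fbV_inverse_continuous => u /set_mem/gP.
Qed.
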